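(* Let $(\varphi_{s,t})_{0\le s\le t<+\infty}$ be a non-trivial evolution family in the unit disk $\mathbb{D}$ with common Denjoy-Wolff point $\tau\in\mathbb{D}$. Then one and only one of the following three mutually excluding situations can happen: (1) For every $s\ge 0$, $\lim_{t\to+\infty}\varphi_{s,t}=\tau$ uniformly on compact subsets of $\mathbb{D}$. (2) For every $s\ge 0$, there exists a univalent holomorphic self-map $h_s$ of the unit disk such that $\lim_{t\to+\infty}\varphi_{s,t}=h_s$ uniformly on compact subsets of $\mathbb{D}$. (3) For every $s\ge 0$ and every $z\in\mathbb{D}\setminus\{\tau\}$, the $\omega$-limit $\omega(s,z)$ of the trajectory $t\in[s,+\infty)\mapsto\varphi_{s,t}(z)\in\mathbb{D}$ is a closed arc of the circumference defined by the boundary of a certain hyperbolic disk $D_H(\tau,r(s,z))$, where $0<r(s,z)\le\rho_{\mathbb{D}}(\tau,z)$. Moreover, case (3) holds if and only if one of the following two mutually excluding subcases holds: (3.a) For every $s\ge 0$ and every $z\in\mathbb{D}\setminus\{\tau\}$, $\omega(s,z)$ is exactly the whole circumference $\partial D_H(\tau,r(s,z))$. (3.b) For every $s\ge 0$ and every $z\in\mathbb{D}\setminus\{\tau\}$, $\omega(s,z)$ is a proper closed arc of $\partial D_H(\tau,r(s,z))$, and all of those arcs (for all $s\ge0$, $z\in\mathbb{D}\setminus\{\tau\}$) have the same associated hyperbolic angular extent.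
   Context: Evolution family: a family $(\varphi_{s,t})_{0\le s\le t<+\infty}$ of holomorphic self-maps of $\mathbb{D}=\{z\in\mathbb{C}:|z|<1\}$ such that (i) $\varphi_{s,s}=\mathrm{id}_{\mathbb{D}}$ for all $s\ge0$; (ii) $\varphi_{s,t}=\varphi_{u,t}\circ\varphi_{s,u}$ for all $0\le s\le u\le t<+\infty$; (iii) for all $z\in\mathbb{D}$ and $T>0$ there is a non-negative $k_{z,T}\in L^1([0,T],\mathbb{R})$ with $|\varphi_{s,u}(z)-\varphi_{s,t}(z)|\le\int_u^t k_{z,T}(\xi)\,d\xi$ for all $0\le s\le u\le t\le T$. It is trivial if every $\varphi_{s,t}$ is the identity, and non-trivial otherwise. Common Denjoy-Wolff point: the family has common Denjoy-Wolff point $\tau\in\overline{\mathbb{D}}$ if the Denjoy-Wolff point of each $\varphi_{s,t}$ other than the identity is $\tau$. When a self-map other than the identity has a fixed point in $\mathbb{D}$ (elliptic automorphisms included), its Denjoy-Wolff point is that unique fixed point. Univalent means holomorphic and injective. $\omega$-limit: $\omega(s,z)$ is the set of all $p\in\overline{\mathbb{D}}$ for which there is a sequence $t_n\to+\infty$ in $[s,+\infty)$ with $\varphi_{s,t_n}(z)\to p$. Hyperbolic metric: for an absolutely continuous curve $\gamma:[a,b]\to\mathbb{D}$, $\ell_{\mathbb{D}}(\gamma)=2\int_a^b\frac{|\gamma'(t)|}{1-|\gamma(t)|^2}\,dt$, and $\rho_{\mathbb{D}}(z_1,z_2)$ is the infimum of $\ell_{\mathbb{D}}(\gamma)$ over such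 curves joining $z_1$ to $z_2$. $D_H(a,r):=\{z\in\mathbb{D}:\rho_{\mathbb{D}}(z,a)<r\}$ for $a\in\mathbb{D}$, $r>0$; it is a Euclidean disk, with boundary circumference $\{z\in\mathbb{D}:\rho_{\mathbb{D}}(z,a)=r\}$. Arcs: a closed arc of the circumference with (Euclidean) center $p\in\mathbb{C}$ and radius $R>0$ is a set $\{p+Re^{i\theta}:\theta_1\le\theta\le\theta_2\}$ with $0<\theta_2-\theta_1\le2\pi$; it is proper if $\theta_2-\theta_1<2\pi$. The hyperbolic angular extent of a closed arc $A$ of $\partial D_H(a,r)$ is $\ell_{\mathbb{D}}(A)/\sinh(r)$. *)

(* Defs.v *)
From HB Require Import structures.
From mathcomp Require Import all_boot all_order all_algebra.
From mathcomp Require Import all_classical all_reals all_analysis.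
From mathcomp Require Import complex.

Set Implicit Arguments.
Unset Strict Implicit.
Unset Printing Implicit Defensive.

Import Order.TTheory GRing.Theory Num.Theory.
Import numFieldNormedType.Exports.

Local Open Scope classical_set_scope.
Local Open Scope ring_scope.
Local Open Scope complex_scope.

(* The usual topology of the numFieldType R[i], which canonical structure
   inference does not find on its own because of the head symbol [complex].
   With it, [derivable f z 1] is complex differentiability of f at z. *)
HB.instance Definition _ (R : realType) := NormedModule.copy R[i] (R[i]^o).

(* The R-valued modulus; [`|z|] lives in R[i]. *)
Notation cmod := ComplexField.Normc.normc.

Section UnitDisk.
Context {R : realType}.
Local Notation C := (R[i]).
Local Notation mu := (@lebesgue_measure R).
Implicit Types (z w p tau : C) (f h : C -> C) (s t r : R).

Definition unit_disk : set C := [set z | cmod z < 1].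

Definition closed_unit_disk : set C := [set z | cmod z <= 1].

Definition holomorphic_on (D : set C) f := forall z, D z -> derivable f z 1.

Definition holo_self_map f :=
  holomorphic_on unit_disk f /\ (forall z, unit_disk z -> unit_disk (f z)).

Definition univalent_self_map f :=
  holo_self_map f /\
  (forall z w, unit_disk z -> unit_disk w -> f z = f w -> z = w).

Definition is_identity f := forall z, unit_disk z -> f z = z.

Definition cvg_on_compacts (F : set_system (C -> C)) h :=
  forall K : set C, compact K -> K `<=` unit_disk -> {uniform K, F --> h}.

(* Only the values phi s t z with 0 <= s <= t and |z| < 1 are meaningful. *)
Definition evolution_family (phi : R -> R -> C -> C) :=
  [/\ forall s t, 0 <= s -> s <= t -> holo_self_map (phi s t),
      forall s, 0 <= s -> is_identity (phi s s),
      forall s u t z, 0 <= s -> s <= u -> u <= t -> unit_disk z ->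
        phi s t z = phi u t (phi s u z)
    & forall z T, unit_disk z -> 0 < T ->
        exists k : R -> R,
          [/\ mu.-integrable `[0, T] (EFin \o k),
              forall x, 0 <= x <= T -> 0 <= k x
            & forall s u t, 0 <= s -> s <= u -> u <= t -> t <= T ->
                ((cmod (phi s u z - phi s t z))%:E
                 <= \int[mu]_(x in `[u, t]) (k x)%:E)%E]].

Definition nontrivial_family (phi : R -> R -> C -> C) :=
  exists s t, [/\ 0 <= s, s <= t & ~ is_identity (phi s t)].

(* To be used for a holomorphic self-map f of the disk other than the
   identity: the fixed point in the disk if there is one, and otherwise the
   boundary point to which the iterates converge. *)
Definition denjoy_wolff_point f tau :=
  (unit_disk tau /\ f tau = tau) \/
  [/\ forall z, unit_disk z -> f z <> z,
      cmod tau = 1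
    & cvg_on_compacts ((fun z => iter n f z) @[n --> \oo]) (cst tau)].

Definition common_denjoy_wolff_point (phi : R -> R -> C -> C) tau :=
  closed_unit_disk tau /\
  (forall s t, 0 <= s -> s <= t -> ~ is_identity (phi s t) ->
     denjoy_wolff_point (phi s t) tau).

Definition omega_limit (phi : R -> R -> C -> C) s z : set C :=
  [set p | closed_unit_disk p /\
     exists t_ : nat -> R,
       [/\ forall n, s <= t_ n,
           t_ n @[n --> \oo] --> +oo
         & phi s (t_ n) z @[n --> \oo] --> p]].

Definition absolutely_continuous_on (a b : R) (g : R -> C) :=
  forall e : R, 0 < e -> exists2 d : R, 0 < d &
    forall (n : nat) (u v : 'I_n -> R),
      (forall i, [/\ a <= u i, u i <= v i & v i <= b]) ->
      trivIset [set: 'I_n] (fun i => [set` `]u i, v i[]) ->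
      \sum_(i < n) (v i - u i) < d ->
      \sum_(i < n) cmod (g (v i) - g (u i)) < e.

(* Meaningful where g is differentiable, hence almost everywhere on [a, b] if g
   is absolutely continuous there. *)
Definition curve_derive (g : R -> C) t : C :=
  derive1 (fun x => complex.Re (g x)) t +i* derive1 (fun x => complex.Im (g x)) t.

Definition hyp_length (a b : R) (g : R -> C) : \bar R :=
  (2%:E * \int[mu]_(t in `[a, b])
    (cmod (curve_derive g t) / (1 - cmod (g t) ^+ 2))%:E)%E.

Definition hyp_dist z w : \bar R :=
  ereal_inf [set l | exists a b (g : R -> C),
    [/\ a <= b, absolutely_continuous_on a b g,
        forall t, a <= t <= b -> unit_disk (g t),
        g a = z /\ g b = w & l = hyp_length a b g]].

Definition hyp_disk z r : set C :=
  [set w | unit_disk w /\ (hyp_dist w z < r%:E)%E].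

Definition frontier (A : set C) : set C := closure A `\` interior A.

Definition circle p (q : R) : set C := [set z | cmod (z - p) = q].

Definition circle_path p (q theta : R) : C :=
  p + (q * cos theta +i* (q * sin theta)).

(* S is the circumference with centre p and radius q, and A is its closed arc
   of the angles between th1 and th2. *)
Definition arc_data (S A : set C) p (q th1 th2 : R) :=
  [/\ 0 < q, S = circle p q, 0 < th2 - th1 <= pi *+ 2
    & A = circle_path p q @` `[th1, th2]].

Definition closed_arc_of (S A : set C) :=
  exists p q th1 th2, arc_data S A p q th1 th2.

Definition proper_closed_arc_of (S A : set C) :=
  exists p q th1 th2, arc_data S A p q th1 th2 /\ th2 - th1 < pi *+ 2.

Definition sinh (x : R) : R := (expR x - expR (- x)) / 2.

(* e is the hyperbolic angular extent of the closed arc A of the boundary of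
   D_H(z, r); it does not depend on the chosen angles th1, th2. *)
Definition hyp_extent z r (A : set C) (e : \bar R) :=
  exists p q th1 th2,
    arc_data (frontier (hyp_disk z r)) A p q th1 th2 /\
    e = (hyp_length th1 th2 (circle_path p q) / (sinh r)%:E)%E.

Definition cvg_to_point (phi : R -> R -> C -> C) tau :=
  forall s, 0 <= s -> cvg_on_compacts (phi s t @[t --> +oo]) (cst tau).

Definition cvg_to_univalent (phi : R -> R -> C -> C) :=
  forall s, 0 <= s -> exists2 h, univalent_self_map h &
    cvg_on_compacts (phi s t @[t --> +oo]) h.

Definition admissible_radius tau z r := 0 < r /\ (r%:E <= hyp_dist tau z)%E.

Definition omega_arcs (phi : R -> R -> C -> C) tau :=
  forall s z, 0 <= s -> unit_disk z -> z <> tau ->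
    exists2 r, admissible_radius tau z r &
      closed_arc_of (frontier (hyp_disk tau r)) (omega_limit phi s z).

Definition omega_circles (phi : R -> R -> C -> C) tau :=
  forall s z, 0 <= s -> unit_disk z -> z <> tau ->
    exists2 r, admissible_radius tau z r &
      omega_limit phi s z = frontier (hyp_disk tau r).

Definition omega_proper_arcs (phi : R -> R -> C -> C) tau :=
  exists e : \bar R, forall s z, 0 <= s -> unit_disk z -> z <> tau ->
    exists r, [/\ admissible_radius tau z r,
      proper_closed_arc_of (frontier (hyp_disk tau r)) (omega_limit phi s z)
      & hyp_extent tau r (omega_limit phi s z) e].

End UnitDisk.

(* Main.v *)
(** Conjugating by the Moebius involution exchanging tau and 0, the family psi
    fixes 0, so lam s t = psi_{s,t}'(0) is multiplicative and, by the Schwarz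
    lemma, t |-> |lam 0 t| decreases.  The maps g_{s,t} = psi_{s,t} / z send the
    disk to itself, and Schwarz-Pick together with a Harnack estimate gives
      |g_{s,t} a - g_{s,t} b| <= C (1 - |lam s t|) |a - b|
    and 1 - |g_{s,t} a| <= C (1 - |lam s t|) on each smaller disk.
    If |lam 0 t| -> 0, the Harnack estimate run backwards makes psi_{s,t} tend to
    0.  If not, the first estimate shows that psi_{s,t} / lam s t is Cauchy, with
    a univalent limit, so that psi_{s,t} z is asymptotic to sigma t * h_s z for the
    continuous unimodular phase sigma t = lam 0 t / |lam 0 t|.  Either sigma
    converges, which is case (2), or its limit set is an arc of the unit circle,
    the same for all s and z, and the omega-limits are the rotated arcs of radius
    |h_s z| carried back by the Moebius map.

    The Moebius map sends hyperbolic circles around tau to circles around 0, where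
    the hyperbolic length density is constant; this gives the common angular
    extent.  That the infimum of lengths of absolutely continuous curves is the
    explicit hyperbolic distance rests on the fundamental theorem of calculus for
    absolutely continuous functions, obtained from Radon-Nikodym. *)

(* All complex analysis here descends from Goursat's theorem on rectangles, through the mean value
   property, to the maximum principle. Two obstacles shape its form. The quotient psi / z is known
   at first only to be continuous at 0, so statements about bounded functions tolerate a finite
   exceptional set where differentiability is unknown. And the limit of psi / lam has to be
   holomorphic and injective: this is why increments in time are estimated by Lipschitz bounds in z,
   which control derivatives as well as values, while a matching lower bound keeps points apart.
   Neither injectivity of the maps nor non-vanishing of their multipliers is assumed. Both hold for
   short times, by closeness to the identity, and pass to all times by composition. The same
   induction in time turns the Harnack estimate into |g|^M <= |lam|, a form that is stable under
   products. Finally, a continuous phase that eventually avoids a point of the circle has a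
   continuous argument, whose lower and upper limits are the ends of the arc. *)
Require Import Defs.
From HB Require Import structures.
From mathcomp Require Import all_boot all_order all_algebra.
From mathcomp Require Import all_classical all_reals all_analysis.
From mathcomp Require Import measurable_realfun complex.
From mathcomp Require Import ring lra.

Set Implicit Arguments.
Unset Strict Implicit.
Unset Printing Implicit Defensive.

Import Order.TTheory GRing.Theory Num.Theory.
Import numFieldNormedType.Exports.

Local Open Scope classical_set_scope.
Local Open Scope ring_scope.
Local Open Scope complex_scope.

Import ComplexField.Normc.

(** * Complex differentiability *)

Section ComplexCalculus.
Context {R : realType}.
Local Notation C := R[i].
Implicit Types (z w a b c : C) (f g h : C -> C).

Lemma cmod_ge0 z : 0 <= cmod z.
Proof. by case: z => x y; exact: sqrtr_ge0. Qed.

Lemma cmodD z w : cmod (z + w) <= cmod z + cmod w.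
Proof. exact: le_normcD. Qed.

Lemma cmodN z : cmod (- z) = cmod z.
Proof. exact: normcN. Qed.

Lemma cmodC z w : cmod (z - w) = cmod (w - z).
Proof. by rewrite -cmodN opprB. Qed.

Lemma cmodB z w : cmod (z - w) <= cmod z + cmod w.
Proof. by rewrite -(cmodN w); exact: cmodD. Qed.

Lemma cmod_dist z w : cmod z - cmod w <= cmod (z - w).
Proof. by rewrite lerBlDr; have := cmodD (z - w) w; rewrite subrK. Qed.

Lemma cmod_eq0 z : (cmod z == 0) = (z == 0).
Proof. by apply/eqP/eqP => [/eq0_normc//|->]; exact: normc0. Qed.

Lemma cmod_gt0 z : (0 < cmod z) = (z != 0).
Proof. by rewrite lt_neqAle cmod_ge0 andbT eq_sym cmod_eq0. Qed.

Lemma cmodX z n : cmod (z ^+ n) = cmod z ^+ n.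
Proof. by elim: n => [|n IH]; rewrite ?expr0 ?normc1// !exprS normcM IH. Qed.

Lemma cmod_real (x : R) : cmod x%:C = `|x|.
Proof. by rewrite /= expr0n addr0 sqrtr_sqr. Qed.

Lemma sqr_cmod z : cmod z ^+ 2 = complex.Re z ^+ 2 + complex.Im z ^+ 2.
Proof. by case: z => x y /=; rewrite sqr_sqrtr ?addr_ge0 ?sqr_ge0. Qed.

Lemma mul_conj z : z * (conjc z) = (cmod z ^+ 2)%:C.
Proof. by rewrite sqr_cmod; case: z => x y; rewrite /=; simpc; congr (_ +i* _); ring. Qed.

Lemma cmod_conj z : cmod (conjc z) = cmod z.
Proof. by case: z => x y /=; rewrite sqrrN. Qed.

Lemma Re_le_cmod z : `|complex.Re z| <= cmod z.
Proof.
by rewrite -(@ler_pXn2r _ 2) ?nnegrE ?cmod_ge0// sqr_cmod real_normK ?num_real// lerDl sqr_ge0.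
Qed.

Lemma Im_le_cmod z : `|complex.Im z| <= cmod z.
Proof.
by rewrite -(@ler_pXn2r _ 2) ?nnegrE ?cmod_ge0// sqr_cmod real_normK ?num_real// lerDr sqr_ge0.
Qed.

Lemma cmod_le_ReIm z : cmod z <= `|complex.Re z| + `|complex.Im z|.
Proof.
rewrite -(@ler_pXn2r _ 2) ?nnegrE ?cmod_ge0 ?addr_ge0//.
rewrite sqr_cmod sqrrD !real_normK ?num_real//.
by rewrite -subr_ge0 [leRHS](_ : _ = `|complex.Re z| * `|complex.Im z| *+ 2) ?mulrn_wge0 ?mulr_ge0//; ring.
Qed.

Lemma ReD z w : complex.Re (z + w) = complex.Re z + complex.Re w.
Proof. by case: z; case: w. Qed.
Lemma ReN z : complex.Re (- z) = - complex.Re z.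
Proof. by case: z. Qed.
Lemma ReB z w : complex.Re (z - w) = complex.Re z - complex.Re w.
Proof. by rewrite ReD ReN. Qed.
Lemma ImD z w : complex.Im (z + w) = complex.Im z + complex.Im w.
Proof. by case: z; case: w. Qed.
Lemma ImN z : complex.Im (- z) = - complex.Im z.
Proof. by case: z. Qed.
Lemma ImB z w : complex.Im (z - w) = complex.Im z - complex.Im w.
Proof. by rewrite ImD ImN. Qed.
Lemma ReM z w : complex.Re (z * w) = complex.Re z * complex.Re w - complex.Im z * complex.Im w.
Proof. by case: z; case: w. Qed.
Lemma ImM z w : complex.Im (z * w) = complex.Re z * complex.Im w + complex.Im z * complex.Re w.
Proof. by case: z => ? ?; case: w. Qed.

Lemma complex_ext z w : complex.Re z = complex.Re w -> complex.Im z = complex.Im w -> z = w.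
Proof. by case: z => ? ?; case: w => ? ? /= -> ->. Qed.

Definition ccont f z := forall e : R, 0 < e -> exists2 d : R, 0 < d &
  forall w, cmod (w - z) < d -> cmod (f w - f z) < e.

(** The non-strict bound covers w = z, so that no punctured neighbourhood appears. [derivable_cdiff]
    identifies this with differentiability for the topology of [R[i]]. *)
Definition cdiff f z (l : C) := forall e : R, 0 < e -> exists2 d : R, 0 < d &
  forall w, cmod (w - z) < d -> cmod (f w - f z - l * (w - z)) <= e * cmod (w - z).

Lemma ccont_cst c z : ccont (fun=> c) z.
Proof. by move=> e e0; exists 1 => // w _; rewrite subrr normc0. Qed.

Lemma ccont_id z : ccont id z.
Proof. by move=> e e0; exists e. Qed.

Lemma ccont_lip f z (k : R) : (forall w, cmod (f w - f z) <= k * cmod (w - z)) -> ccont f z.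
Proof.
move=> H e e0; have k0 : 0 < `|k| + 1 by rewrite ltr_wpDl.
exists (e / (`|k| + 1)); first by rewrite divr_gt0.
move=> w; rewrite ltr_pdivlMr// mulrC => Hw; apply: le_lt_trans Hw.
apply: (le_trans (H w)); apply: ler_wpM2r; first exact: cmod_ge0.
by rewrite (le_trans (ler_norm k))// lerDl.
Qed.

Lemma ccontD f g z : ccont f z -> ccont g z -> ccont (fun w => f w + g w) z.
Proof.
move=> Hf Hg e e0; have e2 : 0 < e / 2 by rewrite divr_gt0.
have [d d0 Hd] := Hf _ e2; have [d' d'0 Hd'] := Hg _ e2.
exists (Num.min d d'); first by rewrite lt_min d0.
move=> w; rewrite lt_min => /andP[/Hd h1 /Hd' h2].
rewrite (_ : _ - _ = (f w - f z) + (g w - g z)); last ring.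
by apply: (le_lt_trans (cmodD _ _)); lra.
Qed.

Lemma ccontN f z : ccont f z -> ccont (fun w => - f w) z.
Proof.
move=> Hf e /Hf[d d0 Hd]; exists d => // w /Hd.
by rewrite -cmodN; congr (cmod _ < _); ring.
Qed.

Lemma ccontB f g z : ccont f z -> ccont g z -> ccont (fun w => f w - g w) z.
Proof. by move=> Hf Hg; apply: ccontD Hf _; exact: ccontN. Qed.

Lemma ccontM f g z : ccont f z -> ccont g z -> ccont (fun w => f w * g w) z.
Proof.
move=> Hf Hg e e0.
pose M := cmod (f z) + cmod (g z) + 1.
have M0 : 0 < M by rewrite ltr_wpDl// addr_ge0// cmod_ge0.
pose e' := Num.min 1 (e / (2 * M)).
have e'0 : 0 < e' by rewrite lt_min ltr01 divr_gt0// mulr_gt0.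
have [d d0 Hd] := Hf _ e'0; have [d' d'0 Hd'] := Hg _ e'0.
exists (Num.min d d'); first by rewrite lt_min d0.
move=> w; rewrite lt_min => /andP[/Hd h1 /Hd' h2].
rewrite (_ : _ - _ = (f w - f z) * (g w - g z) + (f w - f z) * g z + f z * (g w - g z)); last ring.
apply: (le_lt_trans (cmodD _ _)); rewrite normcM.
apply: (@le_lt_trans _ _ (e' * 1 + e' * cmod (g z) + cmod (f z) * e')).
  apply: lerD; last by rewrite ler_wpM2l ?cmod_ge0 ?ltW.
  apply: (le_trans (cmodD _ _)); rewrite !normcM; apply: lerD.
    apply: ler_pM; rewrite ?cmod_ge0 ?ltW//.
    by apply: (lt_le_trans h2); rewrite ge_min lexx.
  by rewrite ler_wpM2r ?cmod_ge0 ?ltW.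
have -> : e' * 1 + e' * cmod (g z) + cmod (f z) * e' = e' * M by rewrite /M; ring.
apply: (@le_lt_trans _ _ (e / (2 * M) * M)).
  by rewrite ler_wpM2r ?(ltW M0)// ge_min lexx orbT.
have -> : e / (2 * M) * M = e / 2 by field; rewrite gt_eqF.
by lra.
Qed.

Lemma ccontV f z : f z != 0 -> ccont f z -> ccont (fun w => (f w)^-1) z.
Proof.
move=> fz Hf e e0; have m0 : 0 < cmod (f z) by rewrite cmod_gt0.
pose m := cmod (f z).
have e'0 : 0 < Num.min (m / 2) (e * m ^+ 2 / 2).
  by rewrite lt_min !divr_gt0// mulr_gt0// exprn_gt0.
have [d d0 Hd] := Hf _ e'0; exists d => // w /Hd; rewrite lt_min => /andP[h1 h2].
have h3 : m / 2 < cmod (f w).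
  have := cmod_dist (f z) (f w); rewrite cmodC -/m; lra.
have fw : f w != 0 by rewrite -cmod_gt0; move: m0; rewrite -/m; lra.
rewrite (_ : _ - _ = - (f w - f z) / (f w * f z)); last by field; rewrite fw fz.
rewrite normcM cmodN normcV normcM ltr_pdivrMr ?mulr_gt0 ?cmod_gt0//.
apply: (lt_le_trans h2); rewrite -/m.
have : m / 2 * m <= cmod (f w) * m by rewrite ler_wpM2r// ltW.
have := ltW e0 => e0'; move=> /(ler_wpM2l e0'); congr (_ <= _); by ring.
Qed.

Lemma ccont_comp f g z : ccont f z -> ccont g (f z) -> ccont (fun w => g (f w)) z.
Proof. by move=> Hf Hg e /Hg[d /Hf[d' d'0 Hd'] Hd]; exists d' => // w /Hd' /Hd. Qed.

Lemma ccont_near f g z : (exists2 d : R, 0 < d & forall w, cmod (w - z) < d -> f w = g w) ->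
  ccont f z -> ccont g z.
Proof.
move=> [d d0 Hd] Hf e /Hf[d' d'0 Hd']; exists (Num.min d d'); first by rewrite lt_min d0.
move=> w; rewrite lt_min => /andP[h1 /Hd']; rewrite -!Hd//.
by rewrite subrr normc0.
Qed.

Lemma cdiff_near f g z l : (exists2 d : R, 0 < d & forall w, cmod (w - z) < d -> f w = g w) ->
  cdiff f z l -> cdiff g z l.
Proof.
move=> [d d0 Hd] Hf e /Hf[d' d'0 Hd']; exists (Num.min d d'); first by rewrite lt_min d0.
move=> w; rewrite lt_min => /andP[h1 /Hd']; rewrite -!Hd//.
by rewrite subrr normc0.
Qed.

(* Caratheodory's form of differentiability reduces the differentiation rules
   to the continuity rules. *)
Lemma cdiffP f z l : cdiff f z l <->
  exists q, [/\ ccont q z, q z = l & forall w, f w - f z = q w * (w - z)].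
Proof.
split=> [H|[q [Hq <- Hf]] e e0].
  pose q w := if w == z then l else (f w - f z) / (w - z).
  have qz : q z = l by rewrite /q eqxx.
  exists q; split=> //.
    move=> e e0; have e2 : 0 < e / 2 by rewrite divr_gt0.
    have [d d0 Hd] := H _ e2; exists d => // w /Hd.
    rewrite qz /q; have [_|wz] := eqVneq w z; first by rewrite subrr normc0.
    have h : 0 < cmod (w - z) by rewrite cmod_gt0 subr_eq0.
    have wz0 : w - z != 0 by rewrite subr_eq0.
    rewrite (_ : f w - f z - l * (w - z) = ((f w - f z) / (w - z) - l) * (w - z)).
      by rewrite normcM ler_pM2r//; lra.
    by field.
  move=> w; rewrite /q; case: eqVneq => [->|wz]; first by rewrite !subrr mulr0.
  by rewrite divfK// subr_eq0.
have [d d0 Hd] := Hq _ e0; exists d => // w /Hd h.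
by rewrite Hf -mulrBl normcM ler_wpM2r ?cmod_ge0// ltW.
Qed.

Lemma cdiff_cont f z l : cdiff f z l -> ccont f z.
Proof.
move=> /cdiffP[q [Hq _ Hf]].
have : ccont (fun w => q w * (w - z) + f z) z.
  by apply: ccontD; [apply: ccontM => //; apply: ccontB; [exact: ccont_id|exact: ccont_cst]|exact: ccont_cst].
apply: ccont_near; exists 1 => // w _; by rewrite -Hf subrK.
Qed.

Lemma cdiff_cst c z : cdiff (fun=> c) z 0.
Proof. by move=> e e0; exists 1 => // w _; rewrite mul0r subrr subr0 normc0 mulr_ge0 ?cmod_ge0 ?ltW. Qed.

Lemma cdiff_id z : cdiff id z 1.
Proof. by move=> e e0; exists 1 => // w _; rewrite mul1r subrr normc0 mulr_ge0 ?cmod_ge0 ?ltW. Qed.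

Lemma cdiffD f g z k l : cdiff f z k -> cdiff g z l -> cdiff (fun w => f w + g w) z (k + l).
Proof.
move=> /cdiffP[p [Hp <- Hf]] /cdiffP[q [Hq <- Hg]]; apply/cdiffP.
exists (fun w => p w + q w); split=> //; first exact: ccontD.
by move=> w; rewrite mulrDl -Hf -Hg; ring.
Qed.

Lemma cdiffM f g z k l : cdiff f z k -> cdiff g z l ->
  cdiff (fun w => f w * g w) z (k * g z + f z * l).
Proof.
move=> Hf0 Hg0; have cg := cdiff_cont Hg0; move: Hf0 Hg0.
move=> /cdiffP[p [Hp <- Hf]] /cdiffP[q [Hq <- Hg]]; apply/cdiffP.
exists (fun w => p w * g w + f z * q w); split=> //.
  by apply: ccontD; apply: ccontM => //; exact: ccont_cst.
move=> w; rewrite mulrDl -!mulrA -Hg [g w * _]mulrC mulrA -Hf; ring.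
Qed.

Lemma cdiffV f z k : f z != 0 -> cdiff f z k -> cdiff (fun w => (f w)^-1) z (- k / f z ^+ 2).
Proof.
move=> fz Hf0; have cf := cdiff_cont Hf0; move: Hf0.
move=> /cdiffP[p [Hp <- Hf]].
have nz : exists2 d : R, 0 < d & forall w, cmod (w - z) < d -> f w != 0.
  have m0 : 0 < cmod (f z) by rewrite cmod_gt0.
  have [d d0 Hd] := cf _ m0; exists d => // w /Hd; have := cmod_dist (f z) (f w).
  by rewrite cmodC -cmod_gt0; lra.
have [d d0 Hd] := nz.
(* The factorisation in [cdiffP] must hold for every w, so 1 / f is replaced at the zeros of f by
   the value that the factorisation demands; near z nothing changes. *)
pose F w := if f w == 0 then - p w / f z ^+ 2 * (w - z) + (f z)^-1 else (f w)^-1.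
apply: (@cdiff_near F); first by exists d => // w /Hd fw; rewrite /F (negPf fw).
apply/cdiffP; exists (fun w => if f w == 0 then - p w / f z ^+ 2 else - p w / (f w * f z)); split.
- apply: (@ccont_near (fun w => - p w * (f w * f z)^-1)).
    by exists d => // w /Hd fw; rewrite (negPf fw).
  apply: ccontM; first exact: ccontN.
  apply: ccontV; first by rewrite mulf_neq0.
  by apply: ccontM => //; exact: ccont_cst.
- by rewrite (negPf fz) expr2.
- move=> w; rewrite /F (negPf fz); case: ifPn => [_|fw]; first by rewrite addrK.
  have -> : p w = (f w - f z) / (w - z) \/ w = z -> - p w / (f w * f z) * (w - z) = (f w)^-1 - (f z)^-1.
    move=> [->|->]; last by rewrite !subrr mulr0.
    have [->|wz] := eqVneq w z; first by rewrite !subrr mulr0.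
    by field; rewrite subr_eq0 fw fz wz.
  by [].
  have [->|wz] := eqVneq w z; first by right.
  by left; rewrite Hf mulfK// subr_eq0.
Qed.

Lemma cdiff_comp f g z k l : cdiff f z k -> cdiff g (f z) l -> cdiff (fun w => g (f w)) z (l * k).
Proof.
move=> Hf0 Hg0; have cf := cdiff_cont Hf0; move: Hf0 Hg0.
move=> /cdiffP[p [Hp <- Hf]] /cdiffP[q [Hq <- Hg]]; apply/cdiffP.
exists (fun w => q (f w) * p w); split=> //.
  by apply: ccontM => //; exact: ccont_comp.
by move=> w; rewrite Hg Hf mulrA.
Qed.

Lemma cdiff_unique f z k l : cdiff f z k -> cdiff f z l -> k = l.
Proof.
move=> Hk Hl; apply/eqP; rewrite -subr_eq0 -cmod_eq0; apply/negP => /negP kl.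
have n0 : 0 < cmod (k - l) by rewrite lt_neqAle cmod_ge0 eq_sym kl.
have e0 : 0 < cmod (k - l) / 4 by rewrite divr_gt0.
have [d d0 Hd] := Hk _ e0; have [d' d'0 Hd'] := Hl _ e0.
pose r := Num.min d d' / 2.
have r0 : 0 < r by rewrite divr_gt0// lt_min d0.
have rd : r < d by apply: (@lt_le_trans _ _ (Num.min d d')); [rewrite /r ltr_pdivrMr// mulr_natr mulr2n ltrDl lt_min d0|rewrite ge_min lexx].
have rd' : r < d' by apply: (@lt_le_trans _ _ (Num.min d d')); [rewrite /r ltr_pdivrMr// mulr_natr mulr2n ltrDl lt_min d0|rewrite ge_min lexx orbT].
have E : cmod (z + r%:C - z) = r by rewrite addrAC subrr add0r cmod_real gtr0_norm.
have := Hd (z + r%:C); have := Hd' (z + r%:C); rewrite E => /(_ rd') h1 /(_ rd) h2.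
have : cmod ((k - l) * r%:C) <= cmod (k - l) / 4 * r + cmod (k - l) / 4 * r.
  rewrite (_ : (k - l) * r%:C = (f (z + r%:C) - f z - l * (z + r%:C - z)) - (f (z + r%:C) - f z - k * (z + r%:C - z))); last by ring.
  by apply: (le_trans (cmodB _ _)); apply: lerD.
by rewrite normcM cmod_real gtr0_norm// -mulrDl ler_pM2r//; lra.
Qed.

End ComplexCalculus.

(** * Primitives and integrals of continuous real functions *)

Section Primitive.
Context {R : realType}.
Implicit Types (h g H G : R -> R) (a b c x y : R).
Local Notation mu := (@lebesgue_measure R).

Lemma derive_within_continuous H (h : R -> R) a b :
  (forall x, a <= x <= b -> is_derive x (1:R) H (h x)) -> {within `[a, b], continuous H}.
Proof.
move=> dH; apply: derivable_within_continuous => x; rewrite in_itv/= => xab.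
by case: (dH x xab).
Qed.

Lemma increment_unique H G (h : R -> R) a b : a <= b ->
  (forall x, a <= x <= b -> is_derive x (1:R) H (h x)) ->
  (forall x, a <= x <= b -> is_derive x (1:R) G (h x)) ->
  H b - H a = G b - G a.
Proof.
move=> ab dH dG.
have dHG x : a <= x <= b -> is_derive x (1:R) (H - G) 0.
  move=> xab; rewrite -(subrr (h x)).
  by apply: is_deriveB; [exact: dH|exact: dG].
have [x||c _] := @MVT_segment R (H - G) (fun=> 0) a b ab.
- by rewrite in_itv/= => /andP[ax xb]; apply: dHG; rewrite !ltW.
- exact: derive_within_continuous dHG.
- by rewrite mul0r !fctE => /eqP; rewrite subr_eq0 => /eqP E; lra.
Qed.

Lemma primitive_right h (a : R) : continuous h ->
  exists H, forall x, a < x -> is_derive x (1:R) H (h x).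
Proof.
move=> ch.
exists (fun y => (\int[mu]_(t in `[a, y]) (h t))%R) => x ax.
have xx : x < x + 1 by rewrite ltrDl.
have [] := @continuous_FTC1_closed R h a x (x + 1) xx _ ax (ch x).
  apply: continuous_compact_integrable; first exact: segment_compact.
  exact/continuous_subspaceT.
by move=> ? <-; rewrite derive1E; exact: DeriveDef.
Qed.

(** [primitive_right] works only to the right of a base point. So the base point moves to the left
    of both x and 0, and each primitive is normalised to vanish at 0; by [GE] the value does not
    depend on the base point. *)
Lemma primitive_exists h : continuous h ->
  exists H, forall x, is_derive x (1:R) H (h x).
Proof.
move=> ch.
have /choice[G dG] a := @primitive_right h a ch.
pose low x : R := - `|x| - 1.
have GE a a' x : a < x -> a < 0 -> a' < x -> a' < 0 -> G a x - G a 0 = G a' x - G a' 0.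
  move=> ax a0 a'x a'0; have [x0|x0] := leP 0 x.
    apply: (@increment_unique _ _ h) => // t /andP[t0 tx]; apply: dG;
      exact: (lt_le_trans _ t0).
  have : G a 0 - G a x = G a' 0 - G a' x.
    apply: (@increment_unique _ _ h); first exact: ltW.
    - by move=> t /andP[t0 tx]; apply: dG; exact: (lt_le_trans _ t0).
    - by move=> t /andP[t0 tx]; apply: dG; exact: (lt_le_trans _ t0).
  by move=> E; lra.
exists (fun x => G (low x) x - G (low x) 0) => x.
pose a := - `|x| - 2.
have aE y : `|y - x| < 1 -> G (low y) y - G (low y) 0 = G a y - G a 0.
  move=> yx; have h1 := ler_norm (- y); have h2 := ler_norm (x - y).
  have h3 := ler_norm (- x); have h4 := ler_norm (y - x).
  rewrite normrN in h1; rewrite normrN in h3; rewrite distrC in h2.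
  have h5 := normr_ge0 x; have h6 := normr_ge0 y.
  by apply: GE; rewrite /low /a; lra.
have : is_derive x (1:R) (fun y => G a y - G a 0) (h x).
  rewrite -(subr0 (h x)); apply: is_deriveB; apply: dG.
  by have := ler_norm (- x); rewrite normrN /a; lra.
apply: near_eq_is_derive.
apply/nbhs_ballP; exists 1 => //= y; rewrite /ball/= distrC => yx.
by rewrite -aE.
Qed.


Definition primitive h : R -> R := get [set H | forall x, is_derive x (1:R) H (h x)].

Lemma primitiveP h : continuous h -> forall x, is_derive x (1:R) (primitive h) (h x).
Proof.
move=> /primitive_exists[H dH].
exact: (getPex (ex_intro (fun H => forall x, is_derive x (1:R) H (h x)) H dH)).
Qed.

(** As a difference of values of one chosen primitive, the integral makes sense for either order of
    a and b, and its additivity over subintervals is a ring identity. *)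
Definition int h a b := primitive h b - primitive h a.

Lemma intE h H a b : continuous h -> (forall x, is_derive x (1:R) H (h x)) ->
  int h a b = H b - H a.
Proof.
move=> /primitiveP ch dH; rewrite /int; have [ab|ba] := leP a b.
  by apply: (@increment_unique _ _ h).
have : primitive h a - primitive h b = H a - H b.
  by apply: (@increment_unique _ _ h) => //; exact: ltW.
by lra.
Qed.

Lemma int_lin h g (k : R) a b : continuous h -> continuous g ->
  int (fun x => h x + k * g x) a b = int h a b + k * int g a b.
Proof.
move=> ch cg.
have cl : continuous (fun x => h x + k * g x).
  move=> x; apply: cvgD; first exact: ch.
  by apply: cvgM; [exact: cvg_cst|exact: cg].
have dl x : is_derive x (1:R) (fun x => primitive h x + k * primitive g x) (h x + k * g x).
  apply: is_deriveD; first exact: primitiveP.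
  rewrite [X in is_derive _ _ X _](_ : _ = k *: primitive g); last by apply/funext.
  by apply: is_deriveZ; exact: primitiveP.
by rewrite (intE _ _ cl dl) /int; ring.
Qed.

Lemma int_cst (k : R) a b : int (fun=> k) a b = k * (b - a).
Proof.
have dl x : is_derive x (1:R) (fun x => k * x) k.
  rewrite [X in is_derive _ _ X _](_ : _ = k *: (id : R -> R)); last by apply/funext.
  rewrite -[X in is_derive _ _ _ X](mulr1 k); apply: (@is_deriveZ _ _ _ id k); exact: is_derive_id.
have ck : continuous (fun _ : R => k) by move=> ?; exact: cvg_cst.
by rewrite (intE _ _ ck dl) mulrBr.
Qed.

Lemma int_bound h a b (M : R) : continuous h -> a <= b ->
  (forall x, a <= x <= b -> `|h x| <= M) -> `|int h a b| <= M * (b - a).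
Proof.
move=> ch ab hM; rewrite /int.
have [x _||c cab ->] := @MVT_segment R (primitive h) h a b ab.
- exact: primitiveP.
- by apply: derive_within_continuous => x _; exact: primitiveP.
- by rewrite normrM (ger0_norm (_ : 0 <= b - a)) ?subr_ge0// ler_wpM2r ?subr_ge0// hM.
Qed.

(* If the mean of [h <= M] equals M, then a primitive of [M - h] is monotone
   and has equal values at both ends. *)
Lemma int_eq_max h a b (M : R) : continuous h -> a < b ->
  (forall x, a <= x <= b -> h x <= M) -> int h a b = M * (b - a) ->
  forall x, a < x < b -> h x = M.
Proof.
move=> ch ab hM E x /andP[ax xb].
apply/eqP; rewrite eq_le hM ?(ltW ax) ?(ltW xb)//=.
rewrite leNgt; apply/negP => hx.
pose e := (M - h x) / 2.
have e0 : 0 < e by rewrite /e; lra.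
have eE : h x = M - 2 * e by rewrite /e; lra.
have /cvgrPdist_lt/(_ e e0)/nbhs_ballP[d /= d0 Hd] := ch x.
pose d' := Num.min d (Num.min (x - a) (b - x)) / 2.
have m0 : 0 < Num.min d (Num.min (x - a) (b - x)) by rewrite !lt_min d0 !subr_gt0 ax.
have d'0 : 0 < d' by rewrite divr_gt0.
have : d' < Num.min d (Num.min (x - a) (b - x)) by rewrite /d'; lra.
rewrite !lt_min => /and3P[d'd d'a d'b].
have bd (u v k : R) : u <= v -> (forall y, u <= y <= v -> h y <= k) -> int h u v <= k * (v - u).
  move=> uv hk; rewrite /int.
  have [y _||c cuv ->] := @MVT_segment R (primitive h) h u v uv.
  - exact: primitiveP.
  - by apply: derive_within_continuous => ? _; exact: primitiveP.
  - by rewrite ler_wpM2r ?subr_ge0// hk.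
have h1 : int h a (x - d') <= M * ((x - d') - a).
  by apply: bd; [lra|move=> y /andP[? ?]; apply: hM; apply/andP; split; lra].
have h2 : int h (x - d') (x + d') <= (M - e) * ((x + d') - (x - d')).
  apply: bd; first by lra.
  move=> y /andP[y1 y2]; have : `|h x - h y| < e.
    by apply: Hd; rewrite /ball/= ltr_norml; apply/andP; split; lra.
  by rewrite ltr_norml => /andP[? ?]; lra.
have h3 : int h (x + d') b <= M * (b - (x + d')).
  by apply: bd; [lra|move=> y /andP[? ?]; apply: hM; apply/andP; split; lra].
have : int h a b = int h a (x - d') + int h (x - d') (x + d') + int h (x + d') b.
  by rewrite /int; ring.
have : 0 < e * d' by rewrite mulr_gt0.
rewrite E; nra.
Qed.

End Primitive.

(** * Bisection of rectangles *)

Section Bisection.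
Context {R : realType}.
Variable P : R -> R -> R -> R -> Prop.
Hypothesis P_split : forall a b c d, a <= b -> c <= d ->
  let x := (a + b) / 2 in let y := (c + d) / 2 in
  P a x c y -> P a x y d -> P x b c y -> P x b y d -> P a b c d.

(** Selects a quarter on which P fails. The last quarter is the default: if the other three satisfy
    P, it is bad by [P_split]. *)
Let step (r : R * R * (R * R)) :=
  let: ((a, b), (c, d)) := r in
  let x := (a + b) / 2 in let y := (c + d) / 2 in
  if `[< ~ P a x c y >] then ((a, x), (c, y)) else
  if `[< ~ P a x y d >] then ((a, x), (y, d)) else
  if `[< ~ P x b c y >] then ((x, b), (c, y)) else ((x, b), (y, d)).

Let inside (r r' : R * R * (R * R)) :=
  [/\ r'.1.1 <= r.1.1, r.1.1 <= r.1.2, r.1.2 <= r'.1.2 &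
   [/\ r'.2.1 <= r.2.1, r.2.1 <= r.2.2 & r.2.2 <= r'.2.2]].

Let bad r := ~ P r.1.1 r.1.2 r.2.1 r.2.2.

Let stepP r : r.1.1 <= r.1.2 -> r.2.1 <= r.2.2 -> bad r ->
  [/\ inside (step r) r, bad (step r),
   (step r).1.2 - (step r).1.1 = (r.1.2 - r.1.1) / 2 &
   (step r).2.2 - (step r).2.1 = (r.2.2 - r.2.1) / 2].
Proof.
case: r => -[a b] [c d] /= ab cd br; rewrite /step /inside /bad.
case: asboolP => [h|/contrapT h1]; first by split => //=; [split; [lra|lra|lra|split; lra]|lra|lra].
case: asboolP => [h|/contrapT h2]; first by split => //=; [split; [lra|lra|lra|split; lra]|lra|lra].
case: asboolP => [h|/contrapT h3]; first by split => //=; [split; [lra|lra|lra|split; lra]|lra|lra].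
split=> //=; [split; [lra|lra|lra|split; lra]| |lra|lra].
by move=> h4; apply: br; exact: P_split.
Qed.

(** If P failed, nested bad quarters would shrink to a point (x, y), against the local hypothesis
    there. That hypothesis concerns rectangles containing the point, which is what differentiability
    at the point can supply. *)
Lemma bisection a0 b0 c0 d0 : a0 <= b0 -> c0 <= d0 ->
  (forall x y, a0 <= x <= b0 -> c0 <= y <= d0 -> exists2 e : R, 0 < e &
     forall a b c d, a0 <= a -> a <= x <= b -> b <= b0 ->
       c0 <= c -> c <= y <= d -> d <= d0 -> (b - a) + (d - c) < e -> P a b c d) ->
  P a0 b0 c0 d0.
Proof.
move=> ab cd loc; apply: contrapT => nP.
pose r n := iter n step ((a0, b0), (c0, d0)).
have rP n : [/\ inside (r n) ((a0, b0), (c0, d0)), bad (r n),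
    (r n).1.2 - (r n).1.1 = (b0 - a0) / 2 ^+ n & (r n).2.2 - (r n).2.1 = (d0 - c0) / 2 ^+ n].
  elim: n => [|n [[i1 i2 i3 [i4 i5 i6]] bn e1 e2]].
    by rewrite /r /= !expr0 !divr1; split.
  have [[j1 j2 j3 [j4 j5 j6]] ? f1 f2] := stepP i2 i5 bn.
  have two0 : (2 : R) ^+ n != 0 by rewrite expf_neq0.
  rewrite /r iterS; split=> //.
  - by split; rewrite ?(le_trans i1)// ?(le_trans _ i3)//; split; rewrite ?(le_trans i4)// ?(le_trans _ i6).
  - by rewrite f1 e1 exprS; field.
  - by rewrite f2 e2 exprS; field.
have rS n : inside (r n.+1) (r n).
  have [[_ i2 _ [_ i5 _]] bn _ _] := rP n.
  by rewrite /r iterS; have [] := stepP i2 i5 bn.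
have mono m n : (m <= n)%N -> inside (r n) (r m).
  elim: n => [|n IH]; first by rewrite leqn0 => /eqP ->; have [[_ ? _ [_ ? _]] _ _ _] := rP 0%N; split.
  rewrite leq_eqVlt => /predU1P[->|]; first by have [[_ ? _ [_ ? _]] _ _ _] := rP n.+1; split.
  rewrite ltnS => /IH[i1 i2 i3 [i4 i5 i6]]; have [j1 j2 j3 [j4 j5 j6]] := rS n.
  by split; rewrite ?(le_trans i1)// ?(le_trans _ i3)//; split; rewrite ?(le_trans i4)// ?(le_trans _ i6).
have lim (A B : nat -> R) : (forall m n, (m <= n)%N -> [/\ A m <= A n, A n <= B n & B n <= B m]) ->
    exists x, forall n, A n <= x <= B n.
  move=> AB; have ub m : ubound (range A) (B m).
    move=> _ [n _ <-]; have [mn|/ltnW nm] := leqP m n.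
      by have [_ h1 h2] := AB _ _ mn; exact: le_trans h2.
    by have [h1 h2 _] := AB _ _ nm; exact: le_trans h2.
  exists (sup (range A)) => n; apply/andP; split.
    by apply: ub_le_sup; [exists (B 0%N); exact: ub|exists n].
  by apply: ge_sup; [exists (A 0%N), 0%N|exact: ub].
have [x xP] := lim (fun n => (r n).1.1) (fun n => (r n).1.2)
  (fun m n mn => let: And4 h1 h2 h3 _ := mono m n mn in And3 h1 h2 h3).
have [y yP] := lim (fun n => (r n).2.1) (fun n => (r n).2.2)
  (fun m n mn => let: And4 _ _ _ (And3 h1 h2 h3) := mono m n mn in And3 h1 h2 h3).
have [e e0 He] := loc x y (xP 0%N) (yP 0%N).
have [n nP'] : exists n : nat, ((b0 - a0) + (d0 - c0)) / 2 ^+ n < e.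
  pose n := Num.truncn (((b0 - a0) + (d0 - c0)) / e).
  exists n.+1; rewrite ltr_pdivrMr ?exprn_gt0// mulrC -ltr_pdivrMr//.
  have := truncnS_gt (((b0 - a0) + (d0 - c0)) / e); move/lt_le_trans; apply.
  by rewrite -natrX ler_nat ltnW// ltn_expl.
have [[i1 i2 i3 [i4 i5 i6]] bn e1 e2] := rP n.
by apply: bn; apply: He => //; rewrite e1 e2 -mulrDl.
Qed.

End Bisection.

(** * Goursat's theorem *)

Section Curves.
Context {R : realType}.
Local Notation C := R[i].

Definition curve_cont (g : R -> C) x := forall e : R, 0 < e -> exists2 d : R, 0 < d &
  forall y, `|y - x| < d -> cmod (g y - g x) < e.

Lemma curve_cont_comp (F : C -> C) (g : R -> C) x :
  curve_cont g x -> ccont F (g x) -> curve_cont (F \o g) x.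
Proof. by move=> Hg HF e /HF[d /Hg[d' d'0 Hd'] Hd]; exists d' => // y /Hd' /Hd. Qed.

Lemma curve_cont_lip (g : R -> C) x (k : R) :
  (forall y, cmod (g y - g x) <= k * `|y - x|) -> curve_cont g x.
Proof.
move=> H e e0; have k0 : 0 < `|k| + 1 by rewrite ltr_wpDl.
exists (e / (`|k| + 1)); first by rewrite divr_gt0.
move=> y; rewrite ltr_pdivlMr// mulrC => Hy; apply: le_lt_trans Hy.
apply: (le_trans (H y)); apply: ler_wpM2r => //.
by rewrite (le_trans (ler_norm k))// lerDl.
Qed.

Lemma continuous_eps (h : R -> R) x :
  (forall e : R, 0 < e -> exists2 d : R, 0 < d & forall y, `|y - x| < d -> `|h y - h x| < e) ->
  {for x, continuous h}.
Proof.
move=> H; apply/cvgrPdist_lt => e /H[d d0 Hd]; apply/nbhs_ballP; exists d => //= y.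
by rewrite /ball/= distrC => /Hd; rewrite distrC.
Qed.

Lemma continuous_epsP (h : R -> R) x : {for x, continuous h} ->
  forall e : R, 0 < e -> exists2 d : R, 0 < d & forall y, `|y - x| < d -> `|h y - h x| < e.
Proof.
move=> /cvgrPdist_lt H e /H/nbhs_ballP[d /= d0 Hd]; exists d => // y yx.
by rewrite distrC; apply: Hd; rewrite /ball/= distrC.
Qed.

Lemma continuous_Re (g : R -> C) x : curve_cont g x ->
  {for x, continuous (fun x => complex.Re (g x))}.
Proof.
move=> Hg; apply: continuous_eps => e /Hg[d d0 Hd]; exists d => // y /Hd.
by apply: le_lt_trans; rewrite -ReB Re_le_cmod.
Qed.

Lemma continuous_Im (g : R -> C) x : curve_cont g x ->
  {for x, continuous (fun x => complex.Im (g x))}.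
Proof.
move=> Hg; apply: continuous_eps => e /Hg[d d0 Hd]; exists d => // y /Hd.
by apply: le_lt_trans; rewrite -ImB Im_le_cmod.
Qed.

End Curves.

Section Goursat.
Context {R : realType}.
Local Notation C := R[i].
Variable F : C -> C.
Hypothesis F_cont : forall w, ccont F w.

Let u x y := complex.Re (F (x +i* y)).
Let v x y := complex.Im (F (x +i* y)).

Lemma cmod_hor (x x' y : R) : cmod (x' +i* y - (x +i* y)) = `|x' - x|.
Proof. by rewrite -cmod_real; congr cmod; apply: complex_ext; rewrite /=; ring. Qed.

Lemma cmod_ver (x y y' : R) : cmod (x +i* y' - (x +i* y)) = `|y' - y|.
Proof. by rewrite /= subrr expr0n /= add0r sqrtr_sqr. Qed.

Let hor_cont (y x : R) : curve_cont (fun x => x +i* y) x.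
Proof. by apply: (@curve_cont_lip _ _ _ 1) => x'; rewrite cmod_hor mul1r. Qed.

Let ver_cont (x y : R) : curve_cont (fun y => x +i* y) y.
Proof. by apply: (@curve_cont_lip _ _ _ 1) => x'; rewrite cmod_ver mul1r. Qed.

Let ch y : continuous (fun x => v x y).
Proof. by move=> x; apply: continuous_Im; exact: curve_cont_comp. Qed.

Let cv x : continuous (fun y => u x y).
Proof. by move=> y; apply: continuous_Re; exact: (curve_cont_comp (@ver_cont x y)). Qed.

(* The imaginary part of the integral of F along the boundary of the rectangle. *)
Let J a b c d := int (v ^~ c) a b - int (v ^~ d) a b + int (u b) c d - int (u a) c d.

Let J_split a b c d (x y : R) : J a b c d = J a x c y + J a x y d + J x b c y + J x b y d.
Proof. by rewrite /J /int; ring. Qed.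

(** The bound k times the squared half-perimeter is additive under quartering, so it is enough to
    have it for small rectangles about each point. Continuity of F on the whole plane makes [int]
    meaningful; differentiability is asked on the rectangle. *)
Lemma goursat a b c d : a <= b -> c <= d ->
  (forall x y, a <= x <= b -> c <= y <= d -> exists l, cdiff F (x +i* y) l) ->
  int (fun x => complex.Im (F (x +i* c))) a b - int (fun x => complex.Im (F (x +i* d))) a b
  + int (fun y => complex.Re (F (b +i* y))) c d - int (fun y => complex.Re (F (a +i* y))) c d = 0.
Proof.
move=> ab cd dF; apply/eqP; rewrite -[X in X == 0]/(J a b c d) -normr_eq0 eq_le normr_ge0 andbT.
apply/ler_addgt0Pr => e e0; rewrite add0r.
pose D := (b - a) + (d - c).
have D0 : 0 <= D by rewrite addr_ge0 ?subr_ge0.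
have [D00|Dn0] := eqVneq D 0.
  have [-> ->] : a = b /\ c = d by move: D00; rewrite /D => ?; split; lra.
  by rewrite (_ : J _ _ _ _ = 0) ?normr0 ?ltW// /J /int; ring.
have Dp : 0 < D by rewrite lt_neqAle eq_sym Dn0.
pose k := e / D ^+ 2.
have k0 : 0 < k by rewrite divr_gt0// exprn_gt0.
suff : `|J a b c d| <= k * ((b - a) + (d - c)) ^+ 2.
  by rewrite -/D /k divfK// expf_neq0.
apply: (@bisection R (fun a b c d => `|J a b c d| <= k * ((b - a) + (d - c)) ^+ 2)) => //.
- move=> a' b' c' d' ab' cd' x y h1 h2 h3 h4.
  rewrite (J_split _ _ _ _ x y).
  apply: (le_trans (ler_normD _ _)); apply: (le_trans (lerD (ler_normD _ _) (lexx _))).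
  apply: (le_trans (lerD (lerD (ler_normD _ _) (lexx _)) (lexx _))).
  apply: (le_trans (lerD (lerD (lerD h1 h2) h3) h4)).
  by rewrite /x /y le_eqVlt; apply/orP; left; apply/eqP; field.
- move=> x y xab ycd; have [l Hl] := dF _ _ xab ycd.
  have k4 : 0 < k / 2 by rewrite divr_gt0.
  have [r r0 Hr] := Hl _ k4; exists r => // a' b' c' d' _ /andP[ax xb] _ _ /andP[cy yd] _ small.
  pose s := (b' - a') + (d' - c').
  have near w : a' <= complex.Re w <= b' -> c' <= complex.Im w <= d' ->
      cmod (F w - F (x +i* y) - l * (w - (x +i* y))) <= k / 2 * s.
    move=> /andP[w1 w2] /andP[w3 w4].
    have h : cmod (w - (x +i* y)) <= s.
      apply: (le_trans (cmod_le_ReIm _)); rewrite ReB ImB /=; apply: lerD; rewrite ler_norml; apply/andP; split; lra.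
    apply: (@le_trans _ _ (k / 2 * cmod (w - (x +i* y)))).
      by apply: Hr; exact: (le_lt_trans h).
    by rewrite ler_pM2l.
  have two w w' : a' <= complex.Re w <= b' -> c' <= complex.Im w <= d' ->
      a' <= complex.Re w' <= b' -> c' <= complex.Im w' <= d' ->
      cmod (F w - F w' - l * (w - w')) <= k * s.
    move=> w1 w2 w3 w4.
    rewrite (_ : F w - F w' - l * (w - w') = (F w - F (x +i* y) - l * (w - (x +i* y))) - (F w' - F (x +i* y) - l * (w' - (x +i* y)))); last by ring.
    apply: (le_trans (cmodB _ _)); apply: (le_trans (lerD (near _ w1 w2) (near _ w3 w4))).
    by rewrite le_eqVlt; apply/orP; left; apply/eqP; field.
  have ab' : a' <= b' by lra.
  have cd' : c' <= d' by lra.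
  (* For the affine approximation of F, opposite sides differ by l times the displacement: the
     horizontal pair contributes m (c' - d') (b' - a'), the vertical pair the opposite. Only the
     errors remain. *)
  pose m := complex.Re l.
  have lin (h g : R -> R) (K p q : R) : continuous h -> continuous g ->
      int h p q - int g p q - K * (q - p) = int (fun x => (h x + (-1) * g x) + (-1) * K) p q.
    move=> ch' cg'; rewrite int_lin.
    - by rewrite int_lin// int_cst; ring.
    - move=> z; apply: cvgD; first exact: ch'.
      by apply: cvgM; [exact: cvg_cst|exact: cg'].
    - by move=> z; exact: cvg_cst.
  have cc (h g : R -> R) (K : R) : continuous h -> continuous g ->
      continuous (fun x => (h x + (-1) * g x) + (-1) * K).
    move=> ch' cg' z; apply: cvgD; last exact: cvg_cst.
    apply: cvgD; first exact: ch'.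
    by apply: cvgM; [exact: cvg_cst|exact: cg'].
  have hh : `|int (v ^~ c') a' b' - int (v ^~ d') a' b' - m * (c' - d') * (b' - a')| <= k * s * (b' - a').
    rewrite lin//; apply: int_bound => //; first exact: cc.
    move=> t t1; rewrite /v /m.
    have := two (t +i* c') (t +i* d') t1; rewrite /= !lexx cd' => /(_ isT t1 isT).
    apply: le_trans; apply: le_trans (Im_le_cmod _).
    by rewrite le_eqVlt; apply/orP; left; apply/eqP; congr `|_|; rewrite !ImB ImM ReB ImB /=; ring.
  have vv : `|int (u b') c' d' - int (u a') c' d' - m * (b' - a') * (d' - c')| <= k * s * (d' - c').
    rewrite lin//; apply: int_bound => //; first exact: cc.
    move=> t t1; rewrite /u /m.
    have := two (b' +i* t) (a' +i* t); rewrite /= !lexx ab' => /(_ isT t1 isT t1).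
    apply: le_trans; apply: le_trans (Re_le_cmod _).
    by rewrite le_eqVlt; apply/orP; left; apply/eqP; congr `|_|; rewrite !ReB ReM ReB ImB /=; ring.
  rewrite -/s expr2.
  rewrite (_ : J a' b' c' d' = (int (v ^~ c') a' b' - int (v ^~ d') a' b' - m * (c' - d') * (b' - a')) + (int (u b') c' d' - int (u a') c' d' - m * (b' - a') * (d' - c'))); last by rewrite /J; ring.
  apply: (le_trans (ler_normD _ _)); apply: (le_trans (lerD hh vv)).
  by rewrite -mulrDr -/s mulrA.
Qed.

End Goursat.

(** * Mean value property and maximum principle *)

Section ComplexExp.
Context {R : realType}.
Local Notation C := R[i].

Lemma is_derive_eps (f : R -> R) (x l : R) : is_derive x (1:R) f l ->
  forall e : R, 0 < e -> exists2 d : R, 0 < d &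
    forall y, `|y - x| < d -> `|f y - f x - l * (y - x)| <= e * `|y - x|.
Proof.
move=> [df <-] e e0.
have /cvgrPdist_lt/(_ e e0) : h^-1 *: (f (h *: 1 + x) - f x) @[h --> 0^'] --> 'D_1 f x by exact: df.
move=> /nbhs_ballP[d /= d0 Hd]; exists d => // y yx.
have [->|ne] := eqVneq y x; first by rewrite !subrr mulr0 subrr normr0 mulr0.
have nz : y - x != 0 by rewrite subr_eq0.
have := Hd (y - x); rewrite /ball/= sub0r normrN => /(_ yx nz).
rewrite -[(y - x) *: 1]/((y - x) * 1) mulr1 subrK.
rewrite -[_ *: _]/((y - x)^-1 * (f y - f x)) => /ltW h.
have -> : f y - f x - 'D_1 f x * (y - x) = - (('D_1 f x - (y - x)^-1 * (f y - f x)) * (y - x)).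
  by rewrite mulrBl mulrAC mulVf// mul1r opprB.
by rewrite normrN normrM ler_wpM2r.
Qed.

Lemma eps_is_derive (f : R -> R) (x l : R) :
  (forall e : R, 0 < e -> exists2 d : R, 0 < d &
    forall y, `|y - x| < d -> `|f y - f x - l * (y - x)| <= e * `|y - x|) ->
  is_derive x (1:R) f l.
Proof.
move=> H.
have cv : h^-1 *: (f (h *: 1 + x) - f x) @[h --> 0^'] --> l.
  apply/cvgrPdist_lt => e e0; have e2 : 0 < e / 2 by rewrite divr_gt0.
  have [d d0 Hd] := H _ e2; apply/nbhs_ballP; exists d => //= h.
  rewrite /ball/= sub0r normrN => hd h0.
  rewrite -[h *: 1]/(h * 1) mulr1 -[_ *: _]/(h^-1 * _).
  have := Hd (h + x); rewrite addrK => /(_ hd) k.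
  have hp : 0 < `|h| by rewrite normr_gt0.
  rewrite -(ltr_pM2r hp) -normrM.
  rewrite (_ : (l - _) * h = - (f (h + x) - f x - l * h)); last by field.
  by rewrite normrN (le_lt_trans k)// ltr_pM2r// ltr_pdivrMr// mulr_natr mulr2n ltrDl.
apply: DeriveDef; first by apply/cvg_ex; exists l.
by apply: cvg_lim => //; exact: Rhausdorff.
Qed.

Definition cis (y : R) : C := cos y +i* sin y.

Lemma cmod_cis y : cmod (cis y) = 1.
Proof. by rewrite /= cos2Dsin2 sqrtr1. Qed.

Lemma cisD x y : cis (x + y) = cis x * cis y.
Proof. by apply: complex_ext; rewrite /= ?cosD ?sinD; ring. Qed.

Lemma cis0 : cis 0 = 1.
Proof. by rewrite /cis cos0 sin0. Qed.

Definition cexp (w : C) : C := (expR (complex.Re w))%:C * cis (complex.Im w).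

Lemma cexpD z w : cexp (z + w) = cexp z * cexp w.
Proof. by rewrite /cexp ReD ImD expRD cisD rmorphM /=; ring. Qed.

Lemma cmod_cexp w : cmod (cexp w) = expR (complex.Re w).
Proof. by rewrite normcM cmod_cis mulr1 cmod_real gtr0_norm ?expR_gt0. Qed.

Lemma cdiff_cexp0 : cdiff cexp 0 1.
Proof.
move=> e e0.
have e8 : 0 < Num.min 1 (e / 8) by rewrite lt_min ltr01 divr_gt0.
have [d1 d10 H1] := is_derive_eps (is_derive_expR (0:R)) e8.
have [d2 d20 H2] := is_derive_eps (is_derive_cos (0:R)) e8.
have [d3 d30 H3] := is_derive_eps (is_derive_sin (0:R)) e8.
have := continuous_epsP (@continuous_expR R 0) e8; move=> [d4 d40 H4].
exists (Num.min (Num.min d1 d2) (Num.min d3 d4)); first by rewrite !lt_min d10 d20 d30.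
move=> [x y]; rewrite subr0 => wd.
have hx : `|x| <= cmod (x +i* y) := Re_le_cmod (x +i* y).
have hy : `|y| <= cmod (x +i* y) := Im_le_cmod (x +i* y).
move: wd; rewrite !lt_min -andbA => /and4P[w1 w2 w3 w4].
have {H1} := H1 x; rewrite subr0 expR0 mul1r => /(_ (le_lt_trans hx w1)) k1.
have {H2} := H2 y; rewrite subr0 cos0 sin0 oppr0 mul0r subr0 => /(_ (le_lt_trans hy w2)) k2.
have {H3} := H3 y; rewrite subr0 cos0 sin0 mul1r subr0 => /(_ (le_lt_trans hy w3)) k3.
have {H4} := H4 x; rewrite subr0 expR0 => /(_ (le_lt_trans hx w4)) k4.
set r := cmod _ in hx hy *.
have r0 : 0 <= r by exact: cmod_ge0.
set q := Num.min _ _ in e8 k1 k2 k3 k4.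
have q1 : q <= 1 by rewrite /q ge_min lexx.
have qe : q <= e / 8 by rewrite /q ge_min lexx orbT.
apply: (le_trans (cmod_le_ReIm _)).
rewrite /cexp /cis /= cos0 sin0 expR0.
have -> : expR x * cos y - 0 * sin y - (1 * 1 - 0 * 0) - (1 * x - 0 * y) =
   (expR x - 1 - x) + (expR x - 1) * (cos y - 1) + (cos y - 1) by ring.
have -> : expR x * sin y + 0 * cos y - (1 * 0 + 0 * 1) - (1 * y + 0 * x) =
   (expR x - 1) * (sin y - y) + (sin y - y) + (expR x - 1) * y by ring.
have ex1 : `|expR x - 1| <= q by exact: ltW.
have bx : q * `|x| <= q * r by rewrite ler_wpM2l// ltW.
have by_ : q * `|y| <= q * r by rewrite ler_wpM2l// ltW.
have qr : q * (q * r) <= q * r by rewrite ler_piMl// mulr_ge0// ltW.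
have m1 : `|(expR x - 1) * (cos y - 1)| <= q * (q * r).
  by rewrite normrM ler_pM// (le_trans k2).
have m2 : `|(expR x - 1) * (sin y - y)| <= q * (q * r).
  by rewrite normrM ler_pM// (le_trans k3).
have m3 : `|(expR x - 1) * y| <= q * r by rewrite normrM ler_pM.
have t1 := ler_normD (expR x - 1 - x + (expR x - 1) * (cos y - 1)) (cos y - 1).
have t2 := ler_normD (expR x - 1 - x) ((expR x - 1) * (cos y - 1)).
have t3 := ler_normD ((expR x - 1) * (sin y - y) + (sin y - y)) ((expR x - 1) * y).
have t4 := ler_normD ((expR x - 1) * (sin y - y)) (sin y - y).
have qq : q * r <= e / 8 * r by rewrite ler_wpM2r.
have : 0 <= e * r by rewrite mulr_ge0// ltW.
lra.
Qed.

Lemma cdiff_cexp w : cdiff cexp w (cexp w).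
Proof.
move=> e e0; have m0 : 0 < cmod (cexp w) by rewrite cmod_cexp expR_gt0.
have e'0 : 0 < e / cmod (cexp w) by rewrite divr_gt0.
have [d d0 Hd] := cdiff_cexp0 e'0; exists d => // z zw.
have := Hd (z - w); rewrite subr0 mul1r => /(_ zw).
have c0 : cexp 0 = 1 by rewrite /cexp /= expR0 cis0 mulr1.
rewrite c0 => h.
have E : cexp z = cexp w * cexp (z - w) by rewrite -cexpD addrC subrK.
rewrite E (_ : _ - _ = cexp w * (cexp (z - w) - 1 - (z - w))); last by ring.
by rewrite normcM mulrC -ler_pdivlMr// mulrAC.
Qed.

End ComplexExp.

Section MeanValue.
Context {R : realType}.
Local Notation C := R[i].
Variables (f : C -> C) (z0 u : C) (r0 : R).
Hypotheses (u1 : cmod u = 1) (f_cont : ccont f z0)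
  (f_diff : forall z, 0 < cmod (z - z0) < r0 -> exists l, cdiff f z l).

(** With z = z0 + u e^w circles become vertical segments, and periodicity cancels the horizontal
    sides in Goursat's theorem, so the mean is the same for all radii. Continuity at z0 gives its
    value as the radius tends to 0. The factor u decides which point of the circle has the angle
    0. *)
Lemma circle_mean r : 0 < r < r0 ->
  int (fun y => complex.Re (f (z0 + u * (r%:C * cis y)))) (- pi) pi = complex.Re (f z0) * (pi *+ 2).
Proof.
move=> /andP[r_gt0 r_lt].
pose b := ln r; pose b' := ln ((r + r0) / 2).
have m0 : 0 < (r + r0) / 2 by lra.
have bb' : b < b' by rewrite ltr_ln ?posrE//; lra.
have eb' : expR b' < r0 by rewrite lnK ?posrE//; lra.
have eb : expR b = r by rewrite lnK ?posrE.
(* [goursat] wants a function continuous on the whole plane, hence the real part is cut off at b'.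
   As b' lies strictly between ln r and ln r0, the cut leaves F unchanged near the rectangle and
   keeps the argument of f inside its domain. *)
pose T (w : C) : C := Num.min (complex.Re w) b' +i* complex.Im w.
pose G (w : C) := z0 + u * cexp w.
pose F (w : C) := f (G (T w)).
have Gdist w : cmod (G w - z0) = expR (complex.Re w).
  by rewrite /G addrAC subrr add0r normcM u1 mul1r cmod_cexp.
have dG w : cdiff G w (u * cexp w).
  have h := cdiffD (cdiff_cst z0 w) (cdiffM (cdiff_cst u w) (cdiff_cexp w)).
  by move: h; rewrite mul0r !add0r.
have dfG w : complex.Re w <= b' -> exists l, cdiff (f \o G) w l.
  move=> wb; have [|l Hl] := f_diff (z := G w).
    by rewrite Gdist expR_gt0 (le_lt_trans _ eb')// ler_expR.
  by exists (l * (u * cexp w)); exact: cdiff_comp (dG w) Hl.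
have cT w : ccont T w.
  apply: (@ccont_lip _ _ _ 2) => w'; apply: (le_trans (cmod_le_ReIm _)).
  rewrite ReB ImB /=; have := Re_le_cmod (w' - w); have := Im_le_cmod (w' - w).
  rewrite ReB ImB.
  have : `|Num.min (complex.Re w') b' - Num.min (complex.Re w) b'| <= `|complex.Re w' - complex.Re w|.
    rewrite /Num.min /Order.min; case: ltP => h1; case: ltP => h2; rewrite ?subrr ?normr0//;
    by rewrite !ler_normr !ler_norml; apply/orP; (left + right); apply/andP; split; lra.
  by lra.
have cF w : ccont F w.
  apply: (@ccont_comp _ T (f \o G)) => //.
  have [|l Hl] := dfG (T w); first by rewrite /= ge_min lexx orbT.
  exact: cdiff_cont Hl.
have FE x y : x <= b' -> F (x +i* y) = f (z0 + u * ((expR x)%:C * cis y)).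
  by move=> xb; rewrite /F /T /G /cexp /= min_l.
have dF w : complex.Re w < b' -> exists l, cdiff F w l.
  move=> wb; have [l Hl] := dfG w (ltW wb); exists l; apply: cdiff_near Hl.
  exists (b' - complex.Re w); first by rewrite subr_gt0.
  move=> w' h; rewrite /F /T /= min_l; first by case: w' {h}.
  have := Re_le_cmod (w' - w); rewrite ReB ler_norml => /andP[_ ?]; lra.
have c_vert x : x <= b' -> continuous (fun y => complex.Re (f (z0 + u * ((expR x)%:C * cis y)))).
  move=> xb y; have := @continuous_Re R (F \o (fun y => x +i* y)) y.
  have -> : (fun x0 => complex.Re ((F \o (fun y => x +i* y)) x0)) = (fun y => complex.Re (f (z0 + u * ((expR x)%:C * cis y)))).
    by apply/funext => t /=; rewrite FE.
  apply; apply: curve_cont_comp; last exact: cF.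
  by apply: (@curve_cont_lip _ _ _ 1) => y'; rewrite cmod_ver mul1r.
pose A x := int (fun y => complex.Re (f (z0 + u * ((expR x)%:C * cis y)))) (- pi) pi.
have pip := pi_gt0 R.
have pi2 : - pi <= pi :> R by lra.
have Aconst a : a <= b -> A a = A b.
  move=> ab; have := @goursat R F cF a b (- pi) pi ab pi2.
  have -> : (fun x => complex.Im (F (x +i* - pi))) = (fun x => complex.Im (F (x +i* pi))).
    by apply/funext => x; rewrite /F /T /G /cexp /= /cis cosN cospi sinN sinpi oppr0.
  rewrite subrr add0r.
  have E x : x <= b' -> int (fun y => complex.Re (F (x +i* y))) (- pi) pi = A x.
    by move=> xb; rewrite /A; congr (int _ _ _); apply/funext => y; rewrite FE.
  rewrite !E; [|lra|lra] => h; apply/eqP; rewrite eq_sym -subr_eq0; apply/eqP/h => x y /andP[_ xb] _.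
  by apply: dF; rewrite /=; lra.
rewrite -eb -/(A b); apply/eqP; rewrite -subr_eq0 -normr_eq0 eq_le normr_ge0 andbT.
apply/ler_addgt0Pr => e e0; rewrite add0r.
have e'0 : 0 < e / (pi *+ 2) by rewrite divr_gt0// mulrn_wgt0.
have [d d0 Hd] := f_cont e'0.
pose a := Num.min b (ln (d / 2)).
have ab : a <= b by rewrite /a ge_min lexx.
have ea : expR a < d.
  apply: (@le_lt_trans _ _ (d / 2)); last by lra.
  rewrite -[leRHS]lnK ?posrE ?divr_gt0//.
  by rewrite ler_expR /a ge_min lexx orbT.
rewrite -(Aconst a ab).
have ca := c_vert a (le_trans ab (ltW bb')).
have -> : A a - complex.Re (f z0) * (pi *+ 2) = int (fun y => complex.Re (f (z0 + u * ((expR a)%:C * cis y))) + (-1) * complex.Re (f z0)) (- pi) pi.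
  rewrite int_lin//; last by move=> ?; exact: cvg_cst.
  by rewrite int_cst -/(A a); ring.
apply: (@le_trans _ _ (e / (pi *+ 2) * (pi - - pi))).
  apply: int_bound => //.
    by move=> y; apply: cvgD; [exact: ca|exact: cvg_cst].
  move=> y _; rewrite mulN1r -ReB; apply: (le_trans (Re_le_cmod _)); apply/ltW/Hd.
  by rewrite addrAC subrr add0r !normcM u1 mul1r cmod_cis mulr1 cmod_real gtr0_norm ?expR_gt0.
rewrite le_eqVlt; apply/orP; left; apply/eqP.
by rewrite opprK -mulr2n divfK// gt_eqF// mulrn_wgt0.
Qed.

End MeanValue.

Section MaximumPrinciple.
Context {R : realType}.
Local Notation C := R[i].
Implicit Types (z w a b u : C) (f g : C -> C) (s : seq C) (r rho M : R).

Lemma lip_derive (f df : R -> R) (k : R) : (forall x, is_derive x (1:R) f (df x)) ->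
  (forall x, `|df x| <= k) -> forall x y, `|f y - f x| <= k * `|y - x|.
Proof.
move=> dF bd x y; wlog xy : x y / x <= y.
  by move=> W; have [/W//|/ltW/W] := leP x y; rewrite distrC [`|x - y|]distrC.
have [|c cab ->] := @MVT_segment R f df x y xy.
- by apply: derive_within_continuous => t _; exact: dF.
- by rewrite normrM ler_wpM2r.
Qed.

Lemma norm_cos_le1 (x : R) : `|cos x| <= 1.
Proof. by rewrite ler_norml cos_geN1 cos_le1. Qed.

Lemma norm_sin_le1 (x : R) : `|sin x| <= 1.
Proof. by rewrite ler_norml sin_geN1 sin_le1. Qed.

Lemma cis_lip (x y : R) : cmod (cis y - cis x) <= 2 * `|y - x|.
Proof.
apply: (le_trans (cmod_le_ReIm _)); rewrite ReB ImB /=.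
have h1 : `|cos y - cos x| <= 1 * `|y - x|.
  apply: (@lip_derive _ (fun t => - sin t)) => t.
  by rewrite normrN norm_sin_le1.
have h2 : `|sin y - sin x| <= 1 * `|y - x|.
  apply: (@lip_derive _ cos) => t.
  exact: norm_cos_le1.
lra.
Qed.

Lemma cis_surj z : cmod z = 1 -> exists2 t : R, - pi <= t <= pi & z = cis t.
Proof.
move=> z1; have := sqr_cmod z; rewrite z1 expr1n => E.
have Re1 : -1 <= complex.Re z <= 1.
  by have := Re_le_cmod z; rewrite z1 ler_norml.
have s : Num.sqrt (1 - complex.Re z ^+ 2) = `|complex.Im z|.
  by rewrite -sqrtr_sqr; congr Num.sqrt; lra.
have h0 := acos_ge0 Re1; have hpi := acos_lepi Re1.
have hc : cos (acos (complex.Re z)) = complex.Re z by rewrite acosK// in_itv.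
have hs := sin_acos Re1.
have p0 := pi_gt0 R.
have [i0|i0] := leP 0 (complex.Im z).
  exists (acos (complex.Re z)); first by apply/andP; split; lra.
  by apply: complex_ext; rewrite /= ?hc// hs s ger0_norm.
exists (- acos (complex.Re z)); first by apply/andP; split; lra.
by apply: complex_ext; rewrite /= ?cosN ?hc// sinN hs s ltr0_norm// opprK.
Qed.

(** A unimodular factor that turns z into its modulus; any unimodular value would do so at z = 0. *)
Definition unit_conj z : C := if z == 0 then 1 else (conjc z) / (cmod z)%:C.

Lemma cmod_unit_conj z : cmod (unit_conj z) = 1.
Proof.
rewrite /unit_conj; case: eqVneq => [_|z0]; first exact: normc1.
have h : 0 < cmod z by rewrite cmod_gt0.
rewrite normcM cmod_conj normcV cmod_real ger0_norm ?cmod_ge0// divff// gt_eqF//.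
Qed.

Lemma unit_conjM z : unit_conj z * z = (cmod z)%:C.
Proof.
rewrite /unit_conj; case: eqVneq => [->|z0]; first by rewrite mulr0 normc0.
have h : (cmod z)%:C != 0 by rewrite -cmod_gt0 cmod_real normr_gt0 cmod_eq0.
by rewrite mulrAC [_ * z]mulrC mul_conj expr2 rmorphM mulfK.
Qed.

Lemma polar z : exists2 t : R, - pi <= t <= pi & z = (cmod z)%:C * cis t.
Proof.
have [|t tpi E] := @cis_surj (conjc (unit_conj z)); first by rewrite cmod_conj cmod_unit_conj.
exists t => //; rewrite -E -unit_conjM mulrAC mul_conj cmod_unit_conj expr1n.
by rewrite rmorph1 mul1r.
Qed.

Lemma Re_scale (k : R) z : complex.Re (k%:C * z) = k * complex.Re z.
Proof. by case: z => x y; rewrite /= mul0r subr0. Qed.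

(** Polar coordinates map the compact rectangle [0, rho] x [- pi, pi] onto the disc; cutting the
    radius off to [0, rho] makes the pullback of phi continuous on all of R x R. *)
Lemma disc_max (phi : C -> R) rho : 0 <= rho ->
  (forall z, cmod z <= rho -> forall e : R, 0 < e -> exists2 d : R, 0 < d &
     forall w, cmod (w - z) < d -> `|phi w - phi z| < e) ->
  exists2 z, cmod z <= rho & forall w, cmod w <= rho -> phi w <= phi z.
Proof.
move=> rho0 cphi.
have pip := pi_gt0 R.
pose cl (r : R) := Num.max 0 (Num.min r rho).
pose G (p : R * R) := (cl p.1)%:C * cis p.2.
have cl0 r : 0 <= cl r by rewrite /cl le_max lexx.
have clr r : cl r <= rho by rewrite /cl ge_max rho0 ge_min lexx orbT.
have clE r : 0 <= r <= rho -> cl r = r by move=> /andP[? ?]; rewrite /cl min_l// max_r.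
have cll (r r' : R) : `|cl r - cl r'| <= `|r - r'|.
  wlog rr : r r' / r' <= r.
    by move=> W; have [/W//|/ltW/W] := leP r' r; rewrite distrC [`|r' - r|]distrC.
  rewrite [leRHS]ger0_norm ?subr_ge0// ler_norml /cl /Num.max /Num.min /Order.max /Order.min.
  have [h1|h1] := ltP r rho; have [h2|h2] := ltP r' rho;
  [have [h3|h3] := ltP 0 r; have [h4|h4] := ltP 0 r'|have [h3|h3] := ltP 0 r|
   have [h4|h4] := ltP 0 r'|idtac]; try have [h5|h5] := ltP 0 rho; apply/andP; split; lra.
have Gr p : cmod (G p) <= rho by rewrite normcM cmod_cis mulr1 cmod_real ger0_norm.
have cG : continuous (phi \o G).
  move=> p; apply/cvgrPdist_lt => e e0.
  have [d d0 Hd] := cphi _ (Gr p) e e0.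
  pose k := 1 + 2 * rho.
  have k0 : 0 < k by rewrite /k; lra.
  apply/(@nbhs_ballP R (R * R)%type); exists (d / k); first by rewrite /= divr_gt0.
  move=> q [/=]; rewrite /ball /= => q1 q2; rewrite distrC; apply: Hd.
  have -> : G q - G p = (cl q.1 - cl p.1)%:C * cis p.2 + (cl q.1)%:C * (cis q.2 - cis p.2).
    by rewrite /G rmorphB /=; ring.
  apply: (le_lt_trans (cmodD _ _)); rewrite !normcM cmod_cis mulr1 !cmod_real.
  apply: (@le_lt_trans _ _ (`|p.1 - q.1| + rho * (2 * `|p.2 - q.2|))).
    apply: lerD; first by rewrite [leRHS]distrC cll.
    apply: ler_pM; rewrite ?cmod_ge0 ?normr_ge0//; first by rewrite ger0_norm.
    by rewrite [`|p.2 - _|]distrC cis_lip.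
  apply: (@lt_le_trans _ _ (d / k + rho * (2 * (d / k)))).
    apply: ltr_leD => //; rewrite ler_wpM2l// ler_wpM2l//; exact: ltW.
  by rewrite le_eqVlt; apply/orP; left; apply/eqP; rewrite /k; field; rewrite gt_eqF.
pose A : set (R * R) := `[0, rho]%classic `*` `[- pi, pi]%classic.
have A0 : A !=set0 by exists (0, 0); split; rewrite /= in_itv/= ?lexx ?rho0//; apply/andP; split; lra.
have cA : compact A by apply: compact_setX; exact: segment_compact.
have [p _ Hp] := compact_EVT_max A0 cA (continuous_subspaceT cG).
exists (G p) => // w wr; have [t tpi wE] := polar w.
have -> : w = G (cmod w, t) by rewrite /G /= clE ?cmod_ge0.
by apply: Hp; rewrite inE; split; rewrite /= in_itv/= ?cmod_ge0.
Qed.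

Lemma seq_isolated s z : exists2 d : R, 0 < d & forall w, 0 < cmod (w - z) < d -> w \notin s.
Proof.
elim: s => [|a s [d d0 Hd]]; first by exists 1.
have [->|az] := eqVneq a z.
  exists d => // w wd; rewrite inE negb_or Hd// andbT.
  by case/andP: wd; rewrite cmod_gt0 subr_eq0.
exists (Num.min d (cmod (a - z))); first by rewrite lt_min d0 cmod_gt0 subr_eq0.
move=> w; rewrite lt_min => /and3P[w0 wd wa]; rewrite inE negb_or Hd ?w0// andbT.
by apply: contraTneq wa => ->; rewrite ltxx.
Qed.

(* A maximum point z1 of |f| + kappa |z| would also be a maximum point of the
   real part of h = v f + kappa v' z, where v, v' are unimodular and make both
   summands nonnegative at z1; by the mean value property Re h is then constant
   on small circles about z1, so |z| <= |z1| there, which fails in the direction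
   orthogonal to z1. *)
Lemma max_principle f s rho M : 0 < rho < 1 ->
  (forall z, cmod z < 1 -> ccont f z) ->
  (forall z, cmod z < 1 -> z \notin s -> exists l, cdiff f z l) ->
  (forall z, cmod z = rho -> cmod (f z) <= M) ->
  forall z, cmod z <= rho -> cmod (f z) <= M.
Proof.
move=> /andP[rho0 rho1] cf df fM zs zsr; rewrite leNgt; apply/negP => Mz.
(* On the circle |z| = rho the perturbation adds kap rho, half of the excess of |f zs| over M, so
   the perturbed function still has its maximum inside. *)
pose kap := (cmod (f zs) - M) / (2 * rho).
have kap0 : 0 < kap by rewrite divr_gt0 ?subr_gt0// mulr_gt0.
have kapE : kap * rho = (cmod (f zs) - M) / 2 by rewrite /kap; field; rewrite gt_eqF.
pose phi z := cmod (f z) + kap * cmod z.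
have [|z|z1 z1r z1max] := @disc_max phi rho.
- exact: ltW.
- move=> zr e e0; have e2 : 0 < e / 2 by rewrite divr_gt0.
  have [d d0 Hd] := cf z (le_lt_trans zr rho1) _ e2.
  exists (Num.min d (e / 2 / kap)); first by rewrite lt_min d0 divr_gt0.
  move=> w; rewrite lt_min => /andP[/Hd w1]; rewrite ltr_pdivlMr// => w2.
  have h1 : `|cmod (f w) - cmod (f z)| <= cmod (f w - f z).
    have := cmod_dist (f w) (f z); have := cmod_dist (f z) (f w).
    by rewrite (cmodC (f z)) ler_norml => ? ?; apply/andP; split; lra.
  have h2 : `|kap * cmod w - kap * cmod z| <= cmod (w - z) * kap.
    have := cmod_dist w z; have := cmod_dist z w; rewrite (cmodC z) => h h'.
    rewrite -mulrBr normrM gtr0_norm// mulrC ler_pM2r//.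
    by rewrite ler_norml; apply/andP; split; lra.
  rewrite /phi (_ : _ - _ = (cmod (f w) - cmod (f z)) + (kap * cmod w - kap * cmod z)); last by ring.
  by apply: (le_lt_trans (ler_normD _ _)); lra.
have z1lt : cmod z1 < rho.
  rewrite lt_neqAle z1r andbT; apply/eqP => E.
  have := z1max _ zsr; rewrite /phi E kapE => h; have := fM _ E.
  have : 0 <= kap * cmod zs by rewrite mulr_ge0 ?cmod_ge0 ?ltW.
  by lra.
pose v := unit_conj (f z1); pose v' := unit_conj z1.
pose h z := v * f z + kap%:C * (v' * z).
have Reh1 : complex.Re (h z1) = phi z1.
  by rewrite /h !unit_conjM ReD -rmorphM /=.
have Reh z : complex.Re (h z) <= cmod (f z) + kap * complex.Re (v' * z).
  rewrite /h ReD; apply: lerD.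
    by apply: (le_trans (ler_norm _)); apply: (le_trans (Re_le_cmod _)); rewrite normcM cmod_unit_conj mul1r.
  by rewrite Re_scale.
have Reh' z : cmod z <= rho -> complex.Re (h z) <= phi z1.
  move=> zr; apply: (le_trans (Reh z)); apply: (le_trans _ (z1max _ zr)).
  rewrite /phi lerD2l ler_pM2l//.
  by apply: (le_trans (ler_norm _)); apply: (le_trans (Re_le_cmod _)); rewrite normcM cmod_unit_conj mul1r.
have [d d0 Hd] := seq_isolated s z1.
pose r0 := Num.min d (rho - cmod z1).
have r00 : 0 < r0 by rewrite lt_min d0 subr_gt0.
have inr0 z : cmod (z - z1) < r0 -> cmod z < rho.
  by rewrite lt_min => /andP[_ ?]; have := cmod_dist z z1; lra.
pose r := r0 / 2.
have rr : 0 < r < r0 by rewrite /r; apply/andP; split; lra.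
(* This u places the direction orthogonal to z1 at the angle 0, an interior point of [- pi, pi],
   because [int_eq_max] speaks of interior points. *)
have [u u1 uE] : exists2 u : C, cmod u = 1 & v' * u = 'i.
  exists ('i * (conjc v')).
    by rewrite normcM cmod_conj cmod_unit_conj /= expr0n expr1n add0r sqrtr1 mulr1.
  by rewrite mulrCA mul_conj cmod_unit_conj expr1n mulr1.
have ch z : cmod z < rho -> ccont h z.
  move=> zr; apply: ccontD; apply: ccontM; try exact: ccont_cst; first by apply: cf; lra.
  by apply: ccontM; [exact: ccont_cst|exact: ccont_id].
have := @circle_mean R h z1 u r0 u1 (ch _ z1lt).
have dh z : 0 < cmod (z - z1) < r0 -> exists l, cdiff h z l.
  move=> /andP[h0 hr]; have zr := inr0 _ hr.
  have [||l Hl] := df z; [by lra| |].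
    by apply: Hd; rewrite h0/=; move: hr; rewrite lt_min => /andP[].
  exists (v * l + kap%:C * v').
  have := cdiffD (cdiffM (cdiff_cst v z) Hl) (cdiffM (cdiff_cst kap%:C z) (cdiffM (cdiff_cst v' z) (cdiff_id z))).
  by rewrite !mul0r !add0r mulr1.
move=> /(_ dh r rr); rewrite Reh1 => E.
have onc y : cmod (z1 + u * (r%:C * cis y) - z1) < r0.
  rewrite addrAC subrr add0r !normcM u1 mul1r cmod_cis mulr1 cmod_real gtr0_norm; by case/andP: rr.
have pip := pi_gt0 R.
have E0 : complex.Re (h (z1 + u * (r%:C * cis 0))) = phi z1.
  pose H y := complex.Re (h (z1 + u * (r%:C * cis y))).
  apply: (@int_eq_max R H (- pi) pi (phi z1)).
  - move=> y; apply: continuous_Re; apply: (curve_cont_comp (F := h)); last by apply: ch; exact: inr0.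
    apply: (@curve_cont_lip _ _ _ (r * 2)) => y'.
    rewrite (_ : _ - _ = u * (r%:C * (cis y' - cis y))); last by ring.
    rewrite !normcM u1 mul1r cmod_real gtr0_norm; last by case/andP: rr.
    by rewrite -[leRHS]mulrA ler_wpM2l ?cis_lip//; case/andP: rr => /ltW.
  - by lra.
  - by move=> y _; apply: Reh'; apply/ltW/inr0.
  - by rewrite E opprK mulr2n.
  - by apply/andP; split; lra.
rewrite cis0 mulr1 in E0; have := onc 0; rewrite cis0 mulr1.
set z := z1 + u * r%:C => /inr0 zr.
have := z1max _ (ltW zr); rewrite -E0.
have vz : v' * z = (cmod z1 +i* r).
  rewrite /z mulrDr unit_conjM mulrA uE.
  by apply: complex_ext; rewrite /=; ring.
have := Reh z; rewrite vz /= => h1 h2.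
have h3 : kap * cmod z <= kap * cmod z1 by move: h2; rewrite /phi; lra.
rewrite ler_pM2l// in h3.
have : cmod z ^+ 2 = cmod z1 ^+ 2 + r ^+ 2.
  by rewrite -[cmod z]mul1r -(cmod_unit_conj z1) -normcM vz sqr_cmod.
have : 0 < r ^+ 2 by rewrite exprn_gt0//; case/andP: rr.
have : cmod z ^+ 2 <= cmod z1 ^+ 2 by rewrite ler_pXn2r ?nnegrE ?cmod_ge0.
by lra.
Qed.

End MaximumPrinciple.

(** * Schwarz-Pick and Harnack estimates *)

Section SchwarzPick.
Context {R : realType}.
Local Notation C := R[i].
Implicit Types (z w a b : C) (f g : C -> C) (s : seq C) (r rho M : R).

Definition mob a z : C := (a - z) / (1 - (conjc a) * z).

Lemma conj_scale (r : R) z : (conjc (r%:C * z)) = r%:C * (conjc z).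
Proof. by case: z => x y; apply: complex_ext; rewrite /=; ring. Qed.

Lemma mob_den_neq0 a z : cmod a < 1 -> cmod z < 1 -> 1 - (conjc a) * z != 0.
Proof.
move=> a1 z1; apply: contraTneq isT => /eqP; rewrite subr_eq0 => /eqP E.
have : cmod ((conjc a) * z) < 1 by rewrite normcM cmod_conj mulr_ilt1 ?cmod_ge0.
by rewrite -E normc1 ltxx.
Qed.

Lemma mob0 a : mob a 0 = a.
Proof. by rewrite /mob mulr0 !subr0 divr1. Qed.

Lemma mobaa a : mob a a = 0.
Proof. by rewrite /mob subrr mul0r. Qed.

Lemma mobK a z : cmod a < 1 -> cmod z < 1 -> mob a (mob a z) = z.
Proof.
move=> a1 z1; have d1 := mob_den_neq0 a1 z1; have d2 := mob_den_neq0 a1 a1.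
have d3 : 1 - (conjc a) * mob a z = (1 - (conjc a) * a) / (1 - (conjc a) * z) by rewrite /mob; field.
rewrite {1}/mob d3 {1}/mob; field; by rewrite d1 d2.
Qed.

Lemma sub_sqr_cmod_mob a z : cmod a < 1 -> cmod z < 1 ->
  1 - cmod (mob a z) ^+ 2 = (1 - cmod a ^+ 2) * (1 - cmod z ^+ 2) / cmod (1 - (conjc a) * z) ^+ 2.
Proof.
move=> a1 z1; have d1 := mob_den_neq0 a1 z1.
have d0 : cmod (1 - (conjc a) * z) != 0 by rewrite cmod_eq0.
rewrite /mob normcM normcV expr_div_n.
have E : cmod (1 - (conjc a) * z) ^+ 2 - cmod (a - z) ^+ 2 = (1 - cmod a ^+ 2) * (1 - cmod z ^+ 2).
  rewrite !sqr_cmod; case: a {a1 d1 d0} => a1 a2; case: z {z1} => z1' z2 /=; ring.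
by rewrite -E; field.
Qed.

Lemma cmod_mob_lt1 a z : cmod a < 1 -> cmod z < 1 -> cmod (mob a z) < 1.
Proof.
move=> a1 z1; have d1 := mob_den_neq0 a1 z1.
rewrite -(@expr_lt1 _ 2) ?cmod_ge0// -subr_gt0 sub_sqr_cmod_mob//.
by rewrite divr_gt0 ?exprn_gt0 ?cmod_gt0// mulr_gt0// subr_gt0 expr_lt1 ?cmod_ge0.
Qed.

Lemma mob_sub a z w : cmod a < 1 -> cmod z < 1 -> cmod w < 1 ->
  mob a w - mob a z = - (1 - (conjc a) * a) / ((1 - (conjc a) * w) * (1 - (conjc a) * z)) * (w - z).
Proof.
move=> a1 z1 w1; have d1 := mob_den_neq0 a1 z1; have d2 := mob_den_neq0 a1 w1.
by rewrite /mob; field; rewrite d1 d2.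
Qed.

Lemma cdiff_mob a z : cmod a < 1 -> cmod z < 1 ->
  cdiff (mob a) z (- (1 - (conjc a) * a) / (1 - (conjc a) * z) ^+ 2).
Proof.
move=> a1 z1; have d1 := mob_den_neq0 a1 z1.
have h1 := cdiffD (cdiff_cst a z) (cdiffM (cdiff_cst (-1) z) (cdiff_id z)).
have h2 := cdiffV (f := fun w => 1 + (- (conjc a)) * w) _ (cdiffD (cdiff_cst 1 z) (cdiffM (cdiff_cst (- (conjc a)) z) (cdiff_id z))).
rewrite mulNr in h2; have := cdiffM h1 (h2 d1).
set l := (X in cdiff _ _ X -> _).
have -> : l = - (1 - (conjc a) * a) / (1 - (conjc a) * z) ^+ 2 by rewrite /l; field.
by apply: cdiff_near; exists 1 => // w _; rewrite /mob mulN1r mulNr.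
Qed.

Lemma ccont_mob a z : cmod a < 1 -> cmod z < 1 -> ccont (mob a) z.
Proof. by move=> a1 z1; exact: cdiff_cont (cdiff_mob a1 z1). Qed.

Lemma cmod_mobC a b : cmod (mob a b) = cmod (mob b a).
Proof.
rewrite /mob !normcM !normcV cmodC; congr (_ / _).
by rewrite -cmod_conj rmorphB rmorph1 rmorphM /= conjcK mulrC.
Qed.

(** The exceptional list s admits quotients f / z, continuous at 0 with differentiability there
    unknown. The bound is not strict since such a quotient may be a unimodular constant. *)
Definition bounded_holo s g :=
  [/\ forall z, cmod z < 1 -> ccont g z,
      forall z, cmod z < 1 -> z \notin s -> exists l, cdiff g z l
    & forall z, cmod z < 1 -> cmod (g z) <= 1].

(** The passage r -> 1 in an inequality whose error is linear in 1 - r. *)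
Lemma le_of_scaled (x y K : R) :
  (forall r, 0 < r < 1 -> r * x <= y + K * (1 - r)) -> x <= y.
Proof.
move=> H; rewrite leNgt; apply/negP => yx.
pose m := `|x| + `|K| + 1.
have m0 : 0 < m by rewrite ltr_wpDl// addr_ge0.
pose e := Num.min (1 / 2) ((x - y) / (2 * m)).
have e0 : 0 < e by rewrite lt_min !divr_gt0// ?subr_gt0// mulr_gt0.
have e1 : e <= 1 / 2 by rewrite /e ge_min lexx.
have e2 : e * m <= (x - y) / 2.
  rewrite -[leRHS](_ : (x - y) / (2 * m) * m = _); last by field; rewrite gt_eqF.
  by rewrite ler_wpM2r ?(ltW m0)// /e ge_min lexx orbT.
have /H : 0 < 1 - e < 1 by apply/andP; split; lra.
have h1 : e * x <= e * `|x| by rewrite ler_pM2l// ler_norm.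
have h2 : e * K <= e * `|K| by rewrite ler_pM2l// ler_norm.
have : e * m = e * `|x| + e * `|K| + e by rewrite /m; ring.
by lra.
Qed.

Definition slope f (l : C) z : C := if z == 0 then l else f z / z.

Lemma slopeE f l z : f 0 = 0 -> f z = z * slope f l z.
Proof. by move=> f0; rewrite /slope; case: eqVneq => [->|z0]; rewrite ?f0 ?mul0r// mulrC divfK. Qed.

Lemma slope_near f l z : z != 0 ->
  exists2 d : R, 0 < d & forall w, cmod (w - z) < d -> f w * w^-1 = slope f l w.
Proof.
move=> z0; exists (cmod z); first by rewrite cmod_gt0.
move=> w; rewrite /slope; case: eqVneq => // ->.
by rewrite sub0r cmodN ltxx.
Qed.

Lemma ccont_slope f l z : f 0 = 0 -> cdiff f 0 l -> ccont f z -> ccont (slope f l) z.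
Proof.
move=> f0 dl cf; have [->|z0] := eqVneq z 0.
  move=> e e0; have e2 : 0 < e / 2 by rewrite divr_gt0.
  have [d d0 Hd] := dl _ e2; exists d => // w /Hd.
  rewrite f0 !subr0 /slope eqxx; case: eqVneq => [->|w0]; first by rewrite subrr normc0.
  have h : 0 < cmod w by rewrite cmod_gt0.
  rewrite (_ : f w - l * w = (f w / w - l) * w); last by field.
  by rewrite normcM ler_pM2r//; lra.
apply: ccont_near (slope_near f l z0) _.
by apply: ccontM => //; apply: ccontV => //; exact: ccont_id.
Qed.

Lemma cdiff_slope f l z k : z != 0 -> cdiff f z k ->
  cdiff (slope f l) z (k * z^-1 + f z * (- 1 / z ^+ 2)).
Proof.
move=> z0 Hk; apply: cdiff_near (slope_near f l z0) _.
by apply: cdiffM => //; apply: cdiffV => //; exact: cdiff_id.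
Qed.

(** The maximum principle on |z| <= r bounds the quotient f / z by 1 / r, since |f| <= 1 on the
    circle; then r tends to 1. The origin joins the exceptional points of the quotient. *)
Lemma schwarz s f l : bounded_holo s f -> f 0 = 0 -> cdiff f 0 l ->
  forall z, cmod z < 1 -> cmod (f z) <= cmod z.
Proof.
move=> [cf df bf] f0 dl.
pose g := slope f l.
have cg z : cmod z < 1 -> ccont g z by move=> /cf; exact: ccont_slope.
have dg z : cmod z < 1 -> z \notin 0 :: s -> exists k, cdiff g z k.
  move=> z1; rewrite inE negb_or => /andP[z0 zs]; have [k Hk] := df _ z1 zs.
  by eexists; exact: cdiff_slope Hk.
have key r z : 0 < r < 1 -> cmod z <= r -> r * cmod (f z) <= cmod z.
  move=> r01; have /andP[r0 r1] := r01 => zr.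
  have := @max_principle R g (0 :: s) r r^-1 r01 cg dg _ z zr.
  have bd w : cmod w = r -> cmod (g w) <= r^-1.
    move=> wr; rewrite /g /slope ifF; last by rewrite -cmod_eq0 wr gt_eqF.
  rewrite normcM normcV wr ler_piMl ?invr_ge0 ?(ltW r0)//; apply: bf; rewrite wr; exact: r1.
  move=> /(_ bd); rewrite /g /slope; case: eqVneq => [-> _|z0]; first by rewrite f0 normc0 mulr0.
  by rewrite normcM normcV ler_pdivrMr ?cmod_gt0// mulrC ler_pdivlMr// mulrC.
move=> z z1; apply: (@le_of_scaled _ _ 0) => r r01; rewrite mul0r addr0.
have [zr|zr] := leP (cmod z) r; first exact: key.
have /andP[r0 r1] := r01.
by apply: (le_trans _ (ltW zr)); rewrite ler_piMr ?bf// ltW.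
Qed.

Lemma bounded_holo_slope f l : (forall z, cmod z < 1 -> exists k, cdiff f z k) ->
  (forall z, cmod z < 1 -> cmod (f z) < 1) -> f 0 = 0 -> cdiff f 0 l ->
  bounded_holo [:: 0] (slope f l).
Proof.
move=> df bf f0 dl.
have cf z : cmod z < 1 -> ccont f z by move=> /df[k /cdiff_cont].
have bh : bounded_holo [::] f by split=> // z z1; [move=> _; exact: df|exact/ltW/bf].
have b z : cmod z < 1 -> z != 0 -> cmod (slope f l z) <= 1.
  move=> z1 z0; rewrite /slope (negPf z0) normcM normcV ler_pdivrMr ?cmod_gt0// mul1r.
  exact: (schwarz bh f0 dl).
split=> z z1; first by apply: ccont_slope => //; exact: cf.
- rewrite inE => z0; have [k Hk] := df _ z1.
  by eexists; exact: cdiff_slope Hk.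
have [->|z0] := eqVneq z 0; last exact: b.
(* [schwarz] bounds the quotient away from 0; a value of modulus above 1 at 0 would persist at a
   small real point by continuity. *)
rewrite leNgt; apply/negP => l1.
have z01 : cmod (0 : C) < 1 by rewrite normc0.
have e0 : 0 < cmod (slope f l 0) - 1 by rewrite subr_gt0.
have [d d0 Hd] := ccont_slope f0 dl (cf _ z01) e0.
pose r := Num.min d 1 / 2.
have m0 : 0 < Num.min d 1 by rewrite lt_min d0 ltr01.
have r0 : 0 < r by rewrite divr_gt0.
have : r < Num.min d 1 by rewrite /r; lra.
rewrite lt_min => /andP[rd r1].
have rE : cmod (r%:C : C) = r by rewrite cmod_real gtr0_norm.
have := Hd r%:C; rewrite subr0 rE => /(_ rd).
have := b r%:C; rewrite rE -cmod_gt0 rE => /(_ r1 r0).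
have := cmod_dist (slope f l 0) (slope f l r%:C); rewrite cmodC; lra.
Qed.

(** Schwarz's lemma for g conjugated by the involutions at a and g a. With k < 1 the values of g
    stay in the open disc, where [mob (g a)] is well behaved; a avoids s so that the conjugate is
    differentiable at 0. *)
Lemma schwarz_pick_strict s g a b (k : R) : bounded_holo s g -> k < 1 ->
  (forall z, cmod z < 1 -> cmod (g z) <= k) ->
  cmod a < 1 -> cmod b < 1 -> a \notin s ->
  cmod (g a - g b) <= cmod (mob a b) * cmod (1 - (conjc (g a)) * g b).
Proof.
move=> [cg dg _] k1 gk a1 b1 as_.
have g1 z : cmod z < 1 -> cmod (g z) < 1 by move=> /gk; lra.
pose F z := mob (g a) (g (mob a z)).
have m1 z := @cmod_mob_lt1 a z a1.
have [l Hl] := dg _ a1 as_.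
have d0 : cdiff F 0 (- (1 - (conjc (g a)) * g a) / (1 - (conjc (g a)) * g a) ^+ 2 * (l * (- (1 - (conjc a) * a) / (1 - (conjc a) * 0) ^+ 2))).
  have z1 : cmod (0 : C) < 1 by rewrite normc0.
  have h := cdiff_mob a1 z1.
  rewrite -{1}(mob0 a) in Hl.
  have h2 := cdiff_comp h Hl; apply: cdiff_comp h2 _.
  by rewrite mob0; apply: cdiff_mob; apply: g1.
have F0 : F 0 = 0 by rewrite /F mob0 mobaa.
have bF : bounded_holo [seq mob a z | z <- s] F.
  split=> z z1.
  - apply: (@ccont_comp _ (fun z => g (mob a z))); last by apply: ccont_mob; apply: g1; rewrite ?m1.
    by apply: ccont_comp; [exact: ccont_mob|exact/cg/m1].
  - move=> zs; have [|k' Hk'] := dg _ (m1 _ z1).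
      by apply: contra zs => zs; apply/mapP; exists (mob a z) => //; rewrite mobK.
    have h2 := cdiff_comp (cdiff_mob a1 z1) Hk'; eexists; apply: cdiff_comp h2 _.
    by apply: cdiff_mob; apply: g1; rewrite ?m1.
  - by apply/ltW/cmod_mob_lt1; apply: g1; rewrite ?m1.
have := schwarz bF F0 d0 (m1 _ b1).
rewrite /F mobK// {1}/mob normcM normcV ler_pdivrMr// cmod_gt0.
by apply: mob_den_neq0; exact: g1.
Qed.

(** Apply the strict case to r g and let r tend to 1, at the cost 1 - r^2 <= 2 (1 - r). The form
    without denominators keeps its meaning when |g| = 1. *)
Lemma schwarz_pick s g a b : bounded_holo s g ->
  cmod a < 1 -> cmod b < 1 -> a \notin s ->
  cmod (g a - g b) <= cmod (mob a b) * cmod (1 - (conjc (g a)) * g b).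
Proof.
move=> [cg dg bg] a1 b1 as_; apply: (@le_of_scaled _ _ 2) => r /andP[r0 r1].
pose h z := r%:C * g z.
have hr z : cmod z < 1 -> cmod (h z) <= r.
  by move=> z1; rewrite normcM cmod_real gtr0_norm// ler_piMr ?bg// ltW.
have bh : bounded_holo s h.
  split=> z z1.
  - by apply: ccontM; [exact: ccont_cst|exact: cg].
  - move=> zs; have [l Hl] := dg _ z1 zs.
    by eexists; apply: cdiffM; [exact: cdiff_cst|exact: Hl].
  - by apply: (le_trans (hr _ z1)); exact: ltW.
have := schwarz_pick_strict bh r1 hr a1 b1 as_.
rewrite /h -mulrBr normcM cmod_real gtr0_norm// => H; apply: (le_trans H).
set m := cmod (mob a b).
have m0 : 0 <= m by exact: cmod_ge0.
have m1 : m < 1 by exact: cmod_mob_lt1.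
have -> : 1 - (conjc (r%:C * g a)) * (r%:C * g b) = (1 - (conjc (g a)) * g b) + (1 - r ^+ 2)%:C * ((conjc (g a)) * g b).
  rewrite conj_scale rmorphB rmorph1 rmorphXn /=; ring.
apply: (@le_trans _ _ (m * (cmod (1 - (conjc (g a)) * g b) + (1 - r ^+ 2) * 1))).
  rewrite ler_wpM2l//; apply: (le_trans (cmodD _ _)); rewrite lerD2l normcM cmod_real.
  have r2 : 0 <= 1 - r ^+ 2 by rewrite subr_ge0 expr_le1// ltW.
  rewrite ger0_norm// ler_wpM2l// normcM cmod_conj mulr_ile1 ?cmod_ge0 ?bg//.
rewrite mulrDr lerD2l mulr1; apply: (@le_trans _ _ (1 * (1 - r ^+ 2))).
  by apply: ler_wpM2r; [rewrite subr_ge0 expr_le1// ltW|exact: ltW].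
by nra.
Qed.

(** [mob_gap] bounds 1 - |mob a b|^2 from below by (1 - rho^2)^2 / 4, and (1 + |g a|) (1 + |g b|) is
    at most 4; this is the quotient of the two bounds. *)
Definition pick_const rho : R := 16 / (1 - rho ^+ 2) ^+ 2.

Section HarnackEstimates.
Variables (g : C -> C) (rho : R).
Hypotheses (bg : bounded_holo [:: 0] g) (rho01 : 0 <= rho < 1).

(** The point 0 is exceptional for g, but the inequality is symmetric in a and b, so that one of
    them being non-zero is enough. *)
Let pick a b : cmod a <= rho -> cmod b <= rho ->
  cmod (g a - g b) <= cmod (mob a b) * cmod (1 - (conjc (g a)) * g b).
Proof.
case/andP: rho01 => r0 r1 ar br.
have a1 : cmod a < 1 by exact: le_lt_trans r1.
have b1 : cmod b < 1 by exact: le_lt_trans r1.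
have [a0|a0] := eqVneq a 0; last by apply: (@schwarz_pick [:: 0]); rewrite ?inE.
have [b0|b0] := eqVneq b 0; last first.
  have := @schwarz_pick [:: 0] g b a bg b1 a1; rewrite inE => /(_ b0).
  rewrite cmodC cmod_mobC -[cmod (1 - _)]cmod_conj.
  by rewrite rmorphB rmorph1 rmorphM /= conjcK [(conjc _) * _]mulrC.
by rewrite a0 b0 subrr normc0 mulr_ge0 ?cmod_ge0.
Qed.

Let q0 : 0 < 1 - rho ^+ 2.
Proof. by case/andP: rho01 => r0 r1; rewrite subr_gt0 expr_lt1. Qed.

Let den_le a b : cmod a <= rho -> cmod b <= rho -> cmod (1 - (conjc a) * b) <= 2.
Proof.
case/andP: rho01 => r0 r1 ar br.
apply: (le_trans (cmodB _ _)); rewrite normc1 normcM cmod_conj.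
have : cmod a * cmod b <= 1 by rewrite mulr_ile1 ?cmod_ge0//; lra.
by lra.
Qed.

Let mob_gap a b : cmod a <= rho -> cmod b <= rho ->
  (1 - rho ^+ 2) ^+ 2 / 4 <= 1 - cmod (mob a b) ^+ 2.
Proof.
case/andP: rho01 => r0 r1 ar br.
have a1 : cmod a < 1 by exact: le_lt_trans r1.
have b1 : cmod b < 1 by exact: le_lt_trans r1.
have d0 : 0 < cmod (1 - (conjc a) * b) by rewrite cmod_gt0 mob_den_neq0.
have sq c : cmod c <= rho -> 1 - rho ^+ 2 <= 1 - cmod c ^+ 2.
  by move=> cr; rewrite lerB// ler_pXn2r ?nnegrE ?cmod_ge0.
rewrite sub_sqr_cmod_mob// ler_pdivlMr ?exprn_gt0//.
apply: (@le_trans _ _ ((1 - rho ^+ 2) ^+ 2 / 4 * 2 ^+ 2)).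
  rewrite ler_wpM2l//; first by rewrite divr_ge0// sqr_ge0.
  by rewrite ler_pXn2r ?nnegrE ?cmod_ge0//; exact: den_le.
rewrite (_ : _ * 2 ^+ 2 = (1 - rho ^+ 2) * (1 - rho ^+ 2)); last by field.
by apply: ler_pM; rewrite ?(ltW q0)//; exact: sq.
Qed.

(** Square [pick] and insert the identity |1 - conj x y|^2 - |x - y|^2 = (1 - |x|^2) (1 - |y|^2) for
    the values x, y of g: the factor 1 - |mob a b|^2 appears on the left. *)
Let den_sqr a b : cmod a <= rho -> cmod b <= rho ->
  (1 - rho ^+ 2) ^+ 2 / 4 * cmod (1 - (conjc (g a)) * g b) ^+ 2 <=
  4 * (1 - cmod (g a)) * (1 - cmod (g b)).
Proof.
move=> ar br; case/andP: rho01 => r0 r1.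
have ga : cmod (g a) <= 1 by case: bg => _ _; apply; exact: le_lt_trans r1.
have gb : cmod (g b) <= 1 by case: bg => _ _; apply; exact: le_lt_trans r1.
have ga0 := cmod_ge0 (g a); have gb0 := cmod_ge0 (g b).
have E : cmod (1 - (conjc (g a)) * g b) ^+ 2 - cmod (g a - g b) ^+ 2 = (1 - cmod (g a) ^+ 2) * (1 - cmod (g b) ^+ 2).
  by rewrite !sqr_cmod; case: (g a) => a1 a2; case: (g b) => b1 b2 /=; ring.
have h : cmod (g a - g b) ^+ 2 <= cmod (mob a b) ^+ 2 * cmod (1 - (conjc (g a)) * g b) ^+ 2.
  rewrite -exprMn ler_pXn2r ?nnegrE ?cmod_ge0 ?mulr_ge0 ?cmod_ge0//; exact: pick.
apply: (@le_trans _ _ ((1 - cmod (mob a b) ^+ 2) * cmod (1 - (conjc (g a)) * g b) ^+ 2)).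
  by rewrite ler_wpM2r ?sqr_ge0// mob_gap.
apply: (@le_trans _ _ ((1 - cmod (g a) ^+ 2) * (1 - cmod (g b) ^+ 2))).
  by rewrite -E; lra.
have -> : (1 - cmod (g a) ^+ 2) * (1 - cmod (g b) ^+ 2) = ((1 + cmod (g a)) * (1 + cmod (g b))) * ((1 - cmod (g a)) * (1 - cmod (g b))) by ring.
rewrite -[leRHS]mulrA ler_wpM2r ?mulr_ge0 ?subr_ge0//.
by rewrite (_ : 4 = 2 * 2); [apply: ler_pM; lra|ring].
Qed.

Lemma pick_const_gt0 : 0 < pick_const rho.
Proof. by rewrite divr_gt0// exprn_gt0. Qed.

(** As 1 - |g a| <= |1 - conj (g a) g b|, [den_sqr] bounds the square of 1 - |g a| by a multiple of
    (1 - |g a|) (1 - |g b|), and one factor cancels. *)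
Lemma harnack a b : cmod a <= rho -> cmod b <= rho ->
  1 - cmod (g a) <= pick_const rho * (1 - cmod (g b)).
Proof.
move=> ar br; case/andP: rho01 => r0 r1.
have ga : cmod (g a) <= 1 by case: bg => _ _; apply; exact: le_lt_trans r1.
have gb : cmod (g b) <= 1 by case: bg => _ _; apply; exact: le_lt_trans r1.
have := den_sqr ar br; set q := (1 - rho ^+ 2) ^+ 2.
have q1 : 0 < q by rewrite exprn_gt0.
have [x0|x0] := eqVneq (1 - cmod (g a)) 0.
  by rewrite x0 => _; rewrite mulr_ge0 ?subr_ge0// ltW// pick_const_gt0.
have xp : 0 < 1 - cmod (g a) by rewrite lt_neqAle eq_sym x0 subr_ge0.
have low : 1 - cmod (g a) <= cmod (1 - (conjc (g a)) * g b).
  have := cmod_dist 1 ((conjc (g a)) * g b); rewrite normc1 normcM cmod_conj.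
  have : cmod (g a) * cmod (g b) <= cmod (g a) by rewrite ler_piMr ?cmod_ge0.
  by lra.
have low2 : (1 - cmod (g a)) ^+ 2 <= cmod (1 - (conjc (g a)) * g b) ^+ 2.
  by rewrite ler_pXn2r ?nnegrE ?cmod_ge0// ltW.
move=> H; have : q / 4 * (1 - cmod (g a)) ^+ 2 <= 4 * (1 - cmod (g a)) * (1 - cmod (g b)).
  by apply: le_trans H; rewrite ler_wpM2l// divr_ge0// ltW.
rewrite expr2 mulrA [4 * _ * _]mulrAC ler_pM2r// => H2.
rewrite /pick_const -/q mulrAC ler_pdivlMr//; lra.
Qed.

(** Inserting [harnack] in [den_sqr] produces [pick_const rho] a second time, so both sides are
    squares. *)
Lemma pick_den_le a b : cmod a <= rho -> cmod b <= rho ->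
  cmod (1 - (conjc (g a)) * g b) <= pick_const rho * (1 - cmod (g b)).
Proof.
move=> ar br; case/andP: rho01 => r0 r1.
have gb : cmod (g b) <= 1 by case: bg => _ _; apply; exact: le_lt_trans r1.
have k0 := pick_const_gt0.
have q1 : 0 < (1 - rho ^+ 2) ^+ 2 by rewrite exprn_gt0.
have kn : 0 <= pick_const rho * (1 - cmod (g b)).
  by apply: mulr_ge0; [exact: ltW|rewrite subr_ge0].
rewrite -(@ler_pXn2r _ 2) ?nnegrE ?cmod_ge0//.
have := den_sqr ar br; have := harnack ar br.
set x := 1 - cmod (g a); set y := 1 - cmod (g b); set D := cmod _ ^+ 2.
move=> H1 H2.
have y0 : 0 <= y by rewrite subr_ge0.
have : 4 * x * y <= 4 * (pick_const rho * y) * y by rewrite ler_wpM2r// ler_pM2l.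
move=> /(le_trans H2); rewrite -ler_pdivlMl; last by rewrite divr_gt0.
move/le_trans; apply; rewrite le_eqVlt; apply/orP; left; apply/eqP.
by rewrite /pick_const; field; rewrite gt_eqF.
Qed.

Lemma pick_lipschitz a b : cmod a <= rho -> cmod b <= rho ->
  cmod (g a - g b) <= pick_const rho ^+ 2 / (1 - rho ^+ 2) * (1 - cmod (g 0)) * cmod (a - b).
Proof.
move=> ar br; case/andP: rho01 => r0 r1.
have a1 : cmod a < 1 by exact: le_lt_trans r1.
have b1 : cmod b < 1 by exact: le_lt_trans r1.
have k0 := pick_const_gt0.
have h0 : cmod (0 : C) <= rho by rewrite normc0.
have d0 : 0 < cmod (1 - (conjc a) * b) by rewrite cmod_gt0 mob_den_neq0.
have m : cmod (mob a b) <= cmod (a - b) / (1 - rho ^+ 2).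
  rewrite /mob normcM normcV ler_wpM2l ?cmod_ge0// lef_pV2 ?posrE//.
  have := cmod_dist 1 ((conjc a) * b); rewrite normc1 normcM cmod_conj.
  have : cmod a * cmod b <= rho * rho by rewrite ler_pM ?cmod_ge0.
  by rewrite expr2; lra.
apply: (le_trans (pick ar br)).
apply: (@le_trans _ _ (cmod (a - b) / (1 - rho ^+ 2) * (pick_const rho * (pick_const rho * (1 - cmod (g 0)))))).
  apply: ler_pM; rewrite ?cmod_ge0//; apply: (le_trans (pick_den_le ar br)).
  by rewrite ler_pM2l//; exact: harnack.
by rewrite le_eqVlt; apply/orP; left; apply/eqP; field; rewrite gt_eqF.
Qed.

End HarnackEstimates.

End SchwarzPick.

(** * Asymptotics of families fixing the origin *)

Section Limits.
Context {R : realType}.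
Local Notation C := R[i].

(** The limit is found as the lower limit, the supremum of the eventual lower bounds. *)
Lemma cauchy_limit_real (f : R -> R) :
  (forall e : R, 0 < e -> exists T, forall t t', T <= t -> t <= t' -> `|f t' - f t| <= e) ->
  exists l, forall e : R, 0 < e -> exists T, forall t, T <= t -> `|f t - l| <= e.
Proof.
move=> H; pose S := [set x | exists T, forall t, T <= t -> x <= f t].
have [T1 H1] := H 1 ltr01.
have b1 t : T1 <= t -> `|f t - f T1| <= 1 by move=> h; exact: H1.
have ub (T e : R) : (forall t, T <= t -> `|f t - f T| <= e) -> ubound S (f T + e).
  move=> HT x [T' HT']; apply: (le_trans (HT' (Num.max T T') _)).
    by rewrite le_max lexx orbT.
  have := HT (Num.max T T'); rewrite le_max lexx ler_norml => /(_ isT) /andP[_ ?]; lra.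
have hs : has_sup S.
  split; last by exists (f T1 + 1); exact: ub.
  by exists (f T1 - 1), T1 => t /b1; rewrite ler_norml => /andP[? _]; lra.
exists (sup S) => e e0; have e2 : 0 < e / 2 by rewrite divr_gt0.
have [T HT] := H _ e2; exists T => t Tt.
have HT' t' : T <= t' -> `|f t' - f T| <= e / 2 by move=> h; exact: HT.
have h1 : sup S <= f T + e / 2 by apply: ge_sup; [case: hs|exact: ub].
have h2 : f T - e / 2 <= sup S.
  apply: ub_le_sup; first by case: hs.
  by exists T => t' /HT'; rewrite ler_norml => /andP[? _]; lra.
by have := HT' t Tt; rewrite !ler_norml => /andP[? ?]; apply/andP; split; lra.
Qed.

Lemma cauchy_limit (f : R -> C) :
  (forall e : R, 0 < e -> exists T, forall t t', T <= t -> t <= t' -> cmod (f t' - f t) <= e) ->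
  exists l, forall e : R, 0 < e -> exists T, forall t, T <= t -> cmod (f t - l) <= e.
Proof.
move=> H.
have [|x Hx] := @cauchy_limit_real (fun t => complex.Re (f t)).
  move=> e /H[T HT]; exists T => t t' h1 h2; rewrite -ReB.
  by apply: (le_trans (Re_le_cmod _)); exact: HT.
have [|y Hy] := @cauchy_limit_real (fun t => complex.Im (f t)).
  move=> e /H[T HT]; exists T => t t' h1 h2; rewrite -ImB.
  by apply: (le_trans (Im_le_cmod _)); exact: HT.
exists (x +i* y) => e e0; have e2 : 0 < e / 2 by rewrite divr_gt0.
have [T1 H1] := Hx _ e2; have [T2 H2] := Hy _ e2.
exists (Num.max T1 T2) => t; rewrite ge_max => /andP[/H1 h1 /H2 h2].
by apply: (le_trans (cmod_le_ReIm _)); rewrite ReB ImB /=; lra.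
Qed.

(** Applied to increments in time, this makes derivatives Cauchy as soon as the increments have
    small Lipschitz constants. *)
Lemma cdiff_le (f : C -> C) (z l : C) (k d : R) : 0 < d -> cdiff f z l ->
  (forall w, cmod (w - z) < d -> cmod (f w - f z) <= k * cmod (w - z)) -> cmod l <= k.
Proof.
move=> d0 dl H; apply/ler_addgt0Pr => e e0.
have [d' d'0 Hd] := dl _ e0.
pose r := Num.min d d' / 2.
have m0 : 0 < Num.min d d' by rewrite lt_min d0.
have r0 : 0 < r by rewrite divr_gt0.
have : r < Num.min d d' by rewrite /r; lra.
rewrite lt_min => /andP[rd rd'].
have E : cmod (z + r%:C - z) = r by rewrite addrAC subrr add0r cmod_real gtr0_norm.
have h1 := H (z + r%:C); have h2 := Hd (z + r%:C); rewrite E in h1 h2.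
have {}h1 := h1 rd; have {}h2 := h2 rd'.
rewrite -(ler_pM2r r0) -{1}E -normcM mulrDl.
rewrite (_ : l * _ = (f (z + r%:C) - f z) - (f (z + r%:C) - f z - l * (z + r%:C - z))); last by ring.
by apply: (le_trans (cmodB _ _)); apply: lerD.
Qed.

End Limits.

(** * Families fixing 0: multipliers, decay and linearisation *)

Section Dichotomy.
Context {R : realType}.
Local Notation C := R[i].
Implicit Types (z w a b : C) (s t u T rho e : R).

Variable psi : R -> R -> C -> C.
Hypothesis psi_diff : forall s t z, 0 <= s -> s <= t -> cmod z < 1 -> exists l, cdiff (psi s t) z l.
Hypothesis psi_disk : forall s t z, 0 <= s -> s <= t -> cmod z < 1 -> cmod (psi s t z) < 1.
Hypothesis psi_comp : forall s u t z, 0 <= s -> s <= u -> u <= t -> cmod z < 1 ->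
  psi s t z = psi u t (psi s u z).
Hypothesis psi0 : forall s t, 0 <= s -> s <= t -> psi s t 0 = 0.
Hypothesis psi_small : forall z T e, cmod z < 1 -> 0 < e -> exists2 d : R, 0 < d &
  forall s t, 0 <= s -> s <= t -> t <= T -> t - s < d -> cmod (psi s t z - z) < e.

Definition lam s t : C := get [set l | cdiff (psi s t) 0 l].

Let zero_lt1 : cmod (0 : C) < 1.
Proof. by rewrite normc0. Qed.

Lemma lamP s t : 0 <= s -> s <= t -> cdiff (psi s t) 0 (lam s t).
Proof.
by move=> s0 st; have [l Hl] := psi_diff s0 st zero_lt1; exact: (getPex (ex_intro _ l Hl)).
Qed.

Let g s t := slope (psi s t) (lam s t).

Let g0 s t : g s t 0 = lam s t.
Proof. by rewrite /g /slope eqxx. Qed.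

Let psiE s t z : 0 <= s -> s <= t -> psi s t z = z * g s t z.
Proof. by move=> s0 st; apply: slopeE; exact: psi0. Qed.

Let bg s t : 0 <= s -> s <= t -> bounded_holo [:: 0] (g s t).
Proof.
move=> s0 st; apply: bounded_holo_slope; [|by move=> z; exact: psi_disk|exact: psi0|exact: lamP].
by move=> z z1; exact: psi_diff.
Qed.

Let g_le1 s t z : 0 <= s -> s <= t -> cmod z < 1 -> cmod (g s t z) <= 1.
Proof. by move=> s0 st z1; have [_ _] := bg s0 st; exact. Qed.

Lemma lam_le1 s t : 0 <= s -> s <= t -> cmod (lam s t) <= 1.
Proof. by move=> s0 st; rewrite -g0; exact: g_le1. Qed.

Lemma psi_le s t z : 0 <= s -> s <= t -> cmod z < 1 -> cmod (psi s t z) <= cmod z.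
Proof. by move=> s0 st z1; rewrite psiE// normcM ler_piMr ?cmod_ge0// g_le1. Qed.

Lemma lam_mul s u t : 0 <= s -> s <= u -> u <= t -> lam s t = lam u t * lam s u.
Proof.
move=> s0 su ut; have u0 := le_trans s0 su; have st := le_trans su ut.
apply: (cdiff_unique (lamP s0 st)).
have h := lamP u0 ut; rewrite -(psi0 s0 su) in h.
apply: cdiff_near (cdiff_comp (lamP s0 su) h).
by exists 1 => // w; rewrite subr0 => w1; rewrite -psi_comp.
Qed.

(** The cocycle rule for psi / z; at z = 0 it is the chain rule for [lam]. *)
Let g_comp s u t z : 0 <= s -> s <= u -> u <= t -> cmod z < 1 ->
  g s t z = g u t (psi s u z) * g s u z.
Proof.
move=> s0 su ut z1; have u0 := le_trans s0 su; have st := le_trans su ut.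
have [->|z0] := eqVneq z 0; first by rewrite psi0// !g0 (lam_mul s0 su ut).
apply: (mulfI z0); rewrite -psiE// (psi_comp s0 su ut z1) (psiE (psi s u z) u0 ut).
by rewrite {1}psiE//; ring.
Qed.

Definition lip_const rho : R := pick_const rho ^+ 2 / (1 - rho ^+ 2).

Lemma lip_const_ge0 rho : 0 <= rho < 1 -> 0 <= lip_const rho.
Proof.
by move=> /andP[r0 r1]; rewrite divr_ge0 ?sqr_ge0// subr_ge0 expr_le1// ltW.
Qed.

Let lip s t rho a b : 0 <= s -> s <= t -> 0 <= rho < 1 -> cmod a <= rho -> cmod b <= rho ->
  cmod (g s t a - g s t b) <= lip_const rho * (1 - cmod (lam s t)) * cmod (a - b).
Proof. by move=> s0 st r01 ar br; rewrite -g0; apply: pick_lipschitz => //; exact: bg. Qed.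

Let har s t rho a b : 0 <= s -> s <= t -> 0 <= rho < 1 -> cmod a <= rho -> cmod b <= rho ->
  1 - cmod (g s t a) <= pick_const rho * (1 - cmod (g s t b)).
Proof. by move=> s0 st r01 ar br; apply: harnack => //; exact: bg. Qed.

(** Continuity in time at the single point 1/2 suffices. There g is close to 1; Harnack carries the
    smallness of 1 - |g| from 1/2 to 0, and then the Lipschitz estimate bounds the difference of the
    values of g at 0 and 1/2. *)
Lemma lam_near1 T e : 0 < e -> exists2 d : R, 0 < d &
  forall s t, 0 <= s -> s <= t -> t <= T -> t - s < d -> cmod (lam s t - 1) < e.
Proof.
move=> e0; pose z : C := (2^-1)%:C.
have r01 : 0 <= (2^-1 : R) < 1 by apply/andP; split; lra.
have zr : cmod z = 2^-1 by rewrite cmod_real ger0_norm// invr_ge0.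
have z1 : cmod z < 1 by rewrite zr; case/andP: r01.
pose K := pick_const (2^-1 : R); pose L := lip_const (2^-1).
have K0 : 0 < K by exact: pick_const_gt0.
have L0 : 0 <= L by exact: lip_const_ge0.
(* The errors 2 h, at the point 1/2, and L K h, between 0 and 1/2, must add up to less than e. *)
pose h := e / (L * K + 3).
have q0 : 0 < L * K + 3 by rewrite ltr_wpDl// mulr_ge0// ltW.
have h0 : 0 < h by rewrite divr_gt0.
have [d d0 Hd] := psi_small T z1 h0; exists d => // s t s0 st tT tsd.
have := Hd s t s0 st tT tsd; rewrite psiE// (_ : _ - _ = z * (g s t z - 1)) ?normcM ?zr; last by ring.
move=> H.
have H1 : cmod (g s t z - 1) < 2 * h by lra.
have H2 : 1 - cmod (g s t z) < 2 * h.
  by have := cmod_dist 1 (g s t z); rewrite normc1 cmodC; lra.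
have zr' : cmod z <= 2^-1 by rewrite zr.
have or : cmod (0 : C) <= 2^-1 by rewrite normc0; case/andP: r01.
have H3 := har s0 st r01 or zr'; rewrite g0 in H3.
have H4 := lip s0 st r01 or zr'; rewrite g0 sub0r cmodN zr in H4.
have H5 : 1 - cmod (lam s t) <= K * (2 * h).
  by apply: (le_trans H3); rewrite ler_wpM2l//; exact: ltW.
have H6 : cmod (lam s t - g s t z) <= L * K * h.
  apply: (le_trans H4); apply: (@le_trans _ _ (L * (K * (2 * h)) * 2^-1)).
    by rewrite ler_wpM2r ?invr_ge0// ler_wpM2l.
  by rewrite le_eqVlt; apply/orP; left; apply/eqP; field.
rewrite (_ : lam s t - 1 = (lam s t - g s t z) + (g s t z - 1)); last by ring.
apply: (le_lt_trans (cmodD _ _)).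
have : h * (L * K + 3) = e by rewrite /h divfK// gt_eqF.
by lra.
Qed.

(** Induction in time: a property that holds for short steps and is stable under composition holds
    on all of [0, T]. *)
Lemma time_chain (Q : R -> R -> Prop) T d : 0 < d ->
  (forall s t, 0 <= s -> s <= t -> t <= T -> t - s < d -> Q s t) ->
  (forall s u t, 0 <= s -> s <= u -> u <= t -> t <= T -> Q s u -> Q u t -> Q s t) ->
  forall s t, 0 <= s -> s <= t -> t <= T -> Q s t.
Proof.
move=> d0 base step s t s0 st tT.
(* Steps of length d / 2, as the short-time hypothesis wants a length strictly below d. *)
have [n Hn] : exists n : nat, t - s < d / 2 * n%:R.
  exists (Num.truncn ((t - s) / (d / 2))).+1.
  by rewrite mulrC -ltr_pdivrMr ?divr_gt0// truncnS_gt.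
elim: n s s0 st Hn => [|n IH] s s0 st Hn; first by rewrite mulr0 in Hn; lra.
have [small|big] := ltP (t - s) d; first exact: base.
have su : s <= s + d / 2 by lra.
have ut : s + d / 2 <= t by lra.
apply: (@step s (s + d / 2)) => //; first by apply: base; lra.
by apply: IH => //; [lra|move: Hn; rewrite -natr1; lra].
Qed.

Lemma lam_neq0 s t : 0 <= s -> s <= t -> lam s t != 0.
Proof.
move=> s0 st; have [d d0 Hd] := lam_near1 t (ltr01 : 0 < (1 : R)).
apply: (@time_chain (fun s t => lam s t != 0) t d d0) => // [s' t' h1 h2 h3 h4|s' u t' h1 h2 h3 h4 h5 h6].
  apply/eqP => E; have := Hd _ _ h1 h2 h3 h4.
  by rewrite E sub0r cmodN normc1 ltxx.
by rewrite (lam_mul h1 h2 h3) mulf_neq0.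
Qed.

(** A quantitative injectivity when |lam s t| is close to 1: psi a - psi b is (a - b) g a up to b (g
    b - g a), and both 1 - |g a| and the Lipschitz constant of g are small. *)
Lemma psi_lower s t rho a b : 0 <= s -> s <= t -> 0 <= rho < 1 -> cmod a <= rho -> cmod b <= rho ->
  (1 - (pick_const rho + lip_const rho) * (1 - cmod (lam s t))) * cmod (a - b)
  <= cmod (psi s t a - psi s t b).
Proof.
move=> s0 st r01 ar br; have r1 : rho < 1 by case/andP: r01.
have or : cmod (0 : C) <= rho by rewrite normc0; case/andP: r01.
rewrite !psiE//.
have -> : a * g s t a - b * g s t b = (a - b) * g s t a - b * (g s t b - g s t a) by ring.
apply: le_trans (cmod_dist _ _); rewrite !normcM.
have h1 := lip s0 st r01 br ar; rewrite (cmodC b) in h1.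
have h2 := har s0 st r01 ar or; rewrite g0 in h2.
have h3 : cmod b * cmod (g s t b - g s t a) <= cmod (g s t b - g s t a).
  by rewrite ler_piMl ?cmod_ge0// ltW// (le_lt_trans br).
have h4 : cmod (a - b) * (1 - cmod (g s t a)) <= cmod (a - b) * (pick_const rho * (1 - cmod (lam s t))).
  by rewrite ler_wpM2l ?cmod_ge0.
by lra.
Qed.

(** For short steps |lam| exceeds 1 - 1 / (2 K), so the factor in [psi_lower] is at least 1/2. The
    steps can be chained with one rho because psi does not increase the modulus. *)
Lemma psi_inj s t a b : 0 <= s -> s <= t -> cmod a < 1 -> cmod b < 1 ->
  psi s t a = psi s t b -> a = b.
Proof.
move=> s0 st a1 b1.
pose rho := Num.max (cmod a) (cmod b).
have r01 : 0 <= rho < 1 by rewrite le_max cmod_ge0/= gt_max a1.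
have r1 : rho < 1 by case/andP: r01.
pose K := pick_const rho + lip_const rho.
have K0 : 0 < K by apply: ltr_pwDl; [exact: pick_const_gt0|exact: lip_const_ge0].
have e0 : 0 < (2 * K)^-1 by rewrite invr_gt0 mulr_gt0.
have [d d0 Hd] := lam_near1 t e0.
have ar : cmod a <= rho by rewrite le_max lexx.
have br : cmod b <= rho by rewrite le_max lexx orbT.
pose Q s t := forall a b, cmod a <= rho -> cmod b <= rho -> psi s t a = psi s t b -> a = b.
suff : Q s t by apply.
apply: (@time_chain Q t d d0) => // [s' t' h1 h2 h3 h4 a' b' ar' br' E|s' u t' h1 h2 h3 h4 q1 q2 a' b' ar' br' E].
  have := psi_lower h1 h2 r01 ar' br'; rewrite E subrr normc0 -/K => H.
  have lm : 1 - cmod (lam s' t') < (2 * K)^-1.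
    have := cmod_dist 1 (lam s' t'); have := Hd _ _ h1 h2 h3 h4.
    by rewrite normc1 (cmodC 1); lra.
  have : K * (1 - cmod (lam s' t')) <= 2^-1.
    have := ltW lm; rewrite -(ler_pM2l K0) => /le_trans; apply.
    by rewrite le_eqVlt; apply/orP; left; apply/eqP; field; rewrite gt_eqF.
  have := cmod_ge0 (a' - b') => ab0 KK.
  apply/eqP; rewrite -subr_eq0 -cmod_eq0 eq_le ab0 andbT.
  by nra.
have a'1 := le_lt_trans ar' r1; have b'1 := le_lt_trans br' r1.
apply: q1 => //; apply: q2.
- by apply: le_trans ar'; exact: psi_le.
- by apply: le_trans br'; exact: psi_le.
- by rewrite -!psi_comp.
Qed.

Lemma bernoulli_inv (v : R) n : 0 <= v <= 1 -> (1 - v) ^+ n * (1 + n%:R * v) <= 1.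
Proof.
move=> /andP[v0 v1]; elim: n => [|n IH]; first by rewrite expr0; lra.
apply: le_trans IH; rewrite exprSr -mulrA ler_wpM2l ?exprn_ge0 ?subr_ge0//.
rewrite mulrS; have : 0 <= n%:R * v * v by rewrite !mulr_ge0.
have : 0 <= v * v by rewrite mulr_ge0.
by lra.
Qed.

(** Harnack gives 1 - |lam| <= K (1 - |g z|). For short steps this becomes |g z|^M <= |lam|, an
    inequality between quantities that multiply under composition, hence valid for all steps; so g
    tends to 0 with [lam]. *)
Lemma psi_to0 : (forall e, 0 < e -> exists2 T, 0 <= T & cmod (lam 0 T) < e) ->
  forall s rho e, 0 <= s -> 0 <= rho < 1 -> 0 < e -> exists2 T, s <= T &
    forall t z, T <= t -> cmod z <= rho -> cmod (psi s t z) < e.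
Proof.
move=> H s rho e s0 r01 e0; have r1 : rho < 1 by case/andP: r01.
pose K := pick_const rho; have K0 : 0 < K := pick_const_gt0 r01.
(* With y = |g z| and x = |lam|, M >= 2 K gives M (1 - y) >= 2 (1 - x), and [bernoulli_inv] then
   bounds y^M by 1 / (1 + 2 (1 - x)). *)
pose M := (Num.truncn (2 * K)).+1.
have KM : 2 * K <= M%:R by apply/ltW/truncnS_gt.
have half : 0 < (2^-1 : R) by [].
have or : cmod (0 : C) <= rho by rewrite normc0; case/andP: r01.
pose Q s t := forall z, cmod z <= rho -> cmod (g s t z) ^+ M <= cmod (lam s t).
have QT T t : 0 <= t -> t <= T -> forall s, 0 <= s -> s <= t -> Q s t.
  move=> _ tT s' s'0 s't; have [d d0 Hd] := lam_near1 T half.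
  apply: (@time_chain Q T d d0) => // {s' s'0 s't} s' => [t' s0' h2 h3 h4 z zr|u t' h1 h2 h3 h4 q1 q2 z zr].
    have x1 := lam_le1 s0' h2.
    have x2 : 1 / 2 <= cmod (lam s' t').
      have := cmod_dist 1 (lam s' t'); have := Hd _ _ s0' h2 h3 h4.
      by rewrite normc1 (cmodC 1); lra.
    have zle : 1 - cmod (lam s' t') <= K * (1 - cmod (g s' t' z)).
      by rewrite -g0; exact: har.
    have g1 : cmod (g s' t' z) <= 1 by apply: g_le1 => //; exact: le_lt_trans r1.
    have y0 := cmod_ge0 (g s' t' z).
    set y := cmod (g s' t' z) in zle g1 y0 *; set x := cmod (lam s' t') in x1 x2 zle *.
    have := @bernoulli_inv (1 - y) M; rewrite subr_ge0 g1 lerBlDr lerDl y0 => /(_ isT).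
    rewrite subKr => B.
    have yM : 0 <= y ^+ M by rewrite exprn_ge0.
    have h5 : 2 * (1 - x) <= M%:R * (1 - y).
      apply: (@le_trans _ _ (2 * K * (1 - y))); first by lra.
      by rewrite ler_wpM2r// subr_ge0.
    have h6 : y ^+ M * (1 + 2 * (1 - x)) <= 1.
      by apply: le_trans B; rewrite ler_wpM2l// lerD2l.
    (* The difference of the two sides is (2 x - 1) (1 - x), which is why short steps are taken so
       small that x >= 1/2. *)
    have h7 : 1 <= x * (1 + 2 * (1 - x)) by nra.
    have h8 : 0 < 1 + 2 * (1 - x) by lra.
    by rewrite -(ler_pM2r h8); apply: le_trans h7.
  have z1 := le_lt_trans zr r1.
  rewrite (g_comp h1 h2 h3 z1) (lam_mul h1 h2 h3) !normcM exprMn.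
  apply: ler_pM; rewrite ?exprn_ge0 ?cmod_ge0//; last exact: q1.
  by apply: q2; apply: le_trans zr; exact: psi_le.
have l0 : 0 < cmod (lam 0 s) by rewrite cmod_gt0 lam_neq0.
(* The factor |lam 0 s| converts smallness of lam 0 t = lam s t * lam 0 s into smallness of lam s
   t. *)
have [T T0 HT] := H (e ^+ M * cmod (lam 0 s)) (mulr_gt0 (exprn_gt0 _ e0) l0).
exists (Num.max s T); first by rewrite le_max lexx.
move=> t z; rewrite ge_max => /andP[st Tt] zr.
have t0 := le_trans s0 st; have z1 := le_lt_trans zr r1.
rewrite psiE// normcM.
apply: (@le_lt_trans _ _ (cmod (g s t z))).
  by rewrite ler_piMl ?cmod_ge0// ltW.
rewrite -(@ltr_pXn2r _ M)// ?nnegrE ?cmod_ge0 ?(ltW e0)//.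
apply: (le_lt_trans (QT t t t0 (lexx t) s s0 st z zr)).
rewrite -(ltr_pM2r l0) -normcM -lam_mul//; apply: le_lt_trans HT.
by rewrite (lam_mul (lexx 0) T0 Tt) normcM ler_piMl ?cmod_ge0// lam_le1.
Qed.

Section NonDegenerate.
Variable ell : R.
Hypotheses (ell0 : 0 < ell) (lam_ge : forall t, 0 <= t -> ell <= cmod (lam 0 t)).

(** The limit of |lam 0 t|, which decreases with t. *)
Definition lam_inf : R := inf [set cmod (lam 0 t) | t in [set t | 0 <= t]].

Let has_inf_lam : has_inf [set cmod (lam 0 t) | t in [set t | 0 <= t]].
Proof.
split; first by exists (cmod (lam 0 0)), 0 => //=.
by exists ell => _ [t t0 <-]; exact: lam_ge.
Qed.

Lemma lam_inf_le t : 0 <= t -> lam_inf <= cmod (lam 0 t).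
Proof. by move=> t0; apply: ge_inf; [case: has_inf_lam|exists t]. Qed.

Lemma lam_inf_gt0 : 0 < lam_inf.
Proof.
apply: (lt_le_trans ell0); apply: lb_le_inf; first by case: has_inf_lam.
by move=> _ [t t0 <-]; exact: lam_ge.
Qed.

Lemma lam_inf_lim e : 0 < e -> exists2 T, 0 <= T &
  forall t, T <= t -> cmod (lam 0 t) <= lam_inf + e.
Proof.
move=> e0; have [_ [T T0 <-] h] := inf_adherent e0 has_inf_lam.
exists T => // t Tt; apply/ltW/(le_lt_trans _ h).
by rewrite (lam_mul (lexx 0) T0 Tt) normcM ler_piMl ?cmod_ge0// lam_le1.
Qed.

(** |lam t t'| is the quotient of |lam 0 t'| by |lam 0 t|, and both approach the same positive
    limit. *)
Lemma lam_gap e : 0 < e -> exists2 T, 0 <= T &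
  forall t t', T <= t -> t <= t' -> 1 - cmod (lam t t') <= e.
Proof.
move=> e0; have m0 := lam_inf_gt0.
have [T T0 HT] := lam_inf_lim (mulr_gt0 m0 e0); exists T => // t t' Tt tt'.
have t0 := le_trans T0 Tt; have t'0 := le_trans t0 tt'.
have := lam_inf_le t'0; rewrite (lam_mul (lexx 0) t0 tt') normcM => h1.
have h2 := HT t Tt; have x0 := cmod_ge0 (lam t t').
have h3 : cmod (lam t t') * cmod (lam 0 t) <= cmod (lam t t') * (lam_inf + lam_inf * e) by rewrite ler_wpM2l.
have h4 : lam_inf * 1 <= lam_inf * (cmod (lam t t') * (1 + e)) by lra.
rewrite ler_pM2l// in h4.
have h5 : cmod (lam t t') * e <= e by rewrite ler_piMl ?(ltW e0)// lam_le1.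
by lra.
Qed.

Lemma lam_ge_ell s t : 0 <= s -> s <= t -> ell <= cmod (lam s t).
Proof.
move=> s0 st; apply: (le_trans (lam_ge (le_trans s0 st))).
by rewrite (lam_mul (lexx 0) s0 st) normcM ler_piMr ?cmod_ge0// lam_le1.
Qed.

(** The family normalised to have derivative 1 at 0, as in Koenigs' linearisation. *)
Definition kpsi s t z : C := psi s t z / lam s t.

(** With L the Lipschitz constant of g: 2 L collects two errors in g, 1 + L is a Lipschitz constant
    of psi s t, and 1 / ell pays for the division by lam s t'. *)
Definition kpsi_const rho : R := 2 * lip_const rho * (1 + lip_const rho) / ell.

Lemma kpsi_const_ge0 rho : 0 <= rho < 1 -> 0 <= kpsi_const rho.
Proof.
move=> r01; have L0 := lip_const_ge0 r01; rewrite divr_ge0// ?(ltW ell0)//.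
by apply: mulr_ge0; [apply: mulr_ge0|lra].
Qed.

(** A Lipschitz bound in z on the increment in time gives more than its size: the case w = 0 makes
    [kpsi] Cauchy, and w near z makes its derivatives Cauchy. *)
Lemma kpsi_lip s t t' rho z w : 0 <= s -> s <= t -> t <= t' -> 0 <= rho < 1 ->
  cmod z <= rho -> cmod w <= rho ->
  cmod ((kpsi s t' z - kpsi s t z) - (kpsi s t' w - kpsi s t w)) <=
  kpsi_const rho * (1 - cmod (lam t t')) * cmod (z - w).
Proof.
move=> s0 st tt' r01 zr wr; have r1 : rho < 1 by case/andP: r01.
have t0 := le_trans s0 st; have st' := le_trans st tt'.
have z1 := le_lt_trans zr r1; have w1 := le_lt_trans wr r1.
have l1 := lam_neq0 s0 st; have l2 := lam_neq0 t0 tt'.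
have L0 := lip_const_ge0 r01.
set L := lip_const rho in L0 *.
pose A := psi s t z; pose B := psi s t w; pose l := lam t t'.
have Ar : cmod A <= rho by apply: le_trans zr; exact: psi_le.
have Br : cmod B <= rho by apply: le_trans wr; exact: psi_le.
have -> : (kpsi s t' z - kpsi s t z) - (kpsi s t' w - kpsi s t w) =
    ((A - B) * (g t t' A - l) + B * (g t t' A - g t t' B)) / lam s t'.
  rewrite /kpsi (lam_mul s0 st tt') (psi_comp s0 st tt' z1) (psi_comp s0 st tt' w1).
  rewrite -/A -/B (psiE A t0 tt') (psiE B t0 tt') -/l.
  by field; rewrite l1 l2.
have e0 : 0 <= 1 - cmod l by rewrite subr_ge0 lam_le1.
have AB : cmod (A - B) <= (1 + L) * cmod (z - w).
  rewrite /A /B !psiE//.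
  have -> : z * g s t z - w * g s t w = (z - w) * g s t z + w * (g s t z - g s t w) by ring.
  apply: (le_trans (cmodD _ _)); rewrite !normcM.
  have h1 : cmod (z - w) * cmod (g s t z) <= cmod (z - w) by rewrite ler_piMr ?cmod_ge0// g_le1.
  have h2 : cmod w * cmod (g s t z - g s t w) <= cmod (g s t z - g s t w).
    by rewrite ler_piMl ?cmod_ge0// ltW.
  have h3 := lip s0 st r01 zr wr.
  have h4 : lip_const rho * (1 - cmod (lam s t)) * cmod (z - w) <= L * 1 * cmod (z - w).
    apply: ler_wpM2r; first exact: cmod_ge0.
    by apply: ler_wpM2l => //; rewrite lerBlDr lerDl cmod_ge0.
  by lra.
have or : cmod (0 : C) <= rho by rewrite normc0; case/andP: r01.
have h1 : cmod (g t t' A - l) <= L * (1 - cmod l).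
  have := lip t0 tt' r01 Ar or; rewrite g0 subr0 => /le_trans; apply.
  by apply: ler_piMr; [exact: mulr_ge0|exact/ltW/(le_lt_trans Ar)].
have h2 := lip t0 tt' r01 Ar Br; rewrite -/L -/l in h2.
have AB0 := cmod_ge0 (A - B).
rewrite normcM normcV ler_pdivrMr; last by rewrite cmod_gt0 lam_neq0.
have num : cmod ((A - B) * (g t t' A - l) + B * (g t t' A - g t t' B)) <= 2 * L * (1 - cmod l) * cmod (A - B).
  apply: (le_trans (cmodD _ _)); rewrite !normcM.
  have h3 : cmod (A - B) * cmod (g t t' A - l) <= cmod (A - B) * (L * (1 - cmod l)) by rewrite ler_wpM2l.
  have h4 : cmod B * cmod (g t t' A - g t t' B) <= cmod (g t t' A - g t t' B).
    by rewrite ler_piMl ?cmod_ge0// ltW// (le_lt_trans Br).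
  by lra.
apply: (le_trans num).
apply: (@le_trans _ _ (2 * L * (1 - cmod l) * ((1 + L) * cmod (z - w)))).
  by rewrite ler_wpM2l// mulr_ge0// mulr_ge0.
apply: (@le_trans _ _ (kpsi_const rho * (1 - cmod l) * cmod (z - w) * ell)).
  by rewrite le_eqVlt; apply/orP; left; apply/eqP; rewrite /kpsi_const -/L; field; rewrite gt_eqF.
rewrite ler_wpM2l ?lam_ge_ell//.
by rewrite mulr_ge0 ?cmod_ge0// mulr_ge0// kpsi_const_ge0.
Qed.

Lemma kpsi0 s t : 0 <= s -> s <= t -> kpsi s t 0 = 0.
Proof. by move=> s0 st; rewrite /kpsi psi0// mul0r. Qed.

Lemma kpsi_diff s t z : 0 <= s -> s <= t -> cmod z < 1 -> exists l, cdiff (kpsi s t) z l.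
Proof.
move=> s0 st z1; have [l Hl] := psi_diff s0 st z1.
by eexists; apply: cdiffM; [exact: Hl|exact: cdiff_cst].
Qed.

Lemma kpsi_limit s : 0 <= s -> exists kk : C -> C,
  [/\ forall z, cmod z < 1 -> exists l, cdiff kk z l,
      forall z w, cmod z < 1 -> cmod w < 1 -> kk z = kk w -> z = w,
      kk 0 = 0 &
      forall rho e, 0 <= rho < 1 -> 0 < e -> exists2 T, s <= T &
        forall t z, T <= t -> cmod z <= rho -> cmod (kpsi s t z - kk z) <= e].
Proof.
move=> s0.
have gap rho e : 0 <= rho < 1 -> 0 < e -> exists2 T, s <= T & forall t t' z w, T <= t -> t <= t' ->
    cmod z <= rho -> cmod w <= rho ->
    cmod ((kpsi s t' z - kpsi s t z) - (kpsi s t' w - kpsi s t w)) <= e * cmod (z - w).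
  move=> r01 e0; have K0 := kpsi_const_ge0 r01.
  have q0 : 0 < e / (kpsi_const rho + 1) by rewrite divr_gt0// ltr_wpDl.
  have [T T0 HT] := lam_gap q0.
  exists (Num.max s T); first by rewrite le_max lexx.
  move=> t t' z w; rewrite ge_max => /andP[st Tt] tt' zr wr.
  apply: (le_trans (kpsi_lip s0 st tt' r01 zr wr)); rewrite ler_wpM2r ?cmod_ge0//.
  have h1 := HT t t' Tt tt'.
  have h2 : 0 <= 1 - cmod (lam t t') by rewrite subr_ge0 lam_le1//; exact: le_trans st.
  have h3 : kpsi_const rho * (1 - cmod (lam t t')) <= kpsi_const rho * (e / (kpsi_const rho + 1)) by rewrite ler_wpM2l.
  apply: (le_trans h3); rewrite mulrCA ler_piMr ?(ltW e0)// ler_pdivrMr ?ltr_wpDl//.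
  by rewrite mul1r lerDl.
(* Outside the disc the limit gets the default 0. Inside, w = 0 in [gap] gives the Cauchy property,
   since [kpsi] vanishes at 0. *)
have lim z : exists l, cmod z < 1 -> forall e, 0 < e -> exists2 T, s <= T & forall t, T <= t -> cmod (kpsi s t z - l) <= e.
  have [z1|z1] := ltP (cmod z) 1; last by exists 0.
  have r01 : 0 <= cmod z < 1 by rewrite cmod_ge0.
  have [|l Hl] := @cauchy_limit R (fun t => kpsi s t z).
    move=> e e0; have [T sT HT] := gap _ _ r01 e0; exists T => t t' Tt tt'.
    have := HT t t' z 0 Tt tt'; rewrite lexx normc0 cmod_ge0 => /(_ isT isT).
    rewrite !kpsi0// ?(le_trans sT)// ?(le_trans Tt)// !subr0 => /le_trans; apply.
    by rewrite ler_piMr ?ltW.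
  exists l => _ e e0; have [T HT] := Hl e e0.
  exists (Num.max s T); first by rewrite le_max lexx.
  by move=> t; rewrite ge_max => /andP[_ Tt]; exact: HT.
have /choice[kk Hk] := lim.
(* This is [gap] with t' sent to infinity. *)
have diff rho e : 0 <= rho < 1 -> 0 < e -> exists2 T, s <= T & forall t z w, T <= t ->
    cmod z <= rho -> cmod w <= rho ->
    cmod ((kk z - kpsi s t z) - (kk w - kpsi s t w)) <= e * cmod (z - w).
  move=> r01 e0; have [T sT HT] := gap _ _ r01 e0; exists T => // t z w Tt zr wr.
  have r1 : rho < 1 by case/andP: r01.
  apply/ler_addgt0Pr => d d0; have d2 : 0 < d / 2 by rewrite divr_gt0.
  have [T1 _ H1] := Hk z (le_lt_trans zr r1) _ d2.
  have [T2 _ H2] := Hk w (le_lt_trans wr r1) _ d2.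
  pose t' := Num.max t (Num.max T1 T2).
  have tt' : t <= t' by rewrite /t' le_max lexx.
  have h1 : T1 <= t' by rewrite /t' !le_max lexx !orbT.
  have h2 : T2 <= t' by rewrite /t' !le_max lexx !orbT.
  have := HT t t' z w Tt tt' zr wr; have := H1 t' h1; have := H2 t' h2 => a1 a2 a3.
  have -> : (kk z - kpsi s t z) - (kk w - kpsi s t w) =
    ((kpsi s t' z - kpsi s t z) - (kpsi s t' w - kpsi s t w)) + ((kpsi s t' w - kk w) - (kpsi s t' z - kk z)) by ring.
  apply: (le_trans (cmodD _ _)); have := cmodB (kpsi s t' w - kk w) (kpsi s t' z - kk z); lra.
have kk0 : kk 0 = 0.
  apply/eqP; rewrite -cmod_eq0 eq_le cmod_ge0 andbT; apply/ler_addgt0Pr => e e0; rewrite add0r.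
  have [T sT HT] := Hk 0 zero_lt1 e e0.
  by have := HT T (lexx T); rewrite kpsi0// sub0r cmodN.
exists kk; split=> //.
- move=> z z1.
  pose rho := (cmod z + 1) / 2.
  have r01 : 0 <= rho < 1 by have := cmod_ge0 z; rewrite /rho => ?; apply/andP; split; lra.
  have near w : cmod (w - z) < (1 - cmod z) / 2 -> cmod w <= rho.
    by have := cmod_dist w z; rewrite /rho; lra.
  have zr : cmod z <= rho by rewrite /rho; lra.
  have gz : 0 < (1 - cmod z) / 2 by lra.
  have /choice[dl Hdl] t : exists l, s <= t -> cdiff (kpsi s t) z l.
    have [st|ts] := leP s t; last by exists 0.
    by have [l Hl] := kpsi_diff s0 st z1; exists l.
  have [|l Hl] := @cauchy_limit R dl.
    move=> e e0; have [T sT HT] := gap _ _ r01 e0; exists T => t t' Tt tt'.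
    have st := le_trans sT Tt; have st' := le_trans st tt'.
    have dd := cdiffD (Hdl t' st') (cdiffM (cdiff_cst (-1) z) (Hdl t st)).
    rewrite mul0r add0r mulN1r in dd.
    apply: (@cdiff_le _ _ _ _ _ ((1 - cmod z) / 2) gz dd) => w wz.
    by have := HT t t' w z Tt tt' (near _ wz) zr; rewrite !mulN1r.
  exists l => e e0; have e3 : 0 < e / 3 by rewrite divr_gt0.
  have [T1 sT1 H1] := diff _ _ r01 e3; have [T2 H2] := Hl _ e3.
  pose t := Num.max T1 T2.
  have t1 : T1 <= t by rewrite le_max lexx.
  have t2 : T2 <= t by rewrite le_max lexx orbT.
  have [d d0 Hd] := Hdl t (le_trans sT1 t1) _ e3.
  exists (Num.min d ((1 - cmod z) / 2)); first by rewrite lt_min d0.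
  move=> w; rewrite lt_min => /andP[/Hd h1 /near wr].
  have h2 := H1 t w z t1 wr zr.
  have h3 : cmod ((dl t - l) * (w - z)) <= e / 3 * cmod (w - z).
    by rewrite normcM ler_wpM2r ?cmod_ge0// H2.
  have -> : kk w - kk z - l * (w - z) = ((kk w - kpsi s t w) - (kk z - kpsi s t z)) +
    (kpsi s t w - kpsi s t z - dl t * (w - z)) + (dl t - l) * (w - z) by ring.
  apply: (le_trans (cmodD _ _)).
  have := cmodD (kk w - kpsi s t w - (kk z - kpsi s t z)) (kpsi s t w - kpsi s t z - dl t * (w - z)).
  by lra.
- move=> z w z1 w1 E.
  pose rho := Num.max (cmod z) (cmod w).
  have r01 : 0 <= rho < 1 by rewrite le_max cmod_ge0/= gt_max z1.
  have zr : cmod z <= rho by rewrite le_max lexx.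
  have wr : cmod w <= rho by rewrite le_max lexx orbT.
  pose K := pick_const rho + lip_const rho.
  have K0 : 0 < K by apply: ltr_pwDl; [exact: pick_const_gt0|exact: lip_const_ge0].
  have e0 : 0 < (2 * K)^-1 by rewrite invr_gt0 mulr_gt0.
  have [T T0 HT] := lam_gap e0.
  pose t := Num.max s T.
  have st : s <= t by rewrite le_max lexx.
  have t0 := le_trans s0 st.
  pose A := psi s t z; pose B := psi s t w.
  have Ar : cmod A <= rho by apply: le_trans zr; exact: psi_le.
  have Br : cmod B <= rho by apply: le_trans wr; exact: psi_le.
  (* After the time t at most half of the distance between A and B is lost, uniformly in t'. Equal
     limits thus force A = B, and [psi_inj] goes back from time t to time s. *)
  have low t' : t <= t' -> cmod (A - B) / 2 <= cmod (kpsi s t' z - kpsi s t' w).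
    move=> tt'; have st' := le_trans st tt'.
    have := psi_lower t0 tt' r01 Ar Br; rewrite -/K => h1.
    have h2 : K * (1 - cmod (lam t t')) <= 2^-1.
      have := HT t t'; rewrite le_max lexx orbT => /(_ isT tt').
      rewrite -(ler_pM2l K0) => /le_trans; apply.
      by rewrite le_eqVlt; apply/orP; left; apply/eqP; field; rewrite gt_eqF.
    rewrite /kpsi -mulrBl normcM normcV !(psi_comp s0 st tt')// -/A -/B.
    have lp : 0 < cmod (lam s t') by rewrite cmod_gt0 lam_neq0.
    have l1 := lam_le1 s0 st'.
    rewrite ler_pdivlMr//.
    have := cmod_ge0 (A - B) => ab0.
    have : cmod (A - B) / 2 * cmod (lam s t') <= cmod (A - B) / 2 by rewrite ler_piMr// divr_ge0.
    have : K * (1 - cmod (lam t t')) * cmod (A - B) <= 2^-1 * cmod (A - B) by rewrite ler_wpM2r.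
    by lra.
  have AB : A = B.
    apply/eqP; rewrite -subr_eq0 -cmod_eq0 eq_le cmod_ge0 andbT.
    apply/ler_addgt0Pr => e ep; rewrite add0r; have e4 : 0 < e / 4 by rewrite divr_gt0.
    have [T1 _ H1] := Hk z z1 _ e4; have [T2 _ H2] := Hk w w1 _ e4.
    pose t' := Num.max t (Num.max T1 T2).
    have tt' : t <= t' by rewrite /t' le_max lexx.
    have h1 : T1 <= t' by rewrite /t' !le_max lexx !orbT.
    have h2 : T2 <= t' by rewrite /t' !le_max lexx !orbT.
    have := H1 t' h1; have := H2 t' h2; have := low t' tt'; rewrite E.
    rewrite (_ : kpsi s t' z - kpsi s t' w = (kpsi s t' z - kk w) - (kpsi s t' w - kk w)); last by ring.
    by have := cmodB (kpsi s t' z - kk w) (kpsi s t' w - kk w); lra.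
  exact: (psi_inj s0 st z1 w1 AB).
- move=> rho e r01 e0; have r1 : rho < 1 by case/andP: r01.
  have [T sT HT] := diff _ _ r01 e0; exists T => // t z Tt zr.
  have := HT t z 0 Tt zr; rewrite normc0 => /(_ (proj1 (andP r01))).
  rewrite kk0 kpsi0 ?(le_trans sT)// !subr0 cmodC => /le_trans; apply.
  by apply: ler_piMr; [exact: ltW|exact/ltW/(le_lt_trans zr)].
Qed.

(** Cutting time off at 0 makes the phase unimodular and continuous on the whole line. *)
Definition phase t : C := lam 0 (Num.max 0 t) / (cmod (lam 0 (Num.max 0 t)))%:C.

Lemma cmod_phase t : cmod (phase t) = 1.
Proof.
have t0 : 0 <= Num.max 0 t by rewrite le_max lexx.
have n0 : cmod (lam 0 (Num.max 0 t)) != 0 by rewrite cmod_eq0 lam_neq0.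
by rewrite normcM normcV cmod_real ger0_norm ?cmod_ge0// divff.
Qed.

Lemma lam_phase t : 0 <= t -> lam 0 t = (cmod (lam 0 t))%:C * phase t.
Proof.
move=> t0; rewrite /phase max_r// mulrC divfK//.
by rewrite -cmod_gt0 cmod_real normr_gt0 cmod_eq0 lam_neq0.
Qed.

Lemma phase_continuous t : curve_cont phase t.
Proof.
move=> e e0; have q0 : 0 < e / 4 * ell by rewrite mulr_gt0// divr_gt0.
pose T := `|t| + 1.
have [d d0 Hd] := lam_near1 T q0.
exists (Num.min d 1); first by rewrite lt_min d0 ltr01.
have ordered s u : s <= u -> u <= T -> `|u - s| < d -> cmod (phase u - phase s) < e.
  move=> su uT usd.
  set s' := Num.max 0 s; set u' := Num.max 0 u.
  have s'0 : 0 <= s' by rewrite le_max lexx.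
  have su' : s' <= u'.
    rewrite /s' /u' ge_max !le_max lexx/= su orbT//.
  have T0 : 0 <= T by rewrite /T addr_ge0.
  have u'T : u' <= T by rewrite ge_max T0.
  have us' : u' - s' < d.
    move: usd; rewrite ger0_norm ?subr_ge0// /u' /s' /Num.max /Order.max.
    have [a1|a1] := ltP 0 s; have [a2|a2] := ltP 0 u; lra.
  have n1 : 0 < cmod (lam 0 s') by rewrite cmod_gt0 lam_neq0.
  have u'0 := le_trans s'0 su'.
  have n2 : 0 < cmod (lam 0 u') by rewrite cmod_gt0 lam_neq0.
  have := Hd _ _ s'0 su' u'T us' => h.
  have E : lam 0 u' - lam 0 s' = lam 0 s' * (lam s' u' - 1) by rewrite (lam_mul (lexx 0) s'0 su'); ring.
  have h1 : cmod (lam 0 u' - lam 0 s') < e / 4 * ell.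
    by rewrite E normcM; apply: le_lt_trans h; rewrite ler_piMl ?cmod_ge0// lam_le1.
  have h2 : cmod ((cmod (lam 0 s'))%:C - (cmod (lam 0 u'))%:C) <= cmod (lam 0 u' - lam 0 s').
    rewrite -rmorphB cmod_real ler_norml.
    have := cmod_dist (lam 0 u') (lam 0 s'); have := cmod_dist (lam 0 s') (lam 0 u').
    by rewrite (cmodC (lam 0 s')) => ? ?; apply/andP; split; lra.
  have c1 : (cmod (lam 0 s'))%:C != 0 by rewrite -cmod_gt0 cmod_real normr_gt0 gt_eqF.
  have c2 : (cmod (lam 0 u'))%:C != 0 by rewrite -cmod_gt0 cmod_real normr_gt0 gt_eqF.
  (* Normalising costs at most as much as the increment of [lam], so the numerator is below 2 (e /
     4) ell, while the denominator is at least ell. *)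
  have P : phase u - phase s = ((lam 0 u' - lam 0 s') + phase u * ((cmod (lam 0 s'))%:C - (cmod (lam 0 u'))%:C)) / (cmod (lam 0 s'))%:C.
    by rewrite /phase -/u' -/s'; field; rewrite c1 c2.
  rewrite P normcM normcV cmod_real ger0_norm ?cmod_ge0// ltr_pdivrMr//.
  apply: (le_lt_trans (cmodD _ _)); rewrite normcM cmod_phase mul1r.
  have : e * ell <= e * cmod (lam 0 s') by rewrite ler_pM2l// lam_ge.
  have : 0 < e * ell by rewrite mulr_gt0.
  by lra.
move=> u; rewrite lt_min => /andP[ud u1].
have tT : t <= T by rewrite /T; have := ler_norm t; lra.
have uT : u <= T by rewrite /T; have := ler_norm t; move: u1; rewrite ltr_norml => /andP[? ?]; lra.
have [tu|/ltW ut] := leP t u; first exact: ordered.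
by rewrite cmodC; apply: ordered => //; rewrite distrC.
Qed.

(** Here psi s t = lam s t * kpsi s t with lam s t = |lam 0 t| * phase t / lam 0 s, and |lam 0 t|
    tends to [lam_inf]. This dictates the factor lam_inf / lam 0 s in front of the limit of
    [kpsi]. *)
Lemma psi_asymptotics s : 0 <= s -> exists h : C -> C,
  [/\ forall z, cmod z < 1 -> exists l, cdiff h z l,
      forall z w, cmod z < 1 -> cmod w < 1 -> h z = h w -> z = w,
      h 0 = 0,
      forall z, cmod z < 1 -> cmod (h z) <= cmod z &
      forall rho e, 0 <= rho < 1 -> 0 < e -> exists2 T, s <= T &
        forall t z, T <= t -> cmod z <= rho -> cmod (psi s t z - phase t * h z) <= e].
Proof.
move=> s0; have [kk [dk ik k0 ck]] := kpsi_limit s0.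
have ls := lam_neq0 (lexx 0) s0.
have m0 := lam_inf_gt0.
pose c : C := lam_inf%:C / lam 0 s.
have c0 : c != 0.
  by rewrite mulf_neq0 ?invr_neq0// -cmod_gt0 cmod_real normr_gt0 gt_eqF.
pose h z := c * kk z.
have asym rho e : 0 <= rho < 1 -> 0 < e -> exists2 T, s <= T &
    forall t z, T <= t -> cmod z <= rho -> cmod (psi s t z - phase t * h z) <= e.
  move=> r01 e0.
  have e2 : 0 < e / 2 by rewrite divr_gt0.
  have [T1 sT1 H1] := ck _ _ r01 e2.
  have q0 : 0 < e / 2 * ell ^+ 2 by rewrite mulr_gt0// exprn_gt0.
  have [T2 T20 H2] := lam_inf_lim q0.
  exists (Num.max T1 T2); first by rewrite le_max sT1.
  move=> t z; rewrite ge_max => /andP[t1 t2] zr.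
  have st := le_trans sT1 t1; have t0 := le_trans s0 st.
  have z1 : cmod z < 1 by apply: (le_lt_trans zr); case/andP: r01.
  have lst := lam_neq0 s0 st; have l0t := lam_neq0 (lexx 0) t0.
  have lE : lam s t = (cmod (lam 0 t))%:C * phase t / lam 0 s.
    by rewrite -lam_phase// (lam_mul (lexx 0) s0 st) mulfK.
  have -> : psi s t z - phase t * h z = lam s t * (kpsi s t z - kk z) + ((cmod (lam 0 t))%:C - lam_inf%:C) * phase t / lam 0 s * kk z.
    by rewrite mulrBr /kpsi mulrC [lam s t * (_ / _)]mulrCA divff// mulr1 mulrC lE /h /c; ring.
  move: (phase t) (cmod_phase t) => ph phE.
  apply: (le_trans (cmodD _ _)); rewrite !normcM -rmorphB cmod_real phE mulr1 normcV.
  have b1 : cmod (lam s t) * cmod (kpsi s t z - kk z) <= e / 2.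
    apply: (@le_trans _ _ (1 * (e / 2))); last by rewrite mul1r.
    by apply: ler_pM; rewrite ?cmod_ge0 ?lam_le1 ?H1.
  have b2 : `|cmod (lam 0 t) - lam_inf| <= e / 2 * ell ^+ 2.
    have := H2 t t2; have := lam_inf_le t0 => ? ?.
    by rewrite ger0_norm; lra.
  have b3 : cmod (kk z) <= ell^-1.
    apply/ler_addgt0Pr => d d0.
    have r01z : 0 <= cmod z < 1 by rewrite cmod_ge0.
    have [T3 sT3 H3] := ck _ _ r01z d0.
    have := H3 T3 z (lexx _) (lexx _).
    have : cmod (kpsi s T3 z) <= ell^-1.
      rewrite /kpsi normcM normcV -[leRHS]mul1r; apply: ler_pM; rewrite ?invr_ge0 ?cmod_ge0//.
        by apply/ltW/psi_disk.
      by rewrite lef_pV2 ?posrE ?cmod_gt0 ?lam_neq0// lam_ge_ell.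
    have := cmod_dist (kk z) (kpsi s T3 z); rewrite cmodC; lra.
  have b4 : (cmod (lam 0 s))^-1 <= ell^-1 by rewrite lef_pV2 ?posrE ?cmod_gt0// lam_ge.
  have b5 : `|cmod (lam 0 t) - lam_inf| / cmod (lam 0 s) * cmod (kk z) <= e / 2 * ell ^+ 2 * ell^-1 * ell^-1.
    apply: ler_pM; rewrite ?cmod_ge0//; first by rewrite divr_ge0 ?cmod_ge0.
    by apply: ler_pM; rewrite // invr_ge0 cmod_ge0.
  have : e / 2 * ell ^+ 2 * ell^-1 * ell^-1 = e / 2 by field; rewrite gt_eqF.
  by lra.
exists h; split=> //.
- move=> z z1; have [l Hl] := dk z z1.
  by eexists; apply: cdiffM; [exact: cdiff_cst|exact: Hl].
- by move=> z w z1 w1 /(mulfI c0); exact: ik.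
- by rewrite /h k0 mulr0.
- move=> z z1; apply/ler_addgt0Pr => e e0.
  have r01 : 0 <= cmod z < 1 by rewrite cmod_ge0.
  have [T sT HT] := asym _ _ r01 e0.
  have := HT T z (lexx _) (lexx _); have := psi_le s0 sT z1.
  have E : cmod (phase T * h z) = cmod (h z) by rewrite [LHS]normcM cmod_phase mul1r.
  by have := cmod_dist (phase T * h z) (psi s T z); rewrite cmodC E; lra.
Qed.

End NonDegenerate.

End Dichotomy.

(** * The fundamental theorem of calculus for absolutely continuous functions *)

Section AbsoluteContinuity.
Context {R : realType}.
Local Notation mu := (@lebesgue_measure R).
Implicit Types (a b x y u v e d : R) (F G : R -> R) (l : seq (R * R)) (p q : R * R).

Definition nonoverlapping p q := (p.2 <= q.1) || (q.2 <= p.1).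

Definition subintervals a b l :=
  all (fun p => [&& a <= p.1, p.1 <= p.2 & p.2 <= b]) l && pairwise nonoverlapping l.

(** Lists of intervals can be split and refined one entry at a time, and a non-strict conclusion
    survives the supremum that defines the total variation. *)
Definition ac_real a b F := forall e, 0 < e -> exists2 d, 0 < d &
  forall l, subintervals a b l -> \sum_(p <- l) (p.2 - p.1) < d ->
    \sum_(p <- l) `|F p.2 - F p.1| <= e.

Lemma nonoverlapping_sub p q p' : p.1 <= p'.1 -> p'.2 <= p.2 -> nonoverlapping p q -> nonoverlapping p' q.
Proof.
move=> h1 h2; rewrite /nonoverlapping => /orP[h|h]; apply/orP.
  by left; exact: le_trans h.
by right; exact: (le_trans h).
Qed.

Lemma nonoverlappingC p q : nonoverlapping p q = nonoverlapping q p.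
Proof. by rewrite /nonoverlapping orbC. Qed.

Definition partition_pairs u (s : seq R) : seq (R * R) := zip (u :: s) s.

Lemma partition_pairsP u v s : itv_partition u v s ->
  [/\ subintervals u v (partition_pairs u s),
      \sum_(p <- partition_pairs u s) (p.2 - p.1) = v - u &
      forall F, variation u v F s = \sum_(p <- partition_pairs u s) `|F p.2 - F p.1|].
Proof.
move=> h; split; last first.
- move=> F; rewrite (variation_zip _ h) /partition_pairs.
  elim: s u {h} => [|x s IH] u /=; first by rewrite !big_nil.
  by rewrite !big_cons /= IH.
- case: h => _ /eqP; rewrite /partition_pairs.
  elim: s u => [|x s IH] u /=; first by rewrite big_nil => ->; rewrite subrr.
  by move=> /IH E; rewrite big_cons E /=; ring.
case: h => p /eqP E; have ab : u <= v.
  elim: s u p E => [|x s IH] u /= => [_ ->//|/andP[ux p] E].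
  by apply: (le_trans (ltW ux)); exact: IH p E.
rewrite /subintervals /partition_pairs; elim: s u ab p E => [//|x s IH] u uv /= /andP[ux p] E.
have xv : x <= v.
  elim: s x p E {ux IH} => [|y s IH] x /= => [_ ->//|/andP[xy p] E].
  by apply: (le_trans (ltW xy)); exact: IH p E.
have /andP[h1 h2] := IH x xv p E.
rewrite lexx (ltW ux) xv /= h2 andbT; apply/andP; split; apply/allP => q /(allP h1)/and3P[q1 q2 q3].
  by rewrite (le_trans (ltW ux) q1) q2 q3.
by rewrite /nonoverlapping /= q1.
Qed.

Lemma subintervals_cons a b p l : subintervals a b (p :: l) =
  [&& [&& a <= p.1, p.1 <= p.2 & p.2 <= b], all (nonoverlapping p) l & subintervals a b l].
Proof.
rewrite /subintervals /=; case: (all _ l) => /=; rewrite ?andbF ?andbT //=.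
all: by case: (all _ l); rewrite ?andbF ?andbT.
Qed.

Lemma subintervals_cat a b l1 l2 : subintervals a b (l1 ++ l2) =
  [&& subintervals a b l1, subintervals a b l2 & allrel nonoverlapping l1 l2].
Proof.
rewrite /subintervals all_cat pairwise_cat.
by case: all; case: all; case: pairwise; case: pairwise; case: allrel.
Qed.

Lemma subintervals_refine a b p l1 l2 s : subintervals a b ((p :: l1) ++ l2) ->
  itv_partition p.1 p.2 s -> subintervals a b (l1 ++ (partition_pairs p.1 s ++ l2)).
Proof.
rewrite cat_cons subintervals_cons => /and3P[/and3P[ap pp pb] sep good] hs.
have [/andP[sub pw] _ _] := partition_pairsP hs.
have Hsep q q' : q \in partition_pairs p.1 s -> q' \in l1 ++ l2 -> nonoverlapping q q'.
  move=> /(allP sub)/and3P[q1 q2 q3] /(allP sep); exact: nonoverlapping_sub.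
rewrite !subintervals_cat; rewrite subintervals_cat in good; case/and3P: good => g1 g2 g3.
rewrite g1 g2 /= -andbA; apply/and3P; split.
- rewrite /subintervals pw andbT; apply/allP => q /(allP sub)/and3P[q1 q2 q3].
  by rewrite (le_trans ap q1) q2 (le_trans q3 pb).
- by apply/allrelP => q q' hq hq'; apply: Hsep => //; rewrite mem_cat hq' orbT.
- rewrite allrel_catr; apply/andP; split=> //.
  by apply/allrelP => q q' hq hq'; rewrite nonoverlappingC; apply: Hsep => //; rewrite mem_cat hq.
Qed.

Section TotalVariation.
Variables (a b : R) (F : R -> R).
Hypothesis acF : ac_real a b F.

(** Increments are exchanged for total variations one interval at a time: refining an interval keeps
    the total length, so the bound holds for each of its partitions while the other intervals stay
    fixed, and the supremum may be taken. *)
Lemma total_variation_sum_le e d : (forall l, subintervals a b l -> \sum_(p <- l) (p.2 - p.1) < d ->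
    \sum_(p <- l) `|F p.2 - F p.1| <= e) ->
  forall l1 l2, subintervals a b (l1 ++ l2) -> \sum_(p <- l1 ++ l2) (p.2 - p.1) < d ->
  exists2 w, (\sum_(p <- l1) total_variation p.1 p.2 F = w%:E)%E & w + \sum_(p <- l2) `|F p.2 - F p.1| <= e.
Proof.
move=> H; elim=> [|p l1 IH] l2 good len.
  by exists 0; rewrite ?big_nil// add0r; exact: H.
have pp : p.1 <= p.2 by move: good; rewrite cat_cons subintervals_cons => /and3P[/and3P[]].
have step s : itv_partition p.1 p.2 s -> exists2 w, (\sum_(q <- l1) total_variation q.1 q.2 F = w%:E)%E &
    variation p.1 p.2 F s <= e - w - \sum_(q <- l2) `|F q.2 - F q.1|.
  move=> hs; have [_ L V] := partition_pairsP hs.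
  have [|w w1 w2] := IH (partition_pairs p.1 s ++ l2) (subintervals_refine good hs).
    by move: len; rewrite cat_cons big_cons !big_cat /= L; lra.
  by exists w => //; move: w2; rewrite big_cat /= -V; lra.
have [s0 hs0] : exists s, itv_partition p.1 p.2 s.
  move: pp; rewrite le_eqVlt => /predU1P[E|lt]; last by exists [:: p.2]; exact: itv_partition1.
  by exists [::]; split=> //=; rewrite E.
have [w w1 _] := step _ hs0.
have TVle : (total_variation p.1 p.2 F <= (e - w - \sum_(q <- l2) `|F q.2 - F q.1|)%:E)%E.
  apply: ge_ereal_sup => _ [_ [s hs <-] <-]; rewrite lee_fin.
  by have [w'] := step _ hs; rewrite w1 => -[->].
have TV0 := @total_variation_ge0 R p.1 p.2 F pp.
have TVfin : total_variation p.1 p.2 F \is a fin_num.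
  by rewrite ge0_fin_numE//; apply: (le_lt_trans TVle); rewrite ltry.
exists (fine (total_variation p.1 p.2 F) + w).
  by rewrite big_cons w1 EFinD fineK.
by move: TVle; rewrite -(fineK TVfin) lee_fin; lra.
Qed.

Lemma ac_total_variation_fin x y : a <= x -> x <= y -> y <= b ->
  total_variation x y F \is a fin_num.
Proof.
move=> ax xy yb; have [d d0 Hd] := acF ltr01.
(* Total variation is additive and finite on short intervals. The shift by a is there because
   [time_chain] starts at 0. *)
have := @time_chain R (fun s t => total_variation (a + s) (a + t) F \is a fin_num) (b - a) d d0.
move=> /(_ _ _ (x - a) (y - a)); rewrite !subrKC; apply; rewrite ?subr_ge0 ?lerD2r//.
- move=> s t s0 st tb ts.
  have [||w] := total_variation_sum_le Hd (l1 := [:: (a + s, a + t)]) (l2 := [::]).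
  + by rewrite /subintervals /= !andbT; apply/and3P; split; lra.
  + by rewrite big_seq1 /=; lra.
  by rewrite big_seq1 /= => ->.
- move=> s u t s0 su ut tb h1 h2.
  by rewrite (@total_variationD _ _ _ (a + u)) ?lerD2l// fin_numD h1.
Qed.

Definition tv_fun x : R := fine (total_variation a x F).

Lemma tv_fun_increment x y : a <= x -> x <= y -> y <= b ->
  tv_fun y - tv_fun x = fine (total_variation x y F).
Proof.
move=> ax xy yb; rewrite /tv_fun (@total_variationD _ a y x)// fineD.
- by ring.
- by apply: ac_total_variation_fin; rewrite // (le_trans xy).
- by apply: ac_total_variation_fin.
Qed.

Lemma increment_le_tv x y : a <= x -> x <= y -> y <= b -> `|F y - F x| <= tv_fun y - tv_fun x.
Proof.
move=> ax xy yb; rewrite tv_fun_increment// -lee_fin fineK; last exact: ac_total_variation_fin.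
exact: total_variation_ge.
Qed.

Lemma ac_tv_fun : ac_real a b tv_fun.
Proof.
move=> e e0; have [d d0 Hd] := acF e0; exists d => // l good len.
have [||w w1 w2] := total_variation_sum_le Hd (l1 := l) (l2 := [::]).
- by rewrite cats0.
- by rewrite cats0.
rewrite big_nil addr0 in w2; apply: le_trans w2.
rewrite le_eqVlt; apply/orP; left; apply/eqP/EFin_inj; rewrite -w1 -sumEFin.
apply: eq_big_seq => p pl.
case/andP: good => /allP/(_ _ pl)/and3P[h1 h2 h3] _.
rewrite tv_fun_increment// ger0_norm ?fine_ge0 ?total_variation_ge0// fineK//.
exact: ac_total_variation_fin.
Qed.

End TotalVariation.

Section MonotoneAC.
Variables (a b : R) (G : R -> R).
Hypotheses (ab : a < b) (ndG : forall x y, a <= x -> x <= y -> y <= b -> G x <= G y)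
  (acG : ac_real a b G).

(** A Stieltjes measure wants a function on the whole line, so G is continued by its values at the
    ends. *)
Let cl x : R := Num.max a (Num.min x b).
Let Gc x : R := G (cl x).

Let cl_ge x : a <= cl x. Proof. by rewrite /cl le_max lexx. Qed.
Let cl_le x : cl x <= b. Proof. by rewrite /cl ge_max (ltW ab) ge_min lexx orbT. Qed.
Let cl_id x : a <= x -> x <= b -> cl x = x.
Proof. by move=> ax xb; rewrite /cl min_l// max_r. Qed.
Let cl_mono x y : x <= y -> cl x <= cl y /\ cl y - cl x <= y - x.
Proof.
move=> xy; rewrite /cl /Num.max /Num.min /Order.max /Order.min.
have [h1|h1] := ltP x b; have [h2|h2] := ltP y b;
  [have [h3|h3] := ltP a x; have [h4|h4] := ltP a y|have [h3|h3] := ltP a x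
   |have [h4|h4] := ltP a y|idtac]; try have [h5|h5] := ltP a b; split; lra.
Qed.

Let Gc_nd : {homo Gc : x y / x <= y}.
Proof. by move=> x y xy; apply: ndG => //; case: (cl_mono xy). Qed.

Let Gc_cont : continuous Gc.
Proof.
move=> x; apply: continuous_eps => e e0; have e2 : 0 < e / 2 by rewrite divr_gt0.
have [d d0 Hd] := acG e2; exists d => // y yx.
have key u v : u <= v -> v - u < d -> `|Gc v - Gc u| < e.
  move=> uv vu; have [h1 h2] := cl_mono uv.
  have := Hd [:: (cl u, cl v)]; rewrite !big_seq1 /= => h.
  apply: (@le_lt_trans _ _ (e / 2)); last by lra.
  by apply: h; [rewrite /subintervals /= cl_ge h1 cl_le|lra].
have [xy|/ltW yx'] := leP x y; first by apply: key => //; rewrite ger0_norm ?subr_ge0 in yx.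
by rewrite distrC; apply: key => //; rewrite distrC ger0_norm ?subr_ge0 in yx.
Qed.

Let Gc_rc : right_continuous Gc.
Proof. by apply: right_continuousW; exact: Gc_cont. Qed.

HB.instance Definition _ := isCumulative.Build R _ R Gc Gc_nd Gc_rc.

Let nu := lebesgue_stieltjes_measure (Gc : cumulative R R).

Let nu_itv u v : u <= v -> nu `]u, v]%classic = (Gc v - Gc u)%:E.
Proof.
move=> uv; rewrite /nu /lebesgue_stieltjes_measure /measure_extension measurable_mu_extE/=; last exact: is_ocitv.
by rewrite wlength_itv_bnd.
Qed.

Let nu_fin : (nu `]a, b]%classic < +oo)%E.
Proof. by rewrite nu_itv ?ltW// ltry. Qed.

Let mab : measurable (`]a, b]%classic : set (measurableTypeR R)).
Proof. exact: measurable_itv. Qed.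

Let nu' := mfrestr mab nu_fin.

(** The window makes the end points finite; the pair (a, a) encodes the empty interval. *)
Let open_interval_bounds (I : set R) : open I -> is_interval I -> I `<=` `]a - 1, b + 1[%classic ->
  exists p : R * R, (p = (a, a) \/ p.1 < p.2) /\ I = `]p.1, p.2[%classic.
Proof.
move=> oI iI sI.
have [->|/set0P[x Ix]] := eqVneq I set0; first by exists (a, a); split; [left|rewrite set_itvoo0].
have hs : has_sup I.
  by split; [exists x|exists (b + 1) => y /sI; rewrite /= in_itv/= => /andP[_ /ltW]].
have hi : has_inf I.
  by split; [exists x|exists (a - 1) => y /sI; rewrite /= in_itv/= => /andP[/ltW]].
have ball y : I y -> exists2 d, 0 < d & forall z, `|y - z| < d -> I z.
  by move=> Iy; have /nbhs_ballP[d /= d0 Hd] := open_nbhs_nbhs (conj oI Iy); exists d.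
have inside y : I y -> inf I < y < sup I.
  move=> Iy; have [d d0 Hd] := ball y Iy; apply/andP; split.
    apply: (@le_lt_trans _ _ (y - d / 2)); last by lra.
    by apply: ge_inf; [case: hi|apply: Hd; rewrite gtr0_norm; lra].
  apply: (@lt_le_trans _ _ (y + d / 2)); first by lra.
  apply: ub_le_sup; [by case: hs|apply: Hd].
  by rewrite (_ : y - _ = - (d / 2)) ?normrN ?gtr0_norm; lra.
exists (inf I, sup I); split=> /=.
  by right; have /andP[h1 h2] := inside x Ix; exact: lt_trans h2.
apply/seteqP; split=> y; first by move=> /inside; rewrite /= in_itv.
rewrite /= in_itv/= => /andP[iy ys].
have [u Iu uy] := inf_lt (proj1 hi) iy.
have [v Iv yv] := sup_gt (proj1 hs) ys.
by apply: (iI _ _ Iu Iv); rewrite !ltW.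
Qed.

(** A null set lies in an open set of measure below d, whose components are disjoint intervals.
    Absolute continuity bounds the Stieltjes mass of any finitely many of them by e, hence that of
    all. *)
Let nu'_dominated : nu' `<< mu.
Proof.
move=> N nullN A mA AN; have A0 : mu A = 0 by exact: nullN.
apply/eqP; rewrite eq_le measure_ge0 andbT; apply/lee_addgt0Pr => e e0; rewrite add0e.
have [d d0 Hd] := acG e0.
have [|U [oU AU UA]] := @lebesgue_regularity_outer R A d mA _ d0; first by rewrite [X in (X < _)%E]A0 ltry.
have mU : measurable U by exact: open_measurable.
have muU : (mu U < d%:E)%E.
  rewrite -(setDUK AU) measureU//; [|exact: measurableD|by apply/seteqP; split => // x [? []]].
  by rewrite [X in (X + _)%E]A0 add0e.
(* The window is larger than ]a, b], so that it is open and still contains the part of the null set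
   that nu' sees. *)
pose U' := U `&` `]a - 1, b + 1[%classic.
have oU' : open U' by apply: openI => //; exact: interval_open.
pose I := open_disjoint_itv oU'.
have IU' : U' = \bigcup_q I q := @open_disjoint_itv_bigcup R U' oU'.
have trI : trivIset setT I := @open_disjoint_itv_trivIset R U' oU'.
have oI n : open (I n) := @open_disjoint_itv_open R U' oU' n.
have mI n : measurable (I n) by exact: open_measurable.
have /choice[J HJ0] n : exists p : R * R, (p = (a, a) \/ p.1 < p.2) /\ I n = `]p.1, p.2[%classic.
  apply: open_interval_bounds; [exact: oI|exact: (@open_disjoint_itv_is_interval R U' oU' n)|].
  by move=> x Inx; have [] : U' x by rewrite IU'; exists n.
have HJ n : (J n).1 <= (J n).2 /\ I n = `](J n).1, (J n).2[%classic.
  by have [[->|/ltW] ->] := HJ0 n.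
have mU' : measurable (U' : set (measurableTypeR R)) by exact: open_measurable.
apply: (@le_trans _ _ (nu U')).
  rewrite /nu' /mfrestr /mrestr; apply: le_measure; rewrite ?inE//; first exact: measurableI.
  move=> x [/AU Ux]; rewrite /= in_itv/= => /andP[ax xb]; split=> //.
  by rewrite /= in_itv/=; apply/andP; split; lra.
have nuE : (nu U' = \sum_(k <oo | k \in [set: nat]) nu (I k))%E.
  by rewrite [in LHS]IU'; apply: measure_bigcup; [move=> k _; exact: mI|exact: trI].
rewrite nuE; apply: lime_le; first by apply: is_cvg_nneseries => n _ _; exact: measure_ge0.
apply: nearW => n.
pose l := [seq (cl (J k).1, cl (J k).2) | k <- iota 0 n].
have goodl : subintervals a b l.
  rewrite /subintervals; apply/andP; split.
    apply/allP => p /mapP[k _ ->] /=; have [h _] := HJ k.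
    by rewrite cl_ge cl_le andbT /=; case: (cl_mono h).
  rewrite pairwise_map; apply: (@sub_in_pairwise _ predT (fun i j => i != j)); last 2 first.
  - by apply/allP.
  - by rewrite -uniq_pairwise iota_uniq.
  move=> i j _ _ /= ij; rewrite /nonoverlapping /=.
  have [hi Ei] := HJ i; have [hj Ej] := HJ j.
  have [h|h] := leP (J i).2 (J j).1; first by case: (cl_mono h) => ->.
  have [h'|h'] := leP (J j).2 (J i).1; first by case: (cl_mono h') => ->; rewrite orbT.
  have [[E|n1] _] := HJ0 i; first by rewrite E /= [cl a]cl_id ?cl_ge// ltW.
  have [[E|n2] _] := HJ0 j; first by rewrite E /= [cl a]cl_id ?cl_ge ?orbT// ltW.
  exfalso; apply: (negP ij); apply/eqP; apply: trI => //.
  pose u := Num.max (J i).1 (J j).1; pose v := Num.min (J i).2 (J j).2.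
  have uv : u < v.
    by rewrite /u /v gt_max !lt_min h' h n1 n2.
  exists ((u + v) / 2).
  have m1 : (J i).1 <= u by rewrite /u le_max lexx.
  have m2 : (J j).1 <= u by rewrite /u le_max lexx orbT.
  have m3 : v <= (J i).2 by rewrite /v ge_min lexx.
  have m4 : v <= (J j).2 by rewrite /v ge_min lexx orbT.
  by rewrite Ei Ej; split; rewrite /= in_itv/=; apply/andP; split; lra.
have lenl : \sum_(p <- l) (p.2 - p.1) < d.
  rewrite -lte_fin -sumEFin; apply: le_lt_trans muU.
  apply: (@le_trans _ _ (mu U')); last first.
    by apply: le_measure; rewrite ?inE// => x [].
  have muE : (mu U' = \sum_(k <oo | k \in [set: nat]) mu (I k))%E.
    by rewrite [in LHS]IU'; apply: measure_bigcup; [move=> k _; exact: mI|exact: trI].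
  rewrite muE.
  have : (\sum_(0 <= k < n) mu (I k) <= \sum_(k <oo | k \in [set: nat]) mu (I k))%E.
    rewrite [leRHS](@eq_eseriesl _ _ xpredT); last by move=> k; rewrite in_setT.
    by apply: nneseries_lim_ge => k _ _; exact: measure_ge0.
  apply: le_trans; rewrite big_map big_mkord -[in leLHS](subn0 n) -/(index_iota 0 n) big_mkord.
  apply: lee_sum => k _; have [h E] := HJ k.
  rewrite [X in (_ <= X)%E](_ : _ = (((J k).2 - (J k).1)%:E)%E); last first.
    rewrite E lebesgue_measure_itv /= lte_fin; case: ltP => h'; first by rewrite EFinB.
    have E' : (J k).2 = (J k).1 by lra.
    by rewrite E' subrr.
  by rewrite lee_fin; case: (cl_mono h).
have := Hd l goodl lenl; rewrite -lee_fin => /(le_trans _); apply.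
rewrite -sumEFin big_map -[in leRHS](subn0 n) -/(index_iota 0 n).
rewrite [X in (X <= _)%E](eq_bigl xpredT); last by move=> k; rewrite in_setT.
apply: lee_sum => k _; have [h E] := HJ k.
apply: (@le_trans _ _ (nu `](J k).1, (J k).2]%classic)).
  apply: le_measure; rewrite ?inE//; [exact: mI|rewrite E => x; rewrite /= !in_itv/= => /andP[-> /ltW]//].
by rewrite nu_itv// lee_fin ler_norm.
Qed.

(** The density of nu' given by Radon-Nikodym integrates to the increments of G, and by Lebesgue
    differentiation it is almost everywhere the derivative of its integral. *)
Lemma monotone_ac_ftc : exists f : R -> R,
  [/\ mu.-integrable setT (EFin \o f),
      (\int[mu]_(x in `]a, b]) (f x)%:E = (G b - G a)%:E)%E &
      {ae mu, forall x, a < x < b -> is_derive x (1 : R) G (f x)}].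
Proof.
have [f0 [f0ge f0fin f0int f0E]] := radon_nikodym_sigma_finite nu'_dominated.
pose f := fine \o f0.
have fE : EFin \o f = f0 by apply/funext => x /=; rewrite fineK.
have Gint y : a <= y -> y <= b -> (\int[mu]_(x in `]a, y]) (f x)%:E = (G y - G a)%:E)%E.
  move=> ay yb; rewrite (eq_integral f0); last by move=> x _; rewrite /f /= fineK.
  rewrite -f0E; last exact: measurable_itv.
  transitivity (nu `]a, y]%classic).
    rewrite /nu' /mfrestr /mrestr; congr lebesgue_stieltjes_measure.
    by apply/setIidPl => x; rewrite /= !in_itv/= => /andP[-> /le_trans]; apply.
  by rewrite nu_itv// /Gc !cl_id ?lexx// ltW.
exists f; split; first by rewrite fE.
  by rewrite Gint// ltW.
have intf (A : set R) : measurable A -> mu.-integrable A (EFin \o f).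
  by move=> mA; rewrite fE; exact: integrableS f0int.
have locf : locally_integrable setT f.
  have := @integrable_locally R f setT measurableT (intf setT measurableT).
  by rewrite patch_setT.
have := @FTC1 R f (BRight a) (fun y => intf _ (measurable_itv _)) locf.
apply: filterS; first exact: (ae_filter_ringOfSetsType mu).
move=> x /= H /andP[ax xb].
have [|dF F'] := H; first exact: ax.
have : is_derive x (1 : R) (fun y => (\int[mu]_(t in `]a, y]) f t)%R + G a) (f x).
  rewrite -[X in is_derive _ _ _ X]addr0; apply: is_deriveD.
  by rewrite -F' derive1E; exact: DeriveDef.
apply: near_eq_is_derive; apply/nbhs_ballP; exists (Num.min (x - a) (b - x)).
  by rewrite /= lt_min !subr_gt0 ax.
move=> y; rewrite /ball/= lt_min !ltr_norml => /andP[/andP[? ?] /andP[? ?]].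
by rewrite /Rintegral Gint ?fineK//=; lra.
Qed.

End MonotoneAC.

Lemma ac_realB a b F G : ac_real a b F -> ac_real a b G -> ac_real a b (fun x => F x - G x).
Proof.
move=> aF aG e e0; have e2 : 0 < e / 2 by rewrite divr_gt0.
have [d d0 Hd] := aF _ e2; have [d' d'0 Hd'] := aG _ e2.
exists (Num.min d d'); first by rewrite lt_min d0.
move=> l gl; rewrite lt_min => /andP[/(Hd _ gl) h1 /(Hd' _ gl) h2].
apply: (@le_trans _ _ (\sum_(p <- l) (`|F p.2 - F p.1| + `|G p.2 - G p.1|))).
  apply: ler_sum => p _; rewrite (_ : _ - _ = (F p.2 - F p.1) - (G p.2 - G p.1)); last by ring.
  exact: ler_normB.
by rewrite big_split /=; lra.
Qed.

(** Jordan decomposition: the variation function V and V - F are nondecreasing and absolutely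
    continuous, and F is their difference. *)
Lemma ac_ftc a b F : a < b -> ac_real a b F -> exists f : R -> R,
  [/\ mu.-integrable setT (EFin \o f),
      (\int[mu]_(x in `]a, b]) (f x)%:E = (F b - F a)%:E)%E &
      {ae mu, forall x, a < x < b -> is_derive x (1 : R) F (f x)}].
Proof.
move=> ab aF; pose V := tv_fun a F.
have aV : ac_real a b V := ac_tv_fun aF.
have inc x y : a <= x -> x <= y -> y <= b -> `|F y - F x| <= V y - V x by exact: increment_le_tv.
have [||f [f1 f2 f3]] := @monotone_ac_ftc a b V ab.
- by move=> x y ax xy yb; have := inc x y ax xy yb; have := normr_ge0 (F y - F x); lra.
- exact: aV.
have [||g [g1 g2 g3]] := @monotone_ac_ftc a b (fun x => V x - F x) ab.
- by move=> x y ax xy yb; have := inc x y ax xy yb; have := ler_norm (F y - F x); lra.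
- exact: ac_realB.
have sub (A : set R) : measurable A -> forall h : R -> R, mu.-integrable setT (EFin \o h) -> mu.-integrable A (EFin \o h).
  by move=> mA h; apply: integrableS => //; exact: subsetT.
exists (fun x => f x - g x); split.
- by have := integrableB measurableT f1 g1.
- have mi : measurable (`]a, b]%classic : set R) by exact: measurable_itv.
  have := @integralB_EFin _ _ _ mu _ f g mi (sub _ mi f f1) (sub _ mi g g1).
  under eq_integral do rewrite -EFinB.
  move=> ->; rewrite f2 g2 -EFinB; congr (_%:E); ring.
- have aeF := ae_filter_ringOfSetsType mu.
  move: f3 g3; apply: filterS2 => x h1 h2 axb.
  have := is_deriveB (h1 axb) (h2 axb).
  rewrite (_ : V - _ = F)//; apply/funext => y.
  by rewrite !fctE; ring.
Qed.

End AbsoluteContinuity.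

(** * Derivatives along curves and integrals of lower bounds *)

Section CurveDerivatives.
Context {R : realType}.
Local Notation C := R[i].
Local Notation mu := (@lebesgue_measure R).
Implicit Types (g : R -> C) (a b t : R).

Definition curve_diff g t (d : C) := forall e : R, 0 < e -> exists2 r : R, 0 < r &
  forall y, `|y - t| < r -> cmod (g y - g t - d * (y - t)%:C) <= e * `|y - t|.

Lemma curve_diff_ReIm g t (p q : R) : is_derive t (1 : R) (fun x => complex.Re (g x)) p ->
  is_derive t (1 : R) (fun x => complex.Im (g x)) q -> curve_diff g t (p +i* q).
Proof.
move=> dp dq e e0; have e2 : 0 < e / 2 by rewrite divr_gt0.
have [r1 r10 H1] := is_derive_eps dp e2; have [r2 r20 H2] := is_derive_eps dq e2.
exists (Num.min r1 r2); first by rewrite lt_min r10.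
move=> y; rewrite lt_min => /andP[/H1 h1 /H2 h2].
apply: (le_trans (cmod_le_ReIm _)); rewrite !(ReB, ImB) ReM ImM /= !mulr0 subr0 add0r; lra.
Qed.

Lemma curve_diff_Re g t d : curve_diff g t d ->
  is_derive t (1 : R) (fun x => complex.Re (g x)) (complex.Re d).
Proof.
move=> H; apply: eps_is_derive => e /H[r r0 Hr]; exists r => // y /Hr.
apply: le_trans; apply: le_trans (Re_le_cmod _).
by rewrite !ReB ReM /= mulr0 subr0.
Qed.

Lemma curve_diff_Im g t d : curve_diff g t d ->
  is_derive t (1 : R) (fun x => complex.Im (g x)) (complex.Im d).
Proof.
move=> H; apply: eps_is_derive => e /H[r r0 Hr]; exists r => // y /Hr.
apply: le_trans; apply: le_trans (Im_le_cmod _).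
by rewrite !ImB ImM /= mulr0 add0r.
Qed.

Lemma curve_derive_eq g t d : curve_diff g t d -> curve_derive g t = d.
Proof.
move=> H; apply: complex_ext; rewrite /curve_derive /= derive1E.
  by have dR := curve_diff_Re H; rewrite derive_val.
by have dI := curve_diff_Im H; rewrite derive_val.
Qed.

Lemma curve_diff_cont g t d : curve_diff g t d -> curve_cont g t.
Proof.
move=> H e e0; have [r r0 Hr] := H 1 ltr01.
have k0 : 0 < 1 + cmod d by rewrite ltr_pwDl ?cmod_ge0.
exists (Num.min r (e / (1 + cmod d))); first by rewrite lt_min r0 divr_gt0.
move=> y; rewrite lt_min => /andP[/Hr h1]; rewrite ltr_pdivlMr// => h2.
have -> : g y - g t = (g y - g t - d * (y - t)%:C) + d * (y - t)%:C by ring.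
apply: (le_lt_trans (cmodD _ _)); rewrite normcM cmod_real; lra.
Qed.

Lemma curve_diff_comp (f : C -> C) g t d l : curve_diff g t d -> cdiff f (g t) l ->
  curve_diff (f \o g) t (l * d).
Proof.
move=> Hg Hf e e0; have cg := curve_diff_cont Hg.
pose k := 1 + cmod d; have k0 : 0 < k by rewrite ltr_pwDl ?cmod_ge0.
pose m := cmod l + 1; have m0 : 0 < m by rewrite ltr_wpDl ?cmod_ge0.
have e1 : 0 < e / (2 * k) by rewrite divr_gt0// mulr_gt0.
have e2 : 0 < Num.min 1 (e / (2 * m)) by rewrite lt_min ltr01 divr_gt0// mulr_gt0.
have [r1 r10 H1] := Hf _ e1; have [r2 r20 H2] := cg _ r10; have [r3 r30 H3] := Hg _ e2.
exists (Num.min r2 r3); first by rewrite lt_min r20.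
move=> y; rewrite lt_min => /andP[/H2/H1 h1 /H3 h3] /=.
set x := `|y - t| in h3 *; have x0 : 0 <= x by exact: normr_ge0.
have q1 : Num.min 1 (e / (2 * m)) <= 1 by rewrite ge_min lexx.
have q2 : Num.min 1 (e / (2 * m)) <= e / (2 * m) by rewrite ge_min lexx orbT.
have gy : cmod (g y - g t) <= k * x.
  have -> : g y - g t = (g y - g t - d * (y - t)%:C) + d * (y - t)%:C by ring.
  apply: (le_trans (cmodD _ _)); rewrite normcM cmod_real -/x /k.
  have : Num.min 1 (e / (2 * m)) * x <= 1 * x by rewrite ler_wpM2r.
  by lra.
have -> : f (g y) - f (g t) - l * d * (y - t)%:C =
   (f (g y) - f (g t) - l * (g y - g t)) + l * (g y - g t - d * (y - t)%:C) by ring.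
apply: (le_trans (cmodD _ _)); rewrite normcM.
have b1 : e / (2 * k) * cmod (g y - g t) <= e / 2 * x.
  apply: (@le_trans _ _ (e / (2 * k) * (k * x))); first by rewrite ler_wpM2l// ltW.
  by rewrite le_eqVlt; apply/orP; left; apply/eqP; field; rewrite gt_eqF.
have b2 : cmod l * cmod (g y - g t - d * (y - t)%:C) <= e / 2 * x.
  apply: (@le_trans _ _ (m * (e / (2 * m) * x))).
    apply: ler_pM; rewrite ?cmod_ge0//; first by rewrite /m lerDl.
    by apply: (le_trans h3); rewrite ler_wpM2r.
  by rewrite le_eqVlt; apply/orP; left; apply/eqP; field; rewrite gt_eqF.
by lra.
Qed.

Lemma integral_derivative (H h : R -> R) a b : a <= b ->
  (forall x, a <= x <= b -> is_derive x (1 : R) H (h x)) ->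
  (forall x, a <= x <= b -> {for x, continuous h}) ->
  (\int[mu]_(x in `[a, b]) (h x)%:E = (H b - H a)%:E)%E.
Proof.
rewrite le_eqVlt => /predU1P[<- _ _|ab dH ch].
  by rewrite set_itv1 integral_set1 subrr.
rewrite EFinB; apply: continuous_FTC2 => //.
- by apply: continuous_in_subspaceT => x; rewrite inE/= in_itv => /ch.
- have cH x : a <= x <= b -> H @ x --> H x.
    move=> /dH dHx; apply/differentiable_continuous/derivable1_diffP.
    by case: dHx.
  split.
  + by move=> x; rewrite in_itv/= => /andP[ax xb]; have [] : is_derive x (1 : R) H (h x) by apply: dH; rewrite !ltW.
  + by apply: cvg_at_right_filter; apply: cH; rewrite lexx ltW.
  + by apply: cvg_at_left_filter; apply: cH; rewrite lexx ltW.
- move=> x; rewrite in_itv/= => /andP[ax xb]; rewrite derive1E.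
  have dHx : is_derive x (1 : R) H (h x) by apply: dH; rewrite !ltW.
  by rewrite derive_val.
Qed.

(** Leads from the definition for curves, with indexed disjoint open intervals, to the one for real
    functions, with lists of nonoverlapping pairs. *)
Lemma ac_lipschitz g (F : R -> R) (k : R) a b : absolutely_continuous_on a b g ->
  (forall x y, a <= x <= b -> a <= y <= b -> `|F y - F x| <= k * cmod (g y - g x)) ->
  ac_real a b F.
Proof.
move=> acg lip e e0; have k0 : 0 < `|k| + 1 by rewrite ltr_wpDl.
have [d d0 Hd] := acg (e / (`|k| + 1)) (divr_gt0 e0 k0).
exists d => // l /andP[/allP sub pw] len.
pose p (i : 'I_(size l)) := nth (0, 0) l i.
have pl i : p i \in l by exact: mem_nth.
have pin i : [/\ a <= (p i).1, (p i).1 <= (p i).2 & (p i).2 <= b].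
  by have /and3P[] := sub _ (pl i).
have sumE (f : R * R -> R) : \sum_(q <- l) f q = \sum_(i < size l) f (p i).
  by rewrite (big_nth (0, 0)) big_mkord.
have tr : trivIset [set: 'I_(size l)] (fun i => [set` `](p i).1, (p i).2[]).
  have ne (i j : 'I_(size l)) : (i < j)%N -> [set` `](p i).1, (p i).2[] `&` [set` `](p j).1, (p j).2[] !=set0 -> i = j.
    move=> ij [x [/=]]; rewrite !in_itv/= => /andP[h1 h2] /andP[h3 h4].
    have /(pairwiseP (0, 0))/(_ i j (ltn_ord i) (ltn_ord j) ij) := pw.
    rewrite -/(p i) -/(p j) => /orP[h|h].
      by have := lt_trans h2 (le_lt_trans h h3); rewrite ltxx.
    by have := lt_trans h4 (le_lt_trans h h1); rewrite ltxx.
  move=> i j _ _ h; have [ij|ji|/val_inj//] := ltngtP i j; first exact: ne.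
  by apply/esym/ne; rewrite // setIC.
have := Hd _ (fun i => (p i).1) (fun i => (p i).2) pin tr.
rewrite -(sumE (fun q => q.2 - q.1)) => /(_ len) H.
rewrite sumE; apply: (@le_trans _ _ (\sum_(i < size l) (`|k| + 1) * cmod (g (p i).2 - g (p i).1))).
  apply: ler_sum => i _; have [h1 h2 h3] := pin i.
  apply: (@le_trans _ _ (k * cmod (g (p i).2 - g (p i).1))).
    by apply: lip; apply/andP; split=> //; [exact: le_trans h3|exact: le_trans h2].
  by rewrite ler_wpM2r ?cmod_ge0// (le_trans (ler_norm k))// lerDl.
by rewrite -mulr_sumr mulrC -ler_pdivlMr// ltW.
Qed.

Lemma ac_real_max (F : R -> R) a b : a <= b -> ac_real a b F ->
  exists2 c, a <= c <= b & forall t, a <= t <= b -> F t <= F c.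
Proof.
move=> ab acF.
pose cl x : R := Num.max a (Num.min x b).
have cl_in x : a <= cl x <= b.
  by rewrite /cl le_max lexx ge_max ab ge_min lexx orbT.
have clE x : a <= x <= b -> cl x = x.
  by move=> /andP[ax xb]; rewrite /cl min_l// max_r.
have cll x y : x <= y -> cl x <= cl y /\ cl y - cl x <= y - x.
  move=> xy; rewrite /cl /Num.max /Num.min /Order.max /Order.min.
  have [h1|h1] := ltP x b; have [h2|h2] := ltP y b;
    [have [h3|h3] := ltP a x; have [h4|h4] := ltP a y|have [h3|h3] := ltP a x
     |have [h4|h4] := ltP a y|idtac]; try have [h5|h5] := ltP a b; split; lra.
have cF : continuous (F \o cl).
  move=> x; apply: continuous_eps => e e0; have e2 : 0 < e / 2 by rewrite divr_gt0.
  have [d d0 Hd] := acF _ e2; exists d => // y yx.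
  have key u v : u <= v -> v - u < d -> `|F (cl v) - F (cl u)| < e.
    move=> uv vu; have [h1 h2] := cll _ _ uv.
    have := Hd [:: (cl u, cl v)]; rewrite !big_seq1 /= => h.
    apply: (@le_lt_trans _ _ (e / 2)); last by lra.
    have /andP[a1 _] := cl_in u; have /andP[_ b2] := cl_in v.
    by apply: h; [rewrite /subintervals /= a1 h1 b2|lra].
  have [xy|/ltW yx'] := leP x y; first by apply: key => //; rewrite ger0_norm ?subr_ge0 in yx.
  by rewrite distrC; apply: key => //; rewrite distrC ger0_norm ?subr_ge0 in yx.
have [c cab Hc] := EVT_max ab (continuous_subspaceT cF).
exists (cl c) => // t tab; rewrite -{1}(clE t tab).
by apply: Hc; rewrite in_itv.
Qed.

(* No measurability of [G] is assumed: the integral of a nonnegative function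
   is the supremum of the integrals of the simple functions below it. *)
Lemma lower_integral_ge (f G : R -> R) a b (v : R) :
  mu.-integrable setT (EFin \o f) ->
  (\int[mu]_(x in `]a, b]) (f x)%:E = v%:E)%E ->
  {ae mu, forall x, a < x < b -> f x <= G x} ->
  (forall x, a <= x <= b -> 0 <= G x) ->
  (v%:E <= \int[mu]_(x in `[a, b]) (G x)%:E)%E.
Proof.
move=> intf <- [N [mN N0 sN]] G0.
have mf : measurable_fun setT f.
  by apply/measurable_EFinP; case/integrableP: intf.
pose D : set R := `]a, b[%classic `\` N.
have mD : measurable D by apply: measurableD => //; exact: measurable_itv.
(* The positive part of f is measurable and on D lies below G, so every simple function below h
   restricted to D competes in the supremum for G. *)
pose h x := Num.max (f x) 0.
have mh : measurable_fun setT h by apply: measurable_maxr => //; exact: measurable_cst.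
have h0 x : (0 <= (h x)%:E)%E by rewrite lee_fin /h le_max lexx orbT.
apply: (@le_trans _ _ (\int[mu]_(x in D) (h x)%:E)%E).
  have mfD (A : set R) : measurable_fun A (EFin \o f).
    by apply: measurable_funTS; exact/measurable_EFinP.
  rewrite -integral_itv_bndo_bndc; last exact: mfD.
  have mI : measurable (`]a, b[%classic : set R) by exact: measurable_itv.
  have -> : (\int[mu]_(x in `]a, b[) (f x)%:E = \int[mu]_(x in D) (f x)%:E)%E.
    by apply: (negligible_integral mN mI) => //; exact: integrableS intf.
  apply: le_integral => //.
  - by apply: integrableS intf.
  - have : mu.-integrable D ((EFin \o f)^\+)%E by apply: integrable_funepos => //; exact: integrableS intf.
    apply: eq_integrable => // x _; rewrite /= funeposE /h.
    by rewrite EFin_max.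
  - by move=> x _; rewrite lee_fin /h le_max lexx.
rewrite ge0_integralE// [leRHS]ge0_integralE; last first.
  by move=> x; rewrite /= in_itv/= lee_fin; exact: G0.
apply: le_ereal_sup => _ [s Hs <-]; exists s => // x.
apply: (le_trans (Hs x)); rewrite !patchE.
case: ifPn => xD.
  have [] : D x by rewrite inE in xD.
  rewrite /= in_itv/= => /andP[ax xb] xN.
  rewrite mem_set/=; last by rewrite in_itv/= !ltW.
  rewrite lee_fin /h ge_max; apply/andP; split; last by apply: G0; rewrite !ltW.
  by apply: contrapT => H; apply: xN; apply: sN => /= /(_ (introT andP (conj ax xb))).
case: ifPn => // xab; rewrite lee_fin; apply: G0.
by rewrite inE/= in_itv in xab.
Qed.

End CurveDerivatives.

(** * Hyperbolic distance *)

Section HyperbolicDistance.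
Context {R : realType}.
Local Notation C := R[i].
Local Notation mu := (@lebesgue_measure R).
Implicit Types (g : R -> C) (a b t x y q r : R) (z w tau c : C).

(** This is 2 artanh x, for 0 <= x < 1 the hyperbolic distance from 0 to a point of modulus x. *)
Definition hyp_radius x : R := ln (1 + x) - ln (1 - x).

Lemma hyp_radius0 : hyp_radius 0 = 0.
Proof. by rewrite /hyp_radius addr0 subr0 subrr. Qed.

Lemma is_derive_hyp_radius x : -1 < x < 1 -> is_derive x (1 : R) hyp_radius (2 / (1 - x ^+ 2)).
Proof.
move=> /andP[x1 x2].
have d1 : is_derive x (1 : R) (fun y => ln (1 + y)) ((1 + x)^-1 * (0 + 1)).
  apply: (@is_derive1_comp _ (@ln R) (fun y => 1 + y)).
  by apply: is_derive1_ln; lra.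
have d2 : is_derive x (1 : R) (fun y => ln (1 - y)) ((1 - x)^-1 * (0 - 1)).
  apply: (@is_derive1_comp _ (@ln R) (fun y => 1 - y)).
  by apply: is_derive1_ln; lra.
have := is_deriveB d1 d2; congr (is_derive _ _ _ _).
have h1 : 1 + x != 0 by rewrite gt_eqF//; lra.
have h2 : 1 - x != 0 by rewrite gt_eqF//; lra.
have h3 : 1 - x ^+ 2 != 0 by rewrite (_ : 1 - x ^+ 2 = (1 + x) * (1 - x)) ?mulf_neq0//; ring.
by field; rewrite h1 h2 h3.
Qed.

Lemma hyp_radius_lt x y : 0 <= x -> x < y -> y < 1 -> hyp_radius x < hyp_radius y.
Proof.
move=> x0 xy y1; rewrite /hyp_radius.
have : ln (1 + x) < ln (1 + y) by rewrite ltr_ln ?posrE; lra.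
have : ln (1 - y) < ln (1 - x) by rewrite ltr_ln ?posrE; lra.
by lra.
Qed.

Lemma hyp_radius_gt0 x : 0 < x < 1 -> 0 < hyp_radius x.
Proof. by move=> /andP[x0 x1]; rewrite -hyp_radius0 hyp_radius_lt. Qed.

Lemma sinh_hyp_radius q : 0 <= q < 1 -> sinh (hyp_radius q) = 2 * q / (1 - q ^+ 2).
Proof.
move=> /andP[q0 q1]; rewrite /sinh /hyp_radius opprB !expRD !expRN !lnK ?posrE; try lra.
have h1 : 1 + q != 0 by rewrite gt_eqF//; lra.
have h2 : 1 - q != 0 by rewrite gt_eqF//; lra.
have h3 : 1 - q ^+ 2 != 0 by rewrite (_ : 1 - q ^+ 2 = (1 + q) * (1 - q)) ?mulf_neq0//; ring.
by field; rewrite h1 h2 h3.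
Qed.

Lemma hyp_radius_surj r : 0 < r -> exists2 q, 0 < q < 1 & hyp_radius q = r.
Proof.
move=> r0; have e1 : 1 < expR r by rewrite expR_gt1.
(* The witness is tanh (r / 2). *)
exists ((expR r - 1) / (expR r + 1)).
  have p : 0 < expR r + 1 by lra.
  by apply/andP; split; [rewrite divr_gt0// subr_gt0|rewrite ltr_pdivrMr//; lra].
have n : expR r + 1 != 0 by rewrite gt_eqF//; lra.
have E1 : 1 + (expR r - 1) / (expR r + 1) = 2 * expR r / (expR r + 1) by field.
have E2 : 1 - (expR r - 1) / (expR r + 1) = 2 / (expR r + 1) by field.
have p0 : 0 < expR r + 1 by lra.
rewrite /hyp_radius E1 E2 -ln_div ?posrE ?divr_gt0 ?mulr_gt0 ?expR_gt0//.
rewrite [X in ln X](_ : _ = expR r) ?expRK//; field.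
by rewrite n.
Qed.

Lemma mob_lip tau z w : cmod tau < 1 -> cmod z < 1 -> cmod w < 1 ->
  cmod (mob tau w - mob tau z) <= (1 - cmod tau) ^- 2 * cmod (w - z).
Proof.
move=> t1 z1 w1; rewrite mob_sub// normcM ler_wpM2r ?cmod_ge0//.
have t0 : 0 < 1 - cmod tau by rewrite subr_gt0.
have den v : cmod v < 1 -> 1 - cmod tau <= cmod (1 - conjc tau * v).
  move=> v1; have := cmod_dist 1 (conjc tau * v); rewrite normc1 normcM cmod_conj.
  have : cmod tau * cmod v <= cmod tau by rewrite ler_piMr ?cmod_ge0 ?ltW.
  by lra.
have dp v : cmod v < 1 -> 0 < cmod (1 - conjc tau * v).
  by move=> /den; apply: lt_le_trans.
rewrite normcM normcV normcM cmodN ler_pdivrMr ?mulr_gt0 ?dp//.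
rewrite [leRHS]mulrC ler_pdivlMr ?exprn_gt0//.
apply: (@le_trans _ _ (1 * (1 - cmod tau) ^+ 2)).
  rewrite ler_wpM2r ?sqr_ge0// mulrC mul_conj -[1]/(1%:C) -rmorphB cmod_real.
  by rewrite ger0_norm ?subr_ge0 ?expr_le1 ?cmod_ge0 ?(ltW t1)// lerBlDr lerDl sqr_ge0.
by rewrite mul1r expr2 ler_pM ?(ltW t0)// den.
Qed.

Definition dmob tau z : C := - (1 - conjc tau * tau) / (1 - conjc tau * z) ^+ 2.

(** The infinitesimal form of the invariance of the hyperbolic metric under the Moebius map. *)
Lemma cmod_dmob tau z : cmod tau < 1 -> cmod z < 1 ->
  cmod (dmob tau z) * (1 - cmod z ^+ 2) = 1 - cmod (mob tau z) ^+ 2.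
Proof.
move=> t1 z1; rewrite sub_sqr_cmod_mob// /dmob normcM normcV cmodN cmodX.
rewrite mulrC [conjc tau * tau]mulrC mul_conj -[in LHS](rmorph1 (real_complex R)) -rmorphB cmod_real.
rewrite ger0_norm ?subr_ge0 ?expr_le1 ?cmod_ge0 ?(ltW t1)//; by ring.
Qed.

Lemma hyp_length_ge0 a b g : (forall t, a <= t <= b -> unit_disk (g t)) ->
  (0 <= hyp_length a b g)%E.
Proof.
move=> gD; rewrite /hyp_length mule_ge0//; apply: integral_ge0 => t.
rewrite /= in_itv/= => /gD gt; rewrite lee_fin divr_ge0 ?cmod_ge0//.
by rewrite subr_ge0 expr_le1 ?cmod_ge0// ltW.
Qed.

(* [X t] is the real part of the rotated image of [g t] under the Moebius map
   exchanging tau and 0; hyp_radius o X is the distance to the geodesic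
   orthogonal to the real axis, which grows at most as fast as the hyperbolic
   length. *)
Lemma hyp_length_ge a b g tau c : cmod tau < 1 -> cmod c = 1 -> a <= b ->
  absolutely_continuous_on a b g -> (forall t, a <= t <= b -> unit_disk (g t)) ->
  ((hyp_radius (complex.Re (c * mob tau (g b))) -
    hyp_radius (complex.Re (c * mob tau (g a))))%:E <= hyp_length a b g)%E.
Proof.
move=> t1 c1; rewrite le_eqVlt => /predU1P[<- _ gD|ab acg gD].
  by rewrite subrr hyp_length_ge0.
pose M t := mob tau (g t).
have M1 t : a <= t <= b -> cmod (M t) < 1 by move=> /gD; exact: cmod_mob_lt1.
have lipM x y : a <= x <= b -> a <= y <= b -> cmod (M y - M x) <= (1 - cmod tau) ^- 2 * cmod (g y - g x).
  by move=> /gD hx /gD hy; exact: mob_lip.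
(* The image curve stays in a disc of radius rho < 1, where [hyp_radius] is Lipschitz; this makes
   its composition with X absolutely continuous. *)
have [c0 /M1 rho1 Hrho] : exists2 s, a <= s <= b & forall t, a <= t <= b -> cmod (M t) <= cmod (M s).
  apply: ac_real_max; first exact: ltW.
  apply: (ac_lipschitz acg) => x y hx hy; apply: le_trans (lipM x y hx hy).
  have := cmod_dist (M y) (M x); have := cmod_dist (M x) (M y).
  by rewrite (cmodC (M x)) ler_norml => ? ?; apply/andP; split; lra.
set rho := cmod (M c0) in rho1 Hrho.
have rho0 : 0 <= rho by exact: cmod_ge0.
pose X t := complex.Re (c * M t).
have Xle t : `|X t| <= cmod (M t).
  by apply: (le_trans (Re_le_cmod _)); rewrite normcM c1 mul1r.
have Xrho t : a <= t <= b -> `|X t| <= rho by move=> /Hrho; exact: le_trans.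
have q0 : 0 < 1 - rho ^+ 2 by rewrite subr_gt0 expr_lt1.
have hlip x y : `|x| <= rho -> `|y| <= rho -> `|hyp_radius y - hyp_radius x| <= 2 / (1 - rho ^+ 2) * `|y - x|.
  wlog xy : x y / x <= y.
    by move=> W h1 h2; have [/W->//|/ltW/W] := leP x y; rewrite distrC [`|x - y|]distrC; exact.
  move=> hx hy; have /andP[x1 x2] : - rho <= x <= rho by rewrite -ler_norml.
  have /andP[y1 y2] : - rho <= y <= rho by rewrite -ler_norml.
  have dH s : x <= s <= y -> is_derive s (1 : R) hyp_radius (2 / (1 - s ^+ 2)).
    by move=> /andP[? ?]; apply: is_derive_hyp_radius; apply/andP; split; lra.
  have [s||s] := @MVT_segment R hyp_radius (fun s => 2 / (1 - s ^+ 2)) x y xy.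
  - by rewrite in_itv/= => /andP[? ?]; apply: dH; rewrite !ltW.
  - exact: derive_within_continuous dH.
  rewrite in_itv/= => /andP[s1 s2] ->.
  have hs : s ^+ 2 <= rho ^+ 2.
    by rewrite -[s ^+ 2]real_normK ?num_real// ler_pXn2r ?nnegrE// ler_norml; apply/andP; split; lra.
  have qs : 0 < 1 - s ^+ 2 by lra.
  rewrite normrM ler_wpM2r// ger0_norm ?divr_ge0 ?(ltW qs)// ler_pM2l//.
  by rewrite lef_pV2 ?posrE//; lra.
(* Half of it, because the factor 2 of [hyp_length] stands outside the integral. *)
pose F t := hyp_radius (X t) / 2.
have acF : ac_real a b F.
  apply: (@ac_lipschitz _ g F ((1 - rho ^+ 2)^-1 * (1 - cmod tau) ^- 2)) => // x y hx hy.
  have := hlip (X x) (X y) (Xrho _ hx) (Xrho _ hy).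
  have h1 : `|X y - X x| <= (1 - cmod tau) ^- 2 * cmod (g y - g x).
    apply: le_trans (lipM x y hx hy); rewrite /X -ReB -mulrBr.
    by apply: (le_trans (Re_le_cmod _)); rewrite normcM c1 mul1r.
  have h2 : 0 < (1 - rho ^+ 2)^-1 by rewrite invr_gt0.
  rewrite /F -mulrBl normrM [`|2^-1|]ger0_norm ?invr_ge0// => h3.
  have h4 : (1 - rho ^+ 2)^-1 * `|X y - X x| <= (1 - rho ^+ 2)^-1 * ((1 - cmod tau) ^- 2 * cmod (g y - g x)).
    by rewrite ler_pM2l.
  by lra.
have acRe : ac_real a b (fun t => complex.Re (g t)).
  by apply: (@ac_lipschitz _ g _ 1) => // x y _ _; rewrite -ReB mul1r Re_le_cmod.
have acIm : ac_real a b (fun t => complex.Im (g t)).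
  by apply: (@ac_lipschitz _ g _ 1) => // x y _ _; rewrite -ImB mul1r Im_le_cmod.
have [f [fint fE fae]] := ac_ftc ab acF.
have [p [_ _ pae]] := ac_ftc ab acRe.
have [p' [_ _ p'ae]] := ac_ftc ab acIm.
have key t : a < t < b -> is_derive t (1 : R) F (f t) ->
    is_derive t (1 : R) (fun t => complex.Re (g t)) (p t) ->
    is_derive t (1 : R) (fun t => complex.Im (g t)) (p' t) ->
    f t <= cmod (curve_derive g t) / (1 - cmod (g t) ^+ 2).
  move=> /andP[ta tb] dF dp dp'.
  have tab : a <= t <= b by rewrite !ltW.
  have gt1 : cmod (g t) < 1 by exact: gD.
  have dg := curve_diff_ReIm dp dp'; rewrite (curve_derive_eq dg).
  set d := p t +i* p' t in dg *.
  have dM : curve_diff (fun t => c * M t) t (c * dmob tau (g t) * d).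
    have := curve_diff_comp dg (cdiffM (cdiff_cst c (g t)) (cdiff_mob t1 gt1)).
    by rewrite mul0r add0r.
  have dX := curve_diff_Re dM.
  have Xt : `|X t| < 1 by apply: (le_lt_trans (Xle t)); exact: M1.
  have Xt' : -1 < X t < 1 by rewrite -ltr_norml.
  have dHX := @is_derive1_comp _ _ _ _ _ _ (is_derive_hyp_radius Xt') dX.
  have dF2 : is_derive t (1 : R) F (2^-1 * (2 / (1 - X t ^+ 2) * complex.Re (c * dmob tau (g t) * d))).
    rewrite (_ : F = 2^-1 *: (hyp_radius \o X)); last by apply/funext => s; rewrite /F mulrC.
    exact: is_deriveZ.
  have -> : f t = 2^-1 * (2 / (1 - X t ^+ 2) * complex.Re (c * dmob tau (g t) * d)).
    by case: dF => _ <-; case: dF2 => _ <-.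
  have qX : 0 < 1 - X t ^+ 2.
    by rewrite subr_gt0 -[X t ^+ 2]real_normK ?num_real// expr_lt1.
  have qg : 0 < 1 - cmod (g t) ^+ 2 by rewrite subr_gt0 expr_lt1 ?cmod_ge0.
  have qM : 1 - cmod (M t) ^+ 2 <= 1 - X t ^+ 2.
    rewrite lerB// -[X t ^+ 2]real_normK ?num_real// ler_pXn2r ?nnegrE ?cmod_ge0//; exact: Xle.
  have h1 : complex.Re (c * dmob tau (g t) * d) <= cmod (dmob tau (g t)) * cmod d.
    by apply: (le_trans (ler_norm _)); apply: (le_trans (Re_le_cmod _)); rewrite !normcM c1 mul1r.
  rewrite mulrA [2^-1 * _]mulrA mulVf// mul1r mulrC ler_pdivrMr//.
  apply: (le_trans h1).
  have h2 := cmod_dmob t1 gt1; rewrite -/(M t) in h2.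
  have d0 := cmod_ge0 d.
  rewrite mulrAC ler_pdivlMr//.
  have : cmod d * (1 - cmod (M t) ^+ 2) <= cmod d * (1 - X t ^+ 2) by rewrite ler_wpM2l.
  by rewrite -h2; lra.
have low : ((F b - F a)%:E <= \int[mu]_(t in `[a, b]) (cmod (curve_derive g t) / (1 - cmod (g t) ^+ 2))%:E)%E.
  apply: lower_integral_ge fint fE _ _.
    have aeF := ae_filter_ringOfSetsType mu.
    by move: fae pae p'ae; apply: filterS3 => t h1 h2 h3 tab; apply: key => //; [exact: h1|exact: h2|exact: h3].
  move=> t /gD gt1; rewrite divr_ge0 ?cmod_ge0//.
  by rewrite subr_ge0 expr_le1 ?cmod_ge0// ltW.
rewrite /hyp_length.
have -> : (hyp_radius (complex.Re (c * mob tau (g b))) - hyp_radius (complex.Re (c * mob tau (g a))))%:E = (2%:E * (F b - F a)%:E)%E.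
  by rewrite -EFinM; congr (_%:E); rewrite /F /X /M; field.
by rewrite lee_pmul2l// lte_fin.
Qed.

(** The rotation c is chosen to make the image of the end point other than tau real. Both orders of
    the end points occur: [hyp_disk] measures from the point to the centre, [admissible_radius] the
    other way. The image of tau is 0, so the maximum picks the right term. *)
Lemma hyp_dist_ge z w tau : cmod tau < 1 -> (z = tau \/ w = tau) -> cmod z < 1 -> cmod w < 1 ->
  ((hyp_radius (Num.max (cmod (mob tau z)) (cmod (mob tau w))))%:E <= hyp_dist z w)%E.
Proof.
move=> t1 zw z1 w1; apply: le_ereal_inf_tmp => _ [a [b [g [ab acg gD [ga gb] ->]]]].
have mtt : mob tau tau = 0 by exact: mobaa.
have Re0 : complex.Re (0 : C) = 0 by [].
have Rer (x : R) : complex.Re x%:C = x by [].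
case: zw => E.
  have := hyp_length_ge t1 (cmod_unit_conj (mob tau w)) ab acg gD.
  rewrite ga gb E mtt mulr0 Re0 hyp_radius0 subr0 unit_conjM Rer normc0 max_r ?cmod_ge0//.
have c1 : cmod (- unit_conj (mob tau z)) = 1 by rewrite cmodN cmod_unit_conj.
have := hyp_length_ge t1 c1 ab acg gD.
rewrite ga gb E mtt mulr0 Re0 hyp_radius0 sub0r mulNr unit_conjM ReN Rer normc0 max_l ?cmod_ge0//.
by rewrite /hyp_radius opprB opprK.
Qed.

(** The involution carries the segment from zeta to 0 to a geodesic from z to tau. By invariance the
    integrand is that of the segment, with the primitive - hyp_radius ((1 - t) q) / 2. *)
Lemma hyp_dist_le z tau : cmod tau < 1 -> cmod z < 1 ->
  (hyp_dist z tau <= (hyp_radius (cmod (mob tau z)))%:E)%E.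
Proof.
move=> t1 z1; set zeta := mob tau z; set q := cmod zeta.
have q1 : q < 1 by exact: cmod_mob_lt1.
have q0 : 0 <= q by exact: cmod_ge0.
pose L t : C := (1 - t)%:C * zeta.
pose g t := mob tau (L t).
have Lq t : cmod (L t) = `|1 - t| * q by rewrite normcM cmod_real.
have L1 t : 0 <= t <= 1 -> cmod (L t) < 1.
  move=> /andP[a0 a1]; rewrite Lq ger0_norm ?subr_ge0//.
  by apply: le_lt_trans q1; rewrite ler_piMl// lerBlDr lerDl.
apply: ereal_inf_lbound; exists 0, 1, g; split=> //.
- move=> e e0; pose k := (1 - cmod tau) ^- 2 * q.
  have k0 : 0 <= k by rewrite mulr_ge0// invr_ge0 exprn_ge0// subr_ge0 ltW.
  exists (e / (k + 1)); first by rewrite divr_gt0// ltr_wpDl.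
  move=> n u v uv _ len.
  apply: (@le_lt_trans _ _ (\sum_(i < n) (k + 1) * (v i - u i))).
    apply: ler_sum => i _; have [h1 h2 h3] := uv i.
    apply: (@le_trans _ _ ((1 - cmod tau) ^- 2 * cmod (L (v i) - L (u i)))).
      by apply: mob_lip => //; apply: L1; apply/andP; split=> //; [exact: (le_trans h2)|exact: (le_trans h1)].
    rewrite (_ : L (v i) - L (u i) = (u i - v i)%:C * zeta); last by rewrite /L !rmorphB /=; ring.
    rewrite normcM cmod_real distrC ger0_norm ?subr_ge0// -/q.
    have : 0 <= v i - u i by rewrite subr_ge0.
    by rewrite /k; lra.
  by rewrite -mulr_sumr mulrC -ltr_pdivlMr// ltr_wpDl.
- by move=> t /L1; exact: cmod_mob_lt1.
- split; rewrite /g /L; first by rewrite subr0 rmorph1 mul1r mobK.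
  by rewrite subrr rmorph0 mul0r mob0.
have dg t : 0 <= t <= 1 -> cmod (curve_derive g t) / (1 - cmod (g t) ^+ 2) = q / (1 - ((1 - t) * q) ^+ 2).
  move=> t01; have Lt := L1 t t01.
  have dL : curve_diff L t (- zeta).
    move=> e e0; exists 1 => // y _.
    rewrite (_ : L y - L t - _ = 0); last by rewrite /L !rmorphB /=; ring.
    by rewrite normc0 mulr_ge0// ltW.
  rewrite (curve_derive_eq (curve_diff_comp dL (cdiff_mob t1 Lt))) normcM cmodN -/q -/(dmob tau (L t)).
  have := cmod_dmob t1 Lt; rewrite -/(g t) => <-.
  have Lsq : cmod (L t) ^+ 2 = ((1 - t) * q) ^+ 2 by rewrite Lq !exprMn real_normK ?num_real.
  have n1 : 1 - cmod (L t) ^+ 2 != 0 by rewrite gt_eqF// subr_gt0 expr_lt1 ?cmod_ge0.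
  have n2 : cmod (dmob tau (L t)) != 0.
    rewrite /dmob cmod_eq0 mulf_neq0 ?invr_neq0 ?expf_neq0 ?mob_den_neq0//.
    by rewrite oppr_eq0 mob_den_neq0.
  by rewrite -Lsq; field; rewrite n1 n2.
have bnd t : 0 <= t <= 1 -> -1 < (1 - t) * q < 1.
  move=> /andP[h0 h1]; have : 0 <= (1 - t) * q by rewrite mulr_ge0// subr_ge0.
  have : (1 - t) * q <= q by rewrite ler_piMl// lerBlDr lerDl.
  by move=> ? ?; apply/andP; split; lra.
have den t : 0 <= t <= 1 -> 1 - ((1 - t) * q) ^+ 2 != 0.
  move=> /bnd/andP[h1 h2]; rewrite (_ : _ - _ = (1 + (1 - t) * q) * (1 - (1 - t) * q)); last by ring.
  by rewrite mulf_neq0// gt_eqF//; lra.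
have I : (\int[mu]_(t in `[0%R, 1%R]) (cmod (curve_derive g t) / (1 - cmod (g t) ^+ 2))%:E = (2^-1 * hyp_radius q)%:E)%E.
  transitivity (\int[mu]_(t in `[0%R, 1%R]) (q / (1 - ((1 - t) * q) ^+ 2))%:E)%E.
    by apply: eq_integral => t; rewrite inE/= in_itv/= => t01; rewrite dg.
  have -> : 2^-1 * hyp_radius q = - (2^-1) * hyp_radius ((1 - 1) * q) - - (2^-1) * hyp_radius ((1 - 0) * q).
    by rewrite subrr mul0r subr0 mul1r hyp_radius0; ring.
  apply: (@integral_derivative _ (fun t => - (2^-1) * hyp_radius ((1 - t) * q))
    (fun t => q / (1 - ((1 - t) * q) ^+ 2))) => //.
  - move=> t t01.
    have d1 : is_derive t (1 : R) (fun t : R => (1 - t) * q) (- q).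
      apply: eps_is_derive => e e0; exists 1 => // y _.
      have -> : (1 - y) * q - (1 - t) * q - - q * (y - t) = 0 by ring.
      by rewrite normr0 mulr_ge0// ltW.
    have d2 := @is_derive1_comp _ hyp_radius (fun t : R => (1 - t) * q) t _ _ (is_derive_hyp_radius (bnd t t01)) d1.
    have := is_deriveZ (- 2^-1) d2.
    rewrite (_ : - 2^-1 *: _ = q / (1 - ((1 - t) * q) ^+ 2))//.
    rewrite -[_ *: _]/(- 2^-1 * _); field; exact: den.
  - move=> t t01; have c1 : {for t, continuous (fun t : R => (1 - t) * q)}.
      apply: cvgM; last exact: cvg_cst.
      by apply: cvgB; [exact: cvg_cst|exact: cvg_id].
    apply: cvgM; first exact: cvg_cst.
    apply: cvgV; first exact: den.
    by apply: cvgB; [exact: cvg_cst|rewrite expr2; exact: cvgM].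
by rewrite /hyp_length I -EFinM; congr (_%:E); field.
Qed.

Lemma hyp_diskE tau q : cmod tau < 1 -> 0 < q < 1 ->
  hyp_disk tau (hyp_radius q) = [set w | cmod w < 1 /\ cmod (mob tau w) < q].
Proof.
move=> t1 /andP[q0 q1]; apply/seteqP; split=> w [w1 h]; split=> //.
  rewrite ltNge; apply/negP => qw.
  have := hyp_dist_ge t1 (or_intror (erefl tau)) w1 t1.
  rewrite mobaa normc0 max_l ?cmod_ge0// => /le_lt_trans/(_ h); rewrite lte_fin.
  have := cmod_mob_lt1 t1 w1; move: qw; rewrite le_eqVlt => /predU1P[->|qw] m1; first by rewrite ltxx.
  by rewrite ltNge ltW// hyp_radius_lt// ltW.
apply: (le_lt_trans (hyp_dist_le t1 w1)); rewrite lte_fin.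
by rewrite hyp_radius_lt ?cmod_ge0.
Qed.

End HyperbolicDistance.

(** * Hyperbolic circles *)
Section Bridge.
Context {R : realType}.
Local Notation C := R[i].
Implicit Types (z w : C) (A : set C).

Lemma norm_cmod z : `|z| = (cmod z)%:C.
Proof. by rewrite normc_def; case: z. Qed.

(** Balls in [R[i]] have radii in [R[i]]; positivity there forces the imaginary part to vanish, so
    real radii suffice. *)
Lemma nbhs_cmodP z A : nbhs z A <-> exists2 d : R, 0 < d & forall w, cmod (w - z) < d -> A w.
Proof.
split.
  move=> /nbhs_ballP[e /= e0 He].
  move: e0 He; rewrite ltcE => /andP[/eqP ei er] He.
  exists (complex.Re e) => // w wz; apply: He.
  rewrite /ball/= distrC norm_cmod ltcE /=.
  by rewrite ei eqxx.
move=> [d d0 Hd]; apply/nbhs_ballP; exists d%:C; first by rewrite /= ltcR.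
by move=> w; rewrite /ball /= distrC norm_cmod ltcR => /Hd.
Qed.

Lemma cvg_cmodP (T : Type) (F : set_system T) {FF : Filter F} (f : T -> C) z :
  f @ F --> z <-> forall e : R, 0 < e -> \forall t \near F, cmod (f t - z) < e.
Proof.
split=> [H e e0|H A /nbhs_cmodP[d d0 Hd]].
  have := H [set w | cmod (w - z) < e]; apply.
  by apply/nbhs_cmodP; exists e.
by apply: filterS (H d d0) => t; exact: Hd.
Qed.

Lemma derivable_cdiff (f : C -> C) z : derivable f z 1 <-> exists l, cdiff f z l.
Proof.
split.
  move=> /cvg_ex[l /cvg_cmodP Hl]; exists l => e e0.
  have /nbhs_cmodP[d d0 Hd] := Hl _ e0; exists d => // w wz.
  have [->|ne] := eqVneq w z; first by rewrite !subrr mulr0 subrr normc0 mulr0.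
  have nz : w - z != 0 by rewrite subr_eq0.
  have := Hd (w - z); rewrite subr0 => /(_ wz nz) /=.
  rewrite -[(w - z) *: 1]/((w - z) * 1) mulr1 subrK -[_ *: _]/((w - z)^-1 * _) => /ltW h.
  have -> : f w - f z - l * (w - z) = ((w - z)^-1 * (f w - f z) - l) * (w - z).
    by field.
  by rewrite normcM ler_wpM2r ?cmod_ge0.
move=> [l Hl]; apply/cvg_ex; exists l; apply/cvg_cmodP => e e0.
have e2 : 0 < e / 2 by rewrite divr_gt0.
have [d d0 Hd] := Hl _ e2; apply/nbhs_cmodP; exists d => // h; rewrite subr0 => hd h0 /=.
rewrite -[h *: 1]/(h * 1) mulr1 -[_ *: _]/(h^-1 * _).
have := Hd (h + z); rewrite addrK => /(_ hd) k.
have hp : 0 < cmod h by rewrite cmod_gt0.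
rewrite (_ : h^-1 * _ - l = (f (h + z) - f z - l * h) / h); last by field.
rewrite normcM normcV ltr_pdivrMr// (le_lt_trans k)// ltr_pM2r//; lra.
Qed.

Lemma continuous_cmod : continuous (fun z : C => cmod z).
Proof.
move=> z; apply/(@cvgrPdist_lt _ _ _ (nbhs z) (nbhs_filter z)) => e e0.
apply/nbhs_cmodP; exists e => // w h.
rewrite ltr_norml; have := cmod_dist w z; have := cmod_dist z w; rewrite (cmodC z).
by move=> ? ?; apply/andP; split; lra.
Qed.

Lemma compact_in_disk (K : set C) : compact K -> K `<=` unit_disk ->
  exists2 rho : R, 0 <= rho < 1 & forall z, K z -> cmod z <= rho.
Proof.
move=> cK KD; have [->|/set0P K0] := eqVneq K set0; first by exists 0; rewrite ?lexx ?ltr01.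
have cf : {within K, continuous (fun z : C => cmod z)} by apply: continuous_subspaceT; exact: continuous_cmod.
have [c cK' Hc] := compact_EVT_max K0 cK cf.
exists (cmod c); first by rewrite cmod_ge0; apply: KD; rewrite inE in cK'.
by move=> z Kz; apply: Hc; rewrite inE.
Qed.

Lemma uniform_cmodP (T : Type) (F : set_system T) {FF : Filter F} (f : T -> C -> C) (h : C -> C) (K : set C) :
  {uniform K, f @ F --> h} <->
  forall e : R, 0 < e -> \forall t \near F, forall z, K z -> cmod (f t z - h z) < e.
Proof.
split=> [H e e0|H P /uniform_nbhs[E [entE sub]]].
  have := H [set g | forall z, K z -> cmod (g z - h z) < e]; apply.
  apply/uniform_nbhs; exists [set p : C * C | ball p.1 e%:C p.2]; split.
    by rewrite -entourage_ballE; exists e%:C => //=; rewrite ltcR.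
  move=> g Hg z Kz; have := Hg z Kz.
  by rewrite /ball/= distrC norm_cmod ltcR.
move: entE; rewrite -entourage_ballE => -[e /= e0 He].
move: e0; rewrite ltcE => /andP[/eqP ei er].
have := H _ er; apply: filterS => t Ht; apply: sub => z Kz; apply: He => /=.
by rewrite /ball/= distrC norm_cmod ltcE /= ei eqxx; exact: Ht.
Qed.
End Bridge.

Lemma is_derive_continuous {R : realType} (f : R -> R) (x l : R) :
  is_derive x (1 : R) f l -> {for x, continuous f}.
Proof. by move=> [df _]; exact/differentiable_continuous/derivable1_diffP. Qed.

(** * Hyperbolic circles as Euclidean circles, and their arcs *)

Section HyperbolicCircles.
Context {R : realType}.
Local Notation C := R[i].
Local Notation mu := (@lebesgue_measure R).
Variables (tau : C) (q : R).
Hypotheses (tau1 : cmod tau < 1) (q01 : 0 < q < 1).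
Implicit Types (x y e th al be : R) (w z : C).

Let q0 : 0 < q. Proof. by case/andP: q01. Qed.
Let q1 : q < 1. Proof. by case/andP: q01. Qed.
Let s := cmod tau.
Let s0 : 0 <= s. Proof. exact: cmod_ge0. Qed.
Let qs1 : q * s < 1. Proof. by rewrite mulr_ilt1// ltW. Qed.
Let D := 1 - q ^+ 2 * s ^+ 2.
Let D0 : 0 < D.
Proof. by rewrite /D -exprMn subr_gt0 expr_lt1// mulr_ge0// ltW. Qed.

(** Centre and radius come from completing the square in |tau - w|^2 = q^2 |1 - conj tau w|^2;
    [mob_circ] is the resulting identity. *)
Definition circ_center : C := ((1 - q ^+ 2) / (1 - q ^+ 2 * cmod tau ^+ 2))%:C * tau.
Definition circ_radius : R := q * (1 - cmod tau ^+ 2) / (1 - q ^+ 2 * cmod tau ^+ 2).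

Lemma circ_radius_gt0 : 0 < circ_radius.
Proof. by rewrite divr_gt0// mulr_gt0// subr_gt0 expr_lt1. Qed.

Let circ_lt1 w : cmod (w - circ_center) <= circ_radius -> cmod w < 1.
Proof.
move=> h; have : cmod w <= cmod circ_center + circ_radius.
  by have := cmod_dist w circ_center; lra.
rewrite /circ_center normcM cmod_real -/s -/D => h2; apply: (le_lt_trans h2).
have q2 : 0 <= 1 - q ^+ 2 by rewrite subr_ge0 expr_le1// ltW.
rewrite ger0_norm ?divr_ge0 ?(ltW D0)//.
rewrite /circ_radius -/s -/D mulrAC -mulrDl ltr_pdivrMr// mul1r /D.
(* The product (1 - q) (1 - s) (1 - q s) is exactly the difference of the two sides of the goal. *)
have h3 : 0 < (1 - q) * (1 - s) by rewrite mulr_gt0// subr_gt0.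
have h4 : 0 < 1 - q * s by rewrite subr_gt0.
have : 0 < (1 - q) * (1 - s) * (1 - q * s) by rewrite mulr_gt0.
by lra.
Qed.

Let mob_circ w : cmod w < 1 ->
  (cmod (mob tau w) ^+ 2 - q ^+ 2) * cmod (1 - conjc tau * w) ^+ 2 =
  D * (cmod (w - circ_center) ^+ 2 - circ_radius ^+ 2).
Proof.
move=> w1; have d0 : cmod (1 - conjc tau * w) != 0 by rewrite cmod_eq0 mob_den_neq0.
rewrite mulrBl /mob normcM normcV expr_div_n divfK ?expf_neq0//.
have Dn : D != 0 by rewrite gt_eqF.
move: Dn; rewrite /circ_radius /circ_center /D /s !sqr_cmod.
move: tau w {w1 d0} => [t1 t2] [w1 w2] /=.
set a := t1 ^+ 2 + t2 ^+ 2 => Dn.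
rewrite !mul0r !subr0 addr0.
have aE : a = t1 ^+ 2 + t2 ^+ 2 by [].
have t2E : t2 ^+ 2 = a - t1 ^+ 2 by rewrite aE; ring.
clearbody a; field: t2E; exact: Dn.
Qed.

Lemma hyp_disk_disc : hyp_disk tau (hyp_radius q) = [set w | cmod (w - circ_center) < circ_radius].
Proof.
rewrite hyp_diskE//; apply/seteqP; split=> w /=.
  move=> [w1 h]; rewrite -(@ltr_pXn2r _ 2) ?nnegrE ?cmod_ge0 ?(ltW circ_radius_gt0)//.
  rewrite -subr_lt0 -(pmulr_rlt0 _ D0) -mob_circ//.
  rewrite pmulr_llt0 ?exprn_gt0 ?cmod_gt0 ?mob_den_neq0//.
  by rewrite subr_lt0 ltr_pXn2r ?nnegrE ?cmod_ge0 ?(ltW q0).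
move=> h; have w1 := circ_lt1 (ltW h); split=> //.
rewrite -(@ltr_pXn2r _ 2) ?nnegrE ?cmod_ge0 ?(ltW q0)// -subr_lt0.
have d2 : 0 < cmod (1 - conjc tau * w) ^+ 2 by rewrite exprn_gt0 ?cmod_gt0 ?mob_den_neq0.
rewrite -(pmulr_llt0 _ d2) mob_circ// pmulr_rlt0// subr_lt0.
by rewrite ltr_pXn2r ?nnegrE ?cmod_ge0 ?(ltW circ_radius_gt0).
Qed.

Lemma circleE : circle circ_center circ_radius = [set w | cmod w < 1 /\ cmod (mob tau w) = q].
Proof.
apply/seteqP; split=> w /=.
  move=> h; have w1 : cmod w < 1 by apply: circ_lt1; rewrite h.
  split=> //; have := mob_circ w1; rewrite h subrr mulr0 => /eqP.
  rewrite mulf_eq0 [X in _ || X]expf_eq0 cmod_eq0 (negPf (mob_den_neq0 tau1 w1)) andbF orbF.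
  rewrite subr_eq0 eqrXn2 ?cmod_ge0 ?(ltW q0)//.
  by move/eqP.
move=> [w1 h]; have := mob_circ w1; rewrite h subrr mul0r => /esym/eqP.
rewrite mulf_eq0 gt_eqF//= subr_eq0 eqrXn2 ?cmod_ge0 ?(ltW circ_radius_gt0)//.
by move/eqP.
Qed.

Lemma frontier_disc p (r : R) : 0 < r -> frontier [set w | cmod (w - p) < r] = circle p r.
Proof.
move=> r0; apply/seteqP; split=> z.
  move=> [zc zi]; apply/eqP; rewrite eq_le; apply/andP; split.
    rewrite leNgt; apply/negP => h.
    have [w [/= w1 w2]] : [set w | cmod (w - p) < r] `&` [set w | cmod (w - z) < cmod (z - p) - r] !=set0.
      by apply: zc; apply/nbhs_cmodP; exists (cmod (z - p) - r); rewrite ?subr_gt0.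
    have := cmodD (w - p) (z - w); rewrite (cmodC z) addrC subrKA; lra.
  rewrite leNgt; apply/negP => h; apply: zi; apply/nbhs_cmodP.
  exists (r - cmod (z - p)); first by rewrite subr_gt0.
  by move=> w hw; have := cmodD (w - z) (z - p); rewrite subrKA /=; lra.
move=> /= h; split; last by move=> /interior_subset /=; rewrite h ltxx.
move=> B /nbhs_cmodP[d d0 Hd].
pose t := Num.min (1 / 2) (d / (2 * r)).
have t0 : 0 < t by rewrite lt_min !divr_gt0// mulr_gt0.
have t1 : t <= 1 / 2 by rewrite /t ge_min lexx.
have t2 : t * r <= d / 2.
  have : t <= d / (2 * r) by rewrite /t ge_min lexx orbT.
  rewrite -(ler_pM2r r0) => /le_trans; apply.
  by rewrite le_eqVlt; apply/orP; left; apply/eqP; field; rewrite gt_eqF.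
exists (z + t%:C * (p - z)); split=> /=.
  rewrite (_ : _ - p = (1 - t)%:C * (z - p)); last by rewrite rmorphB /=; ring.
  rewrite normcM cmod_real h ger0_norm; last by lra.
  by have : 0 < t * r; [rewrite mulr_gt0|lra].
apply: Hd; rewrite addrAC subrr add0r normcM cmod_real cmodC h ger0_norm ?(ltW t0)//; lra.
Qed.

Lemma frontier_hyp_disk : frontier (hyp_disk tau (hyp_radius q)) = circle circ_center circ_radius.
Proof. by rewrite hyp_disk_disc frontier_disc//; exact: circ_radius_gt0. Qed.

(* The Moebius image of the Euclidean circle is the circle of radius q around 0;
   [circ_angle] is a continuous choice of the argument along it. *)
Let B : C := q%:C * conjc tau.
Let E y : C := 1 - B * cis y.
Let b1 := complex.Re B.
Let b2 := complex.Im B.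

Let cmodB_q : cmod B = q * s.
Proof. by rewrite normcM cmod_conj cmod_real gtr0_norm. Qed.

Let ReE y : complex.Re (E y) = 1 - (b1 * cos y - b2 * sin y).
Proof. by rewrite /E ReB ReM. Qed.

Let ImE y : complex.Im (E y) = - (b1 * sin y + b2 * cos y).
Proof. by rewrite /E ImB ImM /= sub0r. Qed.

Let ReE_gt0 y : 0 < complex.Re (E y).
Proof.
rewrite /E ReB /=; have : `|complex.Re (B * cis y)| <= q * s.
  by apply: (le_trans (Re_le_cmod _)); rewrite normcM cmod_cis mulr1 cmodB_q.
by rewrite ler_norml subr_gt0 => /andP[_]; move/le_lt_trans; apply.
Qed.

Definition circ_angle y : R :=
  y + pi - 2 * atan (complex.Im (1 - q%:C * conjc tau * cis y) / complex.Re (1 - q%:C * conjc tau * cis y)).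

Let circ_point y := circ_center + circ_radius%:C * cis y.

Let circ_pathE y : circle_path circ_center circ_radius y = circ_point y.
Proof.
rewrite /circle_path /circ_point; congr (_ + _).
by apply: complex_ext; rewrite /=; ring.
Qed.

Let circ_point_in y : circle circ_center circ_radius (circ_point y).
Proof.
rewrite /circle /circ_point /= addrAC subrr add0r normcM cmod_cis mulr1 cmod_real.
by rewrite gtr0_norm// circ_radius_gt0.
Qed.

Let circ_point_lt1 y : cmod (circ_point y) < 1.
Proof. by have := circ_point_in y; rewrite circleE => -[]. Qed.

Let En0 y : E y != 0.
Proof. by apply: contraTneq (ReE_gt0 y) => ->; rewrite ltxx. Qed.

Let cisV y : cis y * conjc (cis y) = 1.
Proof. by rewrite mul_conj cmod_cis expr1n. Qed.

Let centerC : circ_center = (1 - q%:C ^+ 2) / (1 - q%:C ^+ 2 * (tau * conjc tau)) * tau.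
Proof. by rewrite mul_conj /circ_center !(rmorphM, fmorphV, rmorphB, rmorphXn, rmorph1). Qed.

Let radiusC : circ_radius%:C =
  q%:C * (1 - tau * conjc tau) / (1 - q%:C ^+ 2 * (tau * conjc tau)).
Proof. by rewrite mul_conj /circ_radius !(rmorphM, fmorphV, rmorphB, rmorphXn, rmorph1). Qed.

Let qCn0 : q%:C != 0 :> C.
Proof. by rewrite -cmod_gt0 cmod_real normr_gt0 gt_eqF. Qed.

Let denCn0 : 1 - q%:C ^+ 2 * (tau * conjc tau) != 0 :> C.
Proof.
rewrite mul_conj (_ : _ - _ = D%:C).
  by rewrite -cmod_gt0 cmod_real normr_gt0 gt_eqF.
by rewrite !(rmorphM, rmorphB, rmorphXn, rmorph1).
Qed.

Let den_point y : 1 - conjc tau * circ_point y = (circ_radius / q)%:C * E y.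
Proof.
have -> : (circ_radius / q)%:C = circ_radius%:C / q%:C by rewrite rmorphM fmorphV.
rewrite /circ_point centerC radiusC /E /B.
by field; rewrite qCn0 denCn0.
Qed.

Let num_point y : tau - circ_point y = - (circ_radius%:C * (cis y * conjc (E y))).
Proof.
have -> : cis y * conjc (E y) = cis y - q%:C * tau.
  rewrite /E rmorphB rmorph1 rmorphM /= /B conj_scale conjcK mulrBr mulr1 mulrCA cisV.
  by rewrite mulr1.
rewrite /circ_point centerC radiusC.
by field; exact: denCn0.
Qed.

(** By [num_point] and [den_point] the image is - q e^(i y) conj E / E. With psi the argument of E,
    conj E / E = e^(- 2 i psi), and since Re E > 0 the arctangent is a continuous choice of psi. *)
Let mob_point y : mob tau (circ_point y) = q%:C * cis (circ_angle y).
Proof.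
rewrite {1}/mob num_point den_point.
have rn : circ_radius%:C != 0 :> C.
  by rewrite -cmod_gt0 cmod_real normr_gt0 gt_eqF ?circ_radius_gt0.
pose psi := atan (complex.Im (E y) / complex.Re (E y)).
have cp : 0 < cos psi by apply: cos_gt0_pihalf; rewrite atan_gtNpi2 atan_ltpi2.
have Ecis : E y = (complex.Re (E y) / cos psi)%:C * cis psi.
  have tp : tan psi = complex.Im (E y) / complex.Re (E y) by rewrite atanK.
  have cn : cos psi != 0 by rewrite gt_eqF.
  have rn' : complex.Re (E y) != 0 by rewrite gt_eqF.
  have sp : sin psi = complex.Im (E y) / complex.Re (E y) * cos psi.
    by rewrite -tp /tan divfK.
  apply: complex_ext; rewrite [RHS]/= !(mul0r, subr0, addr0); first by field.
  by rewrite sp; field; rewrite cn rn'.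
have kn : (complex.Re (E y) / cos psi)%:C != 0 :> C.
  by rewrite -cmod_gt0 cmod_real normr_gt0 gt_eqF// divr_gt0.
have -> : circ_angle y = y + pi + (- psi - psi) by rewrite /circ_angle -/B -/(E y) -/psi; ring.
have cpsi x : cis (- x) = conjc (cis x) by rewrite /cis cosN sinN.
have cpi : cis (pi : R) = -1 by apply: complex_ext; rewrite /cis cospi sinpi /= ?oppr0.
have cn : cis psi != 0 by rewrite -cmod_gt0 cmod_cis.
have cI : conjc (cis psi) = (cis psi)^-1 by apply: (mulfI cn); rewrite cisV divff.
have cE : conjc (E y) = (complex.Re (E y) / cos psi)%:C * (cis psi)^-1.
  by rewrite {1}Ecis conj_scale cI.
have -> : (circ_radius / q)%:C = circ_radius%:C / q%:C by rewrite rmorphM fmorphV.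
rewrite cisD (cisD y pi) (cisD (- psi) (- psi)) cpi cpsi cI.
move: kn Ecis cE; set k := (complex.Re (E y) / cos psi)%:C; clearbody k => kn -> ->.
by field; rewrite rn qCn0 kn cn.
Qed.

(** A Poisson kernel, (1 - |B|^2) / |1 - B e^(i y)|^2: the derivative of [circ_angle], whose
    positivity makes the angle increase. *)
Let K y := (1 - cmod B ^+ 2) / (complex.Re (E y) ^+ 2 + complex.Im (E y) ^+ 2).

Let K_den y : 0 < complex.Re (E y) ^+ 2 + complex.Im (E y) ^+ 2.
Proof. by rewrite ltr_pwDl ?sqr_ge0// exprn_gt0. Qed.

Let K_gt0 y : 0 < K y.
Proof. by rewrite divr_gt0// cmodB_q exprMn. Qed.

Let dRe y : is_derive y (1 : R) (fun t => complex.Re (E t)) (b1 * sin y + b2 * cos y).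
Proof.
rewrite (_ : (fun t => _) = (fun t => 1 - (b1 * cos t - b2 * sin t))); last by apply/funext => t; rewrite ReE.
apply: is_derive_eq.
by rewrite -![_ *: _]/(_ * _); ring.
Qed.

Let dIm y : is_derive y (1 : R) (fun t => complex.Im (E t)) (- (b1 * cos y - b2 * sin y)).
Proof.
rewrite (_ : (fun t => _) = (fun t => - (b1 * sin t + b2 * cos t))); last by apply/funext => t; rewrite ImE.
apply: is_derive_eq.
by rewrite -![_ *: _]/(_ * _); ring.
Qed.

Let dAngle y : is_derive y (1 : R) circ_angle (K y).
Proof.
have Rn : complex.Re (E y) != 0 by rewrite gt_eqF.
have dinv : is_derive y (1 : R) (fun t => (complex.Re (E t))^-1) (- (complex.Re (E y)) ^- 2 *: (b1 * sin y + b2 * cos y)).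
  by apply: is_deriveV => //; exact: dRe.
have dq := is_deriveM (dIm y) dinv.
have da : is_derive (complex.Im (E y) / complex.Re (E y)) (1 : R) atan
    (1 + (complex.Im (E y) / complex.Re (E y)) ^+ 2)^-1 by exact: is_derive1_atan.
have d2 := @is_derive1_comp _ atan (fun t => complex.Im (E t) / complex.Re (E t)) y _ _ da dq.
have d3 := is_deriveB (is_deriveD (is_derive_id y (1 : R)) (is_derive_cst (pi : R) y (1 : R))) (is_deriveZ 2 d2).
have -> : K y = 1 + 0 - 2 *: ((1 + (complex.Im (E y) / complex.Re (E y)) ^+ 2)^-1 *
   (complex.Im (E y) *: (- (complex.Re (E y)) ^- 2 *: (b1 * sin y + b2 * cos y)) +
    (complex.Re (E y))^-1 *: - (b1 * cos y - b2 * sin y))).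
  rewrite -![_ *: _]/(_ * _) /K.
  have beta : cmod B ^+ 2 = (b1 * cos y - b2 * sin y) ^+ 2 + (b1 * sin y + b2 * cos y) ^+ 2.
    rewrite sqr_cmod -/b1 -/b2.
    transitivity ((b1 ^+ 2 + b2 ^+ 2) * (cos y ^+ 2 + sin y ^+ 2)); last by ring.
    by rewrite cos2Dsin2 mulr1.
  have kd := K_den y.
  move: Rn kd; rewrite beta ReE ImE; set P := b1 * cos y - b2 * sin y; set S := b1 * sin y + b2 * cos y.
  move=> Rn kd; have k1 : (1 - P) ^+ 2 + S ^+ 2 != 0 by rewrite gt_eqF// -[S ^+ 2]sqrrN.
  field; rewrite Rn /=.
  by rewrite [X in X != 0](_ : _ = (1 - P) ^+ 2 + S ^+ 2) ?k1//; ring.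
exact: d3.
Qed.

Let K_continuous : continuous K.
Proof.
move=> y; have cR := is_derive_continuous (dRe y); have cI := is_derive_continuous (dIm y).
apply: cvgM; first exact: cvg_cst.
apply: cvgV; first by rewrite gt_eqF.
apply: cvgD.
  by rewrite expr2; exact: (cvgM cR cR).
by rewrite expr2; exact: (cvgM cI cI).
Qed.

Lemma circ_angle_lt x y : x < y -> circ_angle x < circ_angle y.
Proof.
move=> xy; have [c||c _ E'] := @MVT_segment R circ_angle K x y (ltW xy).
- by move=> _; exact: dAngle.
- by apply: (@derive_within_continuous _ circ_angle K) => t _; exact: dAngle.
by rewrite -subr_gt0 E' mulr_gt0// subr_gt0.
Qed.

Lemma circ_angle_period y : circ_angle (y + pi *+ 2) = circ_angle y + pi *+ 2.
Proof.
rewrite /circ_angle; have -> : cis (y + pi *+ 2) = cis y.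
  by rewrite cisD (_ : cis (pi *+ 2) = 1) ?mulr1// /cis cos2pi sin2pi.
by ring.
Qed.

Lemma circ_angle_surj th : exists y, circ_angle y = th.
Proof.
have bd y : y < circ_angle y < y + pi *+ 2.
  rewrite /circ_angle.
  set A := atan _; have h1 : - (pi / 2) < A by exact: atan_gtNpi2.
  have h2 : A < pi / 2 by exact: atan_ltpi2.
  by rewrite mulr2n; apply/andP; split; lra.
have h : th - pi *+ 2 <= th by rewrite lerBlDr lerDl mulrn_wge0// pi_ge0.
have [||y _ Hy] := @IVT R circ_angle (th - pi *+ 2) th th h.
- by apply: (@derive_within_continuous _ circ_angle K) => t _; exact: dAngle.
- rewrite ge_min le_max; have /andP[_ l1] := bd (th - pi *+ 2); rewrite subrK in l1.
  have /andP[l2 _] := bd th.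
  by rewrite (ltW l1)/= (ltW l2) orbT.
by exists y.
Qed.

Definition hyp_arc al be : set C := [set mob tau (q%:C * cis th) | th in `[al, be]].

(** Along the Euclidean parametrisation the length density is a constant times K, the derivative of
    [circ_angle]. The length is therefore proportional to the angle be - al seen from 0 after the
    Moebius map, with the factor sinh of the hyperbolic radius. *)
Lemma hyp_arcP al be : al < be <= al + pi *+ 2 -> exists y1 y2,
  [/\ arc_data (circle circ_center circ_radius) (hyp_arc al be) circ_center circ_radius y1 y2,
      be < al + pi *+ 2 -> y2 - y1 < pi *+ 2 &
      hyp_length y1 y2 (circle_path circ_center circ_radius) =
      (2 * q / (1 - q ^+ 2) * (be - al))%:E].
Proof.
move=> /andP[ab ba].
have [y1 Y1] := circ_angle_surj al; have [y2 Y2] := circ_angle_surj be.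
have mono x y : circ_angle x < circ_angle y -> x < y.
  move=> h; rewrite ltNge; apply/negP; rewrite le_eqVlt => /predU1P[E'|/circ_angle_lt].
    by rewrite E' ltxx in h.
  by move=> /(lt_trans h); rewrite ltxx.
have y12 : y1 < y2 by apply: mono; rewrite Y1 Y2.
have y21 : y2 <= y1 + pi *+ 2.
  rewrite leNgt; apply/negP => /circ_angle_lt; rewrite circ_angle_period Y1 Y2.
  by move=> /lt_le_trans/(_ ba); rewrite ltxx.
have qn1 : 0 < 1 - q ^+ 2 by rewrite subr_gt0 expr_lt1// ltW.
exists y1, y2; split.
- split=> //; first exact: circ_radius_gt0.
    by rewrite subr_gt0 y12/=; lra.
  apply/seteqP; split=> w /=.
    move=> [th]; rewrite /= in_itv/= => /andP[t1 t2] <-.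
    have [y Y] := circ_angle_surj th; exists y.
      rewrite /= in_itv/=; apply/andP; split; rewrite leNgt; apply/negP => /circ_angle_lt; lra.
    by rewrite circ_pathE -Y -mob_point mobK.
  move=> [y]; rewrite /= in_itv/= => /andP[h1 h2] <-.
  exists (circ_angle y).
    rewrite /= in_itv/= -Y1 -Y2; apply/andP; split.
      by move: h1; rewrite le_eqVlt => /predU1P[->//|/circ_angle_lt/ltW].
    by move: h2; rewrite le_eqVlt => /predU1P[->//|/circ_angle_lt/ltW].
  by rewrite circ_pathE -mob_point mobK.
- move=> bs; rewrite ltrBlDl ltNge; apply/negP => h.
  have : y2 = y1 + pi *+ 2 by apply/eqP; rewrite eq_le y21.
  by move=> E'; move: Y2; rewrite E' circ_angle_period Y1; lra.
have Kpath t : cmod (curve_derive (circle_path circ_center circ_radius) t) /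
    (1 - cmod (circle_path circ_center circ_radius t) ^+ 2) = q / (1 - q ^+ 2) * K t.
  have dp : curve_diff (circle_path circ_center circ_radius) t (circ_radius * (- sin t) +i* (circ_radius * cos t)).
    apply: curve_diff_ReIm.
      rewrite (_ : (fun x => _) = (fun x => complex.Re circ_center + circ_radius * cos x)); last by apply/funext => x; rewrite ReD.
      by apply: is_derive_eq; rewrite -![_ *: _]/(_ * _); ring.
    rewrite (_ : (fun x => _) = (fun x => complex.Im circ_center + circ_radius * sin x)); last by apply/funext => x; rewrite ImD.
    by apply: is_derive_eq; rewrite -![_ *: _]/(_ * _); ring.
  rewrite (curve_derive_eq dp) circ_pathE.
  have -> : cmod (circ_radius * (- sin t) +i* (circ_radius * cos t)) = circ_radius.
    rewrite /= [X in Num.sqrt X](_ : _ = circ_radius ^+ 2 * (cos t ^+ 2 + sin t ^+ 2)); last by ring.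
    by rewrite cos2Dsin2 mulr1 sqrtr_sqr gtr0_norm// circ_radius_gt0.
  have mq : cmod (mob tau (circ_point t)) = q by rewrite mob_point normcM cmod_cis mulr1 cmod_real gtr0_norm.
  have := sub_sqr_cmod_mob tau1 (circ_point_lt1 t); rewrite mq den_point normcM cmod_real.
  have rq0 : 0 <= circ_radius / q by apply: divr_ge0; apply: ltW => //; exact: circ_radius_gt0.
  rewrite (ger0_norm rq0) /K -sqr_cmod cmodB_q -/s.
  have px : 0 < 1 - cmod (circ_point t) ^+ 2 by rewrite subr_gt0 expr_lt1 ?cmod_ge0.
  have e0 : 0 < cmod (E t) by rewrite cmod_gt0.
  have ss : 0 < 1 - s ^+ 2 by rewrite subr_gt0 expr_lt1.
  have rE : circ_radius * D = q * (1 - s ^+ 2) by rewrite /circ_radius -/s -/D divfK// gt_eqF.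
  have r0 := circ_radius_gt0.
  set rr := circ_radius in rE r0 *; set X := 1 - cmod _ ^+ 2 in px *; set e' := cmod (E t) in e0 *.
  have DE : 1 - (q * s) ^+ 2 = D by rewrite exprMn.
  rewrite DE => HX.
  have rn : rr != 0 by rewrite gt_eqF.
  have qn : q != 0 by rewrite gt_eqF.
  have en : e' != 0 by rewrite gt_eqF.
  have xn : X != 0 by rewrite gt_eqF.
  have q2n : 1 - q ^+ 2 != 0 by rewrite gt_eqF.
  have sn : 1 - s ^+ 2 != 0 by rewrite gt_eqF.
  have HX2 : (1 - q ^+ 2) * (rr / q * e') ^+ 2 = (1 - s ^+ 2) * X.
    by rewrite HX divfK// expf_neq0// mulf_neq0// mulf_neq0// invr_neq0.
  have XE : X = (1 - q ^+ 2) * (rr / q * e') ^+ 2 / (1 - s ^+ 2) by rewrite HX2 mulrAC divff// mul1r.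
  have dE : D = q * (1 - s ^+ 2) / rr by rewrite -rE mulrAC divff// mul1r.
  rewrite XE dE; field; by rewrite rn qn en q2n sn.
rewrite /hyp_length (_ : (\int[mu]_(t in `[y1, y2]) _)%E = (q / (1 - q ^+ 2) * (be - al))%:E).
  by rewrite -EFinM; congr (_%:E); ring.
transitivity (\int[mu]_(t in `[y1, y2]) (q / (1 - q ^+ 2) * K t)%:E)%E.
  by apply: eq_integral => t _; rewrite Kpath.
have -> : q / (1 - q ^+ 2) * (be - al) = q / (1 - q ^+ 2) * circ_angle y2 - q / (1 - q ^+ 2) * circ_angle y1.
  by rewrite Y1 Y2; ring.
set k := q / (1 - q ^+ 2).
apply: (@integral_derivative _ (fun t => k * circ_angle t) (fun t => k * K t)); first exact: ltW.
- move=> x _; have := dAngle x; set F := circ_angle; set l := K x => dF; exact: is_deriveZ.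
- by move=> x _; have cK := @K_continuous x; apply: cvgM => //; exact: cvg_cst.
Qed.

End HyperbolicCircles.

(** * Limit sets of phases and trajectories *)

Section LimitSet.
Context {R : realType}.
Local Notation C := R[i].
Implicit Types (t x y e : R) (z w p : C).

(** The half-angle formula for the principal argument of a unimodular z other than -1, with the cut
    at -1. *)
Definition arg_cut z : R := 2 * atan (complex.Im z / (1 + complex.Re z)).

(** z + 1 has half the argument of z, because z conj (z + 1) = z + 1 when |z| = 1. *)
Lemma cis_arg_cut z : cmod z = 1 -> 0 < 1 + complex.Re z -> cis (arg_cut z) = z.
Proof.
move=> z1 zr; pose psi := atan (complex.Im z / (1 + complex.Re z)).
have cp : 0 < cos psi by apply: cos_gt0_pihalf; rewrite atan_gtNpi2 atan_ltpi2.
have tp : tan psi = complex.Im z / (1 + complex.Re z) by rewrite atanK.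
have cn : cos psi != 0 by rewrite gt_eqF.
have rn : 1 + complex.Re z != 0 by rewrite gt_eqF.
have sp : sin psi = complex.Im z / (1 + complex.Re z) * cos psi by rewrite -tp /tan divfK.
have E : z + 1 = ((1 + complex.Re z) / cos psi)%:C * cis psi.
  apply: complex_ext; rewrite [RHS]/= !(mul0r, subr0, addr0) ?ReD ?ImD /=; first by field.
  by rewrite sp; field; rewrite cn rn.
have kn : ((1 + complex.Re z) / cos psi)%:C != 0 :> C.
  by rewrite -cmod_gt0 cmod_real normr_gt0 gt_eqF// divr_gt0.
have zz : z * conjc z = 1 by rewrite mul_conj z1 expr1n.
have E2 : z * conjc (z + 1) = z + 1 by rewrite rmorphD rmorph1 mulrDr zz mulr1 addrC.
rewrite E conj_scale in E2; rewrite /arg_cut -/psi mulr_natl mulr2n cisD.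
have cc : cis psi * conjc (cis psi) = 1 by rewrite mul_conj cmod_cis expr1n.
have E3 : z * conjc (cis psi) = cis psi.
  by apply: (mulfI kn); rewrite -E2; ring.
by rewrite -{1}E3 -mulrA [conjc _ * _]mulrC cc mulr1.
Qed.

Lemma arg_cut_bound z : - pi < arg_cut z < pi.
Proof.
rewrite /arg_cut; set A := atan _.
have h1 : - (pi / 2) < A by exact: atan_gtNpi2.
have h2 : A < pi / 2 by exact: atan_ltpi2.
by apply/andP; split; lra.
Qed.

Lemma arg_cut_continuous z : 0 < 1 + complex.Re z -> forall e, 0 < e -> exists2 d : R, 0 < d &
  forall w, cmod (w - z) < d -> `|arg_cut w - arg_cut z| < e.
Proof.
move=> zr e e0; have e2 : 0 < e / 2 by rewrite divr_gt0.
have ca : {for (complex.Im z / (1 + complex.Re z)), continuous (@atan R)}.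
  by apply/differentiable_continuous/derivable1_diffP; case: (is_derive1_atan (complex.Im z / (1 + complex.Re z))).
have [d1 d10 H1] := continuous_epsP ca e2.
pose m := 1 + complex.Re z; pose k := m + `|complex.Im z|.
have k0 : 0 < k by rewrite /k ltr_pwDl.
pose d2 := d1 * m ^+ 2 / (2 * k).
have d20 : 0 < d2 by rewrite divr_gt0 ?mulr_gt0 ?exprn_gt0.
have m0 : 0 < m := zr.
exists (Num.min (m / 2) (d2 / 2)); first by rewrite lt_min; apply/andP; split; apply: divr_gt0.
move=> w; rewrite lt_min => /andP[w1 w2].
have h1 : `|complex.Re w - complex.Re z| <= cmod (w - z) by rewrite -ReB Re_le_cmod.
have h2 : `|complex.Im w - complex.Im z| <= cmod (w - z) by rewrite -ImB Im_le_cmod.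
have wm : m / 2 < 1 + complex.Re w by move: h1; rewrite ler_norml /m => /andP[? ?]; rewrite /m in w1; lra.
rewrite /arg_cut -mulrBr normrM gtr0_norm// mulrC -ltr_pdivlMr//.
apply: H1; rewrite -/m.
have n1 : 1 + complex.Re w != 0 by rewrite gt_eqF//; lra.
have n2 : m != 0 by rewrite gt_eqF.
have -> : complex.Im w / (1 + complex.Re w) - complex.Im z / m =
   ((complex.Im w - complex.Im z) * m - complex.Im z * (complex.Re w - complex.Re z)) / ((1 + complex.Re w) * m).
  by rewrite /m; field; rewrite n1 n2.
have wp : 0 < (1 + complex.Re w) * m by rewrite mulr_gt0//; lra.
rewrite normrM normfV (gtr0_norm wp) ltr_pdivrMr//.
have low : m / 2 * m <= (1 + complex.Re w) * m by apply: ler_wpM2r; [exact: ltW zr|exact: ltW wm].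
apply: (@lt_le_trans _ _ (d1 * (m / 2 * m))); last by apply: ler_wpM2l; [exact: ltW|].
apply: (@le_lt_trans _ _ (cmod (w - z) * k)).
  apply: (le_trans (ler_normB _ _)); rewrite !normrM (gtr0_norm m0) /k [cmod _ * _]mulrDr; apply: lerD.
    by apply: ler_wpM2r; [exact: ltW zr|].
  by rewrite mulrC ler_wpM2r.
have : cmod (w - z) * k < d2 / 2 * k by rewrite ltr_pM2r.
move/lt_le_trans; apply; rewrite /d2.
have -> : d1 * m ^+ 2 / (2 * k) / 2 * k = d1 * (m / 2 * m) / 2 by field; rewrite gt_eqF.
have : 0 < d1 * (m / 2 * m) by rewrite !mulr_gt0// divr_gt0.
by lra.
Qed.

Variable sigma : R -> C.
Hypotheses (sigma1 : forall t, cmod (sigma t) = 1) (sigma_cont : forall t, curve_cont sigma t).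

Definition cluster_phase : set C :=
  [set p | forall e T, 0 < e -> exists2 t, T <= t & cmod (sigma t - p) < e].

Lemma cmod_cluster_phase p : cluster_phase p -> cmod p = 1.
Proof.
move=> cp; apply/eqP; rewrite -subr_eq0 -normr_eq0 eq_le normr_ge0 andbT.
apply/ler_addgt0Pr => e e0; rewrite add0r; have [t _ ht] := cp e 0 e0.
have := cmod_dist (sigma t) p; have := cmod_dist p (sigma t); rewrite (cmodC p) sigma1.
by move=> ? ?; rewrite ler_norml; apply/andP; split; lra.
Qed.

(** If every point of the circle is a cluster point, the arc has length 2 pi. Otherwise sigma
    eventually keeps away from some p and has a continuous argument; by the intermediate value
    theorem the cluster set is the arc between its lower and upper limits, and sigma converges when
    these agree. *)
Lemma phase_limit_set :
  (exists2 p, cmod p = 1 & forall e, 0 < e -> exists T, forall t, T <= t -> cmod (sigma t - p) <= e) \/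
  exists al be, al < be <= al + pi *+ 2 /\ cluster_phase = [set cis th | th in `[al, be]].
Proof.
have pip := pi_gt0 R.
have [full|] := pselect (forall p, cmod p = 1 -> cluster_phase p).
  right; exists (- pi), pi; split; first by rewrite mulr2n; apply/andP; split; lra.
  apply/seteqP; split=> p.
    by move=> /cmod_cluster_phase/cis_surj[th hth ->]; exists th => //; rewrite /= in_itv.
  by move=> [th _ <-]; apply: full; exact: cmod_cis.
move=> /existsNP[p /not_implyP[p1 ncp]].
have [e0 [T0 [e00 far]]] : exists e T, 0 < e /\ forall t, T <= t -> e <= cmod (sigma t - p).
  apply: contrapT => H; apply: ncp => e T e0; apply: contrapT => H2; apply: H.
  exists e, T; split=> // t Tt; rewrite leNgt; apply/negP => h; apply: H2; exists t => //.
(* This rotation sends the avoided point p to -1, the cut of [arg_cut]. *)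
pose r := - conjc p.
have r1 : cmod r = 1 by rewrite cmodN cmod_conj.
pose u t := r * sigma t.
have rp : r * p = -1 by rewrite /r mulNr mulrC mul_conj p1 expr1n.
have rN0 : r != 0 by rewrite -cmod_gt0 r1.
have u1 t : cmod (u t) = 1 by rewrite normcM r1 sigma1 mulr1.
have re_pos w : cmod w = 1 -> e0 <= cmod (w + 1) -> 0 < 1 + complex.Re w.
  move=> w1 wf; have := sqr_cmod (w + 1); rewrite ReD ImD /= addr0.
  have := sqr_cmod w; rewrite w1 expr1n.
  have : 0 < cmod (w + 1) ^+ 2 by rewrite exprn_gt0//; exact: lt_le_trans wf.
  by move=> a1 a2 a3; lra.
have udist t w : cmod (u t - r * w) = cmod (sigma t - w) by rewrite -mulrBr normcM r1 mul1r.
have ufar t : T0 <= t -> e0 <= cmod (u t + 1).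
  by move=> /far; rewrite -(udist t p) rp opprK.
have upos t : T0 <= t -> 0 < 1 + complex.Re (u t) by move=> /ufar; exact: re_pos.
pose th t := arg_cut (u t).
have cth t : T0 <= t -> cis (th t) = u t by move=> /upos; exact: cis_arg_cut.
have th_cont t : T0 <= t -> {for t, continuous th}.
  move=> Tt; apply: continuous_eps => e e_gt0.
  have [d d0 Hd] := arg_cut_continuous (upos t Tt) e_gt0.
  have [d' d'0 Hd'] := sigma_cont t d0; exists d' => // y /Hd' h; apply: Hd.
  by rewrite /u -mulrBr normcM r1 mul1r.
have ivt t1 t2 v : T0 <= t1 -> T0 <= t2 -> th t1 <= v <= th t2 -> exists2 t, Num.min t1 t2 <= t & th t = v.
  move=> T1 T2 /andP[v1 v2].
  have [t12|/ltW t21] := leP t1 t2.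
    have [||c cab cv] := @IVT R th t1 t2 v t12.
    - by apply: continuous_in_subspaceT => x; rewrite inE/= in_itv/= => /andP[h _]; apply: th_cont; exact: le_trans h.
    - by rewrite ge_min v1 le_max v2 orbT.
    by exists c => //; move: cab; rewrite in_itv/= => /andP[].
  have [||c cab cv] := @IVT R th t2 t1 v t21.
  - by apply: continuous_in_subspaceT => x; rewrite inE/= in_itv/= => /andP[h _]; apply: th_cont; exact: le_trans h.
  - by rewrite ge_min v1 orbT le_max v2.
  by exists c => //; move: cab; rewrite in_itv/= => /andP[].
have bd t : - pi <= th t <= pi by have /andP[h1 h2] := arg_cut_bound (u t); rewrite !ltW.
(* The supremum of L is the lower limit of th, the infimum of U its upper limit. *)
pose L := [set x | exists T, forall t, T <= t -> x <= th t].
pose U := [set x | exists T, forall t, T <= t -> th t <= x].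
have LU x y : L x -> U y -> x <= y.
  move=> [T HT] [T' HT']; apply: (@le_trans _ _ (th (Num.max T T'))).
    by apply: HT; rewrite le_max lexx.
  by apply: HT'; rewrite le_max lexx orbT.
have Lpi : L (- pi) by exists 0 => t _; case/andP: (bd t).
have Upi : U pi by exists 0 => t _; case/andP: (bd t).
have hsL : has_sup L by split; [exists (- pi)|exists pi => x Lx; exact: LU].
have hiU : has_inf U by split; [exists pi|exists (- pi) => x Ux; exact: LU].
pose al := sup L; pose be := inf U.
have al_ge : - pi <= al by apply: ub_le_sup; first case: hsL.
have be_le : be <= pi by apply: ge_inf; first case: hiU.
have albe : al <= be.
  apply: lb_le_inf; first by case: hiU.
  by move=> y Uy; apply: ge_sup; [case: hsL|move=> x Lx; exact: LU].
have ev_low e : 0 < e -> exists T, forall t, T <= t -> al - e < th t.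
  move=> e_gt0; have [x [T HT] xe] := sup_adherent e_gt0 hsL.
  by exists T => t /HT; apply: lt_le_trans.
have ev_up e : 0 < e -> exists T, forall t, T <= t -> th t < be + e.
  move=> e_gt0; have [x [T HT] xe] := inf_adherent e_gt0 hiU.
  by exists T => t /HT h; exact: le_lt_trans xe.
have fr_low e T : 0 < e -> exists2 t, T <= t & th t < al + e.
  move=> e_gt0; apply: contrapT => H; have : L (al + e).
    by exists T => t Tt; rewrite leNgt; apply/negP => h; apply: H; exists t.
  by move=> /(ub_le_sup (proj2 hsL)); rewrite -/al; lra.
have fr_up e T : 0 < e -> exists2 t, T <= t & be - e < th t.
  move=> e_gt0; apply: contrapT => H; have : U (be - e).
    by exists T => t Tt; rewrite leNgt; apply/negP => h; apply: H; exists t.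
  by move=> /(ge_inf (proj2 hiU)); rewrite -/be; lra.
have rV : r^-1 = - p.
  by apply: (mulfI rN0); rewrite divff// mulrN rp opprK.
have [t0 _ pE] : exists2 t : R, - pi <= t <= pi & - p = cis t by apply: cis_surj; rewrite cmodN.
have sigmaE t : T0 <= t -> sigma t = - p * cis (th t).
  by move=> Tt; rewrite cth// /u mulrA -rV mulVf// mul1r.
have [E|ne] := eqVneq al be.
  left; exists (- p * cis al); first by rewrite normcM cmodN p1 cmod_cis mulr1.
  move=> e e_gt0; have e2 : 0 < e / 2 by rewrite divr_gt0.
  have [T1 H1] := ev_low _ e2; have [T2 H2] := ev_up _ e2.
  exists (Num.max T0 (Num.max T1 T2)) => t; rewrite !ge_max => /and3P[h0 /H1 h1 /H2 h2].
  rewrite sigmaE// -mulrBr normcM cmodN p1 mul1r.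
  apply: (le_trans (cis_lip _ _)).
  have : `|th t - al| <= e / 2 by rewrite ler_norml; apply/andP; split; lra.
  by lra.
right; exists (t0 + al), (t0 + be).
have ablt : al < be by rewrite lt_neqAle ne.
split; first by rewrite mulr2n; apply/andP; split; lra.
apply/seteqP; split=> w.
  move=> cw; have w1 := cmod_cluster_phase cw.
  pose v := r * w.
  have v1 : cmod v = 1 by rewrite normcM r1 w1 mulr1.
  have vfar : e0 <= cmod (v + 1).
    rewrite leNgt; apply/negP => h; have d0 : 0 < e0 - cmod (v + 1) by rewrite subr_gt0.
    have [t Tt ht] := cw _ T0 d0; have := ufar t Tt.
    rewrite -(udist t w) -/v in ht; have := cmodD (u t - v) (v + 1); rewrite addrA subrK; lra.
  have vpos := re_pos v v1 vfar.
  have frv e T : 0 < e -> exists2 t, T <= t & `|th t - arg_cut v| < e.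
    move=> e_gt0; have [d d0 Hd] := arg_cut_continuous vpos e_gt0.
    have [t Tt ht] := cw _ T d0; exists t => //; apply: Hd.
    by rewrite -(udist t w) in ht.
  exists (t0 + arg_cut v).
    rewrite /= in_itv/= !lerD2l; apply/andP; split; rewrite leNgt; apply/negP => h.
      have d0 : 0 < (al - arg_cut v) / 2 by lra.
      have [T HT] := ev_low _ d0; have [t /HT h1 h2] := frv _ T d0.
      by move: h2; rewrite ltr_norml => /andP[? ?]; lra.
    have d0 : 0 < (arg_cut v - be) / 2 by lra.
    have [T HT] := ev_up _ d0; have [t /HT h1 h2] := frv _ T d0.
    by move: h2; rewrite ltr_norml => /andP[? ?]; lra.
  by rewrite cisD -pE cis_arg_cut// /v mulrA -rV mulVf// mul1r.
move=> [x0]; rewrite /= in_itv/= => /andP[x1 x2] <- e T e_gt0.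
pose x := x0 - t0; pose d := e / 4.
have d0 : 0 < d by rewrite divr_gt0.
pose T' := Num.max T0 T.
have [s1 S1 hs1] := fr_low d T' d0; have [s2 S2 hs2] := fr_up d T' d0.
(* When x is an end of [al, be], th may never take the value x. The value x - d lies below th s2 in
   any case; either it is attained, or th s1 already lies within d of x. *)
have [t Tt ht] : exists2 t, T' <= t & `|th t - x| <= d.
  have [h|h] := leP (x - d) (th s1).
    by exists s1 => //; rewrite ler_norml /x; apply/andP; split; rewrite /x in h *; lra.
  have [h1 g1] : T0 <= s1 /\ T <= s1 by apply/andP; rewrite -ge_max.
  have [h2 g2] : T0 <= s2 /\ T <= s2 by apply/andP; rewrite -ge_max.
  have [|t tm tv] := ivt s1 s2 (x - d) h1 h2.
    by rewrite (ltW h)/= /x; lra.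
  exists t; last by rewrite tv addrAC subrr sub0r normrN gtr0_norm.
  by apply: le_trans tm; rewrite le_min S1.
move: Tt; rewrite ge_max => /andP[Tt0 Tt]; exists t => //.
rewrite sigmaE// pE -cisD; apply: (le_lt_trans (cis_lip _ _)).
have -> : t0 + th t - x0 = th t - x by rewrite /x; ring.
by rewrite /d in ht; lra.
Qed.

End LimitSet.

(** * Conjugation to a family fixing 0 *)

Section Conjugation.
Context {R : realType}.
Local Notation C := R[i].
Local Notation mu := (@lebesgue_measure R).
Implicit Types (s t e rho : R) (z w p : C).

(** Absolute continuity of the integral, applied to k continued by 0 outside [0, T]. *)
Lemma integral_small (k : R -> R) T e : 0 < e -> mu.-integrable `[0, T] (EFin \o k) ->
  (forall x, 0 <= x <= T -> 0 <= k x) -> exists2 d : R, 0 < d &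
  forall s t, 0 <= s -> s <= t -> t <= T -> t - s < d -> (\int[mu]_(x in `[s, t]) (k x)%:E < e%:E)%E.
Proof.
move=> e0 ik k0; pose kT := k \_ `[0, T].
have ikT : mu.-integrable setT (EFin \o kT).
  by rewrite /kT -restrict_EFin; apply/integrable_restrict => //=; rewrite setTI.
have [d [d0 Hd]] := integral_normr_continuous ikT e0.
exists d => // s t s0 st tT std.
have sub x : `[s, t]%classic x -> 0 <= x <= T.
  by rewrite /= in_itv/= => /andP[sx xt]; rewrite (le_trans s0 sx) (le_trans xt tT).
have mst : measurable (`[s, t]%classic : set R) by exact: measurable_itv.
have lt_e : \int[mu]_(x in `[s, t]) `|kT x| < e.
  apply: Hd => //; have := lebesgue_measure_itv `[s, t]; rewrite /= => ->.
  by rewrite lte_fin; case: ifPn => _; rewrite -?EFinD lte_fin.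
have -> : (\int[mu]_(x in `[s, t]) (k x)%:E = \int[mu]_(x in `[s, t]) (`|kT x|)%:E)%E.
  apply: eq_integral => x; rewrite inE => xst; congr EFin.
  rewrite /kT patchE mem_set ?ger0_norm ?k0//; first exact: sub.
  by rewrite /= in_itv/=; exact: sub.
have fin : (\int[mu]_(x in `[s, t]) (`|kT x|)%:E)%E \is a fin_num.
  apply: integrable_fin_num => //.
  have h : mu.-integrable `[s, t] (EFin \o kT) by apply: integrableS ikT.
  exact: integrable_abse h.
by rewrite -(fineK fin) lte_fin.
Qed.

Lemma evolution_small (phi : R -> R -> C -> C) z T e : evolution_family phi -> cmod z < 1 -> 0 < e ->
  exists2 d : R, 0 < d & forall s t, 0 <= s -> s <= t -> t <= T -> t - s < d -> cmod (phi s t z - z) < e.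
Proof.
(* The time bound is raised to at least 1, since the integrable majorant is given only for positive
   times. *)
move=> [_ phi_id _ phi_L1] z1 e0; have T0 : 0 < Num.max T 1 by rewrite lt_max ltr01 orbT.
have [k [ik k0 Hk]] := phi_L1 z _ z1 T0.
have [d d0 Hd] := integral_small e0 ik k0; exists d => // s t s0 st tT std.
have tT' : t <= Num.max T 1 by rewrite le_max tT.
have := Hk s s t s0 (lexx s) st tT'; rewrite (phi_id s s0 z z1) cmodC => h.
by rewrite -lte_fin; exact: le_lt_trans (Hd s t s0 st tT' std).
Qed.

Lemma mob_radius tau rho : cmod tau < 1 -> 0 <= rho < 1 -> exists2 rho' : R, 0 <= rho' < 1 &
  forall z, cmod z <= rho -> cmod (mob tau z) <= rho'.
Proof.
move=> tau1 /andP[rho0 rho1].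
have mz z : cmod z <= rho -> cmod z < 1 by move=> h; exact: le_lt_trans rho1.
have [z0 z0r Hz0] : exists2 z, cmod z <= rho & forall w, cmod w <= rho -> cmod (mob tau w) <= cmod (mob tau z).
  apply: (@disc_max _ (fun z => cmod (mob tau z))) => // z /mz z1 e e0.
  have [d d0 Hd] := ccont_mob tau1 z1 e0; exists d => // w /Hd h.
  apply: le_lt_trans h; rewrite ler_norml cmod_dist andbT lerNl opprB cmodC.
  exact: cmod_dist.
by exists (cmod (mob tau z0)) => //; rewrite cmod_ge0 cmod_mob_lt1// mz.
Qed.

Variables (phi : R -> R -> C -> C) (tau : C).
Hypotheses (phi_evol : evolution_family phi) (tau1 : cmod tau < 1).
Hypothesis phi_fix : forall s t, 0 <= s -> s <= t -> phi s t tau = tau.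

Definition conj_family s t z := mob tau (phi s t (mob tau z)).
Local Notation psi := conj_family.

Let phi_disk s t z : 0 <= s -> s <= t -> cmod z < 1 -> cmod (phi s t z) < 1.
Proof. by case: phi_evol => + _ _ _ s0 st z1 => /(_ s t s0 st)[_]; exact. Qed.

Lemma conj_familyE s t z : 0 <= s -> s <= t -> cmod z < 1 -> phi s t z = mob tau (psi s t (mob tau z)).
Proof. by move=> s0 st z1; rewrite /psi (mobK tau1 z1) mobK// phi_disk. Qed.

Lemma conj_family_diff s t z : 0 <= s -> s <= t -> cmod z < 1 -> exists l, cdiff (psi s t) z l.
Proof.
move=> s0 st z1; case: phi_evol => /(_ s t s0 st)[hol dsk] _ _ _.
have m1 := cmod_mob_lt1 tau1 z1.
have [l dl] := (derivable_cdiff _ _).1 (hol _ m1).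
have := cdiff_comp (cdiff_comp (cdiff_mob tau1 z1) dl) (cdiff_mob tau1 (phi_disk s0 st m1)).
by move=> h; eexists; exact: h.
Qed.

Lemma conj_family_disk s t z : 0 <= s -> s <= t -> cmod z < 1 -> cmod (psi s t z) < 1.
Proof. by move=> s0 st z1; rewrite cmod_mob_lt1// phi_disk// cmod_mob_lt1. Qed.


Lemma conj_family_comp s u t z : 0 <= s -> s <= u -> u <= t -> cmod z < 1 ->
  psi s t z = psi u t (psi s u z).
Proof.
move=> s0 su ut z1; have m1 := cmod_mob_lt1 tau1 z1.
case: phi_evol => _ _ h _; rewrite /psi (h s u t)// mobK//; exact: phi_disk.
Qed.

Lemma conj_family0 s t : 0 <= s -> s <= t -> psi s t 0 = 0.
Proof. by move=> s0 st; rewrite /psi mob0 phi_fix// mobaa. Qed.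

Lemma conj_family_small z T e : cmod z < 1 -> 0 < e -> exists2 d : R, 0 < d &
  forall s t, 0 <= s -> s <= t -> t <= T -> t - s < d -> cmod (psi s t z - z) < e.
Proof.
move=> z1 e0; have m1 := cmod_mob_lt1 tau1 z1.
have [d1 d10 H1] := ccont_mob tau1 m1 e0.
have [d d0 Hd] := evolution_small T phi_evol m1 d10; exists d => // s t s0 st tT std.
by have := H1 _ (Hd s t s0 st tT std); rewrite mobK.
Qed.

End Conjugation.

(** * Closed arcs of circles and hyperbolic radii *)

Section Arcs.
Context {R : realType}.
Local Notation C := R[i].
Implicit Types (s t e rho r q : R) (z w p tau : C).

Lemma cis_neq (x y : R) : 0 < y - x < pi *+ 2 -> cis x <> cis y.
Proof.
rewrite mulr2n => /andP[d0 d1] E; have h : cis (y - x) = 1.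
  have n0 : cis x != 0 by rewrite -cmod_gt0 cmod_cis.
  by apply: (mulfI n0); rewrite -cisD mulr1 E; congr cis; ring.
have c1 : cos (y - x) = 1 by have := congr1 (fun z : C => complex.Re z) h.
have c2 : cos (y - x) = 1 - sin ((y - x) / 2) ^+ 2 *+ 2.
  by have := cosD ((y - x) / 2) ((y - x) / 2); have := cos2Dsin2 ((y - x) / 2);
     rewrite -splitr mulr2n; lra.
have sp : 0 < sin ((y - x) / 2) by apply: sin_gt0_pi; lra.
have : 0 < sin ((y - x) / 2) ^+ 2 by rewrite exprn_gt0.
by move: c2; rewrite c1 mulr2n; lra.
Qed.

Lemma circle_pathE p q (th : R) : circle_path p q th = p + q%:C * cis th.
Proof. by rewrite /circle_path; congr (_ + _); apply: complex_ext; rewrite /= !(mul0r, subr0, addr0). Qed.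

Lemma circle_path_neq p q (x y : R) : 0 < q -> 0 < y - x < pi *+ 2 ->
  circle_path p q x <> circle_path p q y.
Proof.
move=> q0 xy; rewrite !circle_pathE => /addrI E; apply: (cis_neq xy).
by apply: (mulfI _ E); rewrite -cmod_gt0 cmod_real gtr0_norm.
Qed.

Lemma circle_path_full p q : 0 < q -> circle p q = circle_path p q @` `[- pi, - pi + pi *+ 2].
Proof.
move=> q0; apply/seteqP; split=> w.
  move=> /= wE; have [th /andP[h1 h2] E] := polar (w - p); exists th.
    by rewrite /= in_itv/= mulr2n; apply/andP; split; lra.
  by rewrite circle_pathE -wE -E addrC subrK.
by move=> [th _ <-]; rewrite /circle /= circle_pathE addrC addKr normcM cmod_real cmod_cis mulr1 gtr0_norm.
Qed.

Lemma circle_closed_arc p q : 0 < q -> closed_arc_of (circle p q) (circle p q).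
Proof.
move=> q0; exists p, q, (- pi), (- pi + pi *+ 2); split => //; last exact: circle_path_full.
by rewrite addrAC subrr add0r lexx mulrn_wgt0// pi_gt0.
Qed.

Lemma closed_arc_two (S A : set C) : closed_arc_of S A -> exists x y, [/\ A x, A y & x <> y].
Proof.
move=> [p [q [th1 [th2 [q0 _ /andP[d0 d1] ->]]]]].
(* The ends of the arc coincide when it is the whole circle, hence the middle as second point. *)
exists (circle_path p q th1), (circle_path p q ((th1 + th2) / 2)); split.
- by exists th1 => //; rewrite /= in_itv/=; apply/andP; split; lra.
- by exists ((th1 + th2) / 2) => //; rewrite /= in_itv/=; apply/andP; split; lra.
- by apply: circle_path_neq => //; apply/andP; split; [lra|apply: lt_le_trans d1; lra].
Qed.

Lemma proper_arc_neq (S : set C) : ~ proper_closed_arc_of S S.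
Proof.
move=> [p [q [th1 [th2 [[q0 SE /andP[d0 _] AE] d1]]]]].
(* The middle of the complementary arc, between the angles th2 and th1 + 2 pi. *)
pose th := (th1 + th2 + pi *+ 2) / 2.
have : S (circle_path p q th).
  by rewrite SE /circle /= circle_pathE addrC addKr normcM cmod_real cmod_cis mulr1 gtr0_norm.
rewrite AE => -[x]; rewrite /= in_itv/= => /andP[x1 x2] E.
by apply: (@circle_path_neq p q x th) => //; rewrite /th; apply/andP; split; lra.
Qed.

Lemma proper_arc_closed (S A : set C) : proper_closed_arc_of S A -> closed_arc_of S A.
Proof. by move=> [p [q [x [y [h _]]]]]; exists p, q, x, y. Qed.

Lemma admissible_hyp_radius tau z q : cmod tau < 1 -> cmod z < 1 -> 0 < q -> q <= cmod (mob tau z) ->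
  admissible_radius tau z (hyp_radius q).
Proof.
move=> tau1 z1 q0 qz; have m1 := cmod_mob_lt1 tau1 z1; split.
  by apply: hyp_radius_gt0; rewrite q0 (le_lt_trans qz).
apply: (le_trans _ (hyp_dist_ge tau1 (or_introl (erefl tau)) tau1 z1)).
rewrite lee_fin mobaa (_ : cmod 0 = 0) ?(max_idPr (cmod_ge0 _))//; last by apply/eqP; rewrite cmod_eq0.
by move: qz; rewrite le_eqVlt => /predU1P[->//|qz]; apply/ltW/hyp_radius_lt => //; exact: ltW.
Qed.

Lemma frontier_hyp_diskE tau r : cmod tau < 1 -> 0 < r -> exists2 q, 0 < q < 1 &
  frontier (hyp_disk tau r) = circle (circ_center tau q) (circ_radius tau q) /\
  frontier (hyp_disk tau r) = [set w | cmod w < 1 /\ cmod (mob tau w) = q].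
Proof.
move=> tau1 r0; have [q q01 <-] := hyp_radius_surj r0; exists q => //.
by rewrite frontier_hyp_disk// circleE.
Qed.

End Arcs.

(** * Convergence on compact sets and omega-limits *)

Section OmegaLimits.
Context {R : realType}.
Local Notation C := R[i].
Implicit Types (s t e rho r q : R) (z w p tau : C).

Lemma cvg_on_compacts_radius (f : R -> C -> C) (h : C -> C) :
  (forall rho e, 0 <= rho < 1 -> 0 < e -> exists T, forall t z, T <= t -> cmod z <= rho ->
     cmod (f t z - h z) < e) -> cvg_on_compacts (f t @[t --> +oo]) h.
Proof.
move=> H K cK Kd; have [rho rho01 Hrho] := compact_in_disk cK Kd.
apply/uniform_cmodP => e e0; have [T HT] := H rho e rho01 e0.
by exists T; split; [exact: num_real|move=> t /ltW Tt z /Hrho; exact: HT].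
Qed.

Lemma cvg_on_compacts_point (f : R -> C -> C) (h : C -> C) z : cvg_on_compacts (f t @[t --> +oo]) h ->
  cmod z < 1 -> forall e, 0 < e -> exists T, forall t, T <= t -> cmod (f t z - h z) < e.
Proof.
move=> H z1 e e0; have cz : compact [set z] by exact: compact_set1.
have zd : [set z] `<=` unit_disk by move=> _ ->.
have [T [_ HT]] := (uniform_cmodP _ _ _).1 (H _ cz zd) e e0.
by exists (T + 1) => t Tt; apply: HT => //; apply: lt_le_trans Tt; rewrite ltrDl.
Qed.

Lemma cvg_pinfty_eps (u : nat -> R) (T : R) : u n @[n --> \oo] --> +oo ->
  \forall n \near \oo, T <= u n.
Proof. by move=> /cvgryPge; apply. Qed.

Lemma omega_limit_unique (phi : R -> R -> C -> C) s z l : 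
  (forall e, 0 < e -> exists T, forall t, T <= t -> cmod (phi s t z - l) < e) ->
  forall p, omega_limit phi s z p -> p = l.
Proof.
move=> H p [_ [t_ [_ toy /cvg_cmodP pl]]]; apply/eqP; rewrite -subr_eq0 -cmod_eq0.
rewrite eq_le cmod_ge0 andbT; apply/ler_addgt0Pr => e e0; rewrite add0r.
have e2 : 0 < e / 2 by rewrite divr_gt0.
have [T HT] := H _ e2.
have [n [h1 h2]] : exists n, T <= t_ n /\ cmod (phi s (t_ n) z - p) < e / 2.
  have [n _ Hn] := filterI (cvg_pinfty_eps T toy) (pl _ e2).
  by exists n; have [] := Hn n (leqnn n).
have -> : p - l = (phi s (t_ n) z - l) - (phi s (t_ n) z - p) by ring.
by apply: (le_trans (cmodB _ _)); have := HT _ h1; lra.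
Qed.

(** In the conjugated coordinate the trajectory is asymptotic to sigma t times a constant c, so its
    limit points are c times the cluster points of sigma, carried back by the Moebius map. *)
Lemma omega_limit_arc (phi : R -> R -> C -> C) tau s z (sigma : R -> C) q (th0 al be : R) :
  cmod tau < 1 -> 0 < q < 1 -> (forall t, s <= t -> cmod (phi s t z) < 1) ->
  (forall e, 0 < e -> exists T, forall t, T <= t ->
     cmod (mob tau (phi s t z) - sigma t * (q%:C * cis th0)) <= e) ->
  cluster_phase sigma = [set cis th | th in `[al, be]] -> (forall t, cmod (sigma t) = 1) ->
  omega_limit phi s z = hyp_arc tau q (al + th0) (be + th0).
Proof.
move=> tau1 /andP[q0 q1] phi_disk lim clE sigma1.
pose v t := mob tau (phi s t z).
have phiE t : s <= t -> phi s t z = mob tau (v t) by move=> st; rewrite mobK// phi_disk.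
pose c : C := q%:C * cis th0.
have cc : cmod c = q by rewrite normcM cmod_real cmod_cis mulr1 gtr0_norm.
have c0 : c != 0 by rewrite -cmod_gt0 cc.
have rcis (th : R) : c * cis th = q%:C * cis (th + th0) by rewrite /c cisD; ring.
have qcis1 (th : R) : cmod (q%:C * cis th) < 1 by rewrite normcM cmod_real cmod_cis mulr1 gtr0_norm.
apply/seteqP; split=> p.
- move=> [_ [t_ [st toy /cvg_cmodP pl]]].
  (* The Moebius map can be undone only inside the disc. The conjugated trajectory eventually has
     modulus at most (1 + q) / 2, so the trajectory stays in a smaller disc. *)
  have p1 : cmod p < 1.
    have h01 : 0 <= (1 + q) / 2 < 1 by apply/andP; split; lra.
    have [rho' /andP[_ rho'1] Hrho'] := mob_radius tau1 h01.
    have e1 : 0 < (1 - q) / 2 by lra.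
    have e2 : 0 < 1 - rho' by lra.
    have [T HT] := lim _ e1.
    have [n _ Hn] := filterI (cvg_pinfty_eps T toy) (pl _ e2).
    have [/HT h1 h2] := Hn n (leqnn n).
    have h3 : cmod (phi s (t_ n) z) <= rho'.
      rewrite phiE//; apply: Hrho'; rewrite -/(v _) in h1.
      have := cmod_dist (v (t_ n)) (sigma (t_ n) * c).
      by rewrite (normcM (sigma (t_ n))) sigma1 cc mul1r /c; lra.
    by have := cmod_dist p (phi s (t_ n) z); rewrite cmodC; lra.
  have cl : cluster_phase sigma (mob tau p / c).
    move=> e T e0; have e2 : 0 < e * q / 2 by rewrite divr_gt0// mulr_gt0.
    have [T' HT'] := lim _ e2.
    have [d d0 Hd] := ccont_mob tau1 p1 e2.
    have [n _ Hn] := filterI (cvg_pinfty_eps (Num.max T T') toy) (pl _ d0).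
    have [+ /Hd h2] := Hn n (leqnn n); rewrite ge_max => /andP[h0 /HT' h1].
    exists (t_ n) => //; rewrite -(ltr_pM2r q0) -{1}cc -normcM mulrBl divfK//.
    have -> : sigma (t_ n) * c - mob tau p =
      (v (t_ n) - mob tau p) - (v (t_ n) - sigma (t_ n) * c) by ring.
    apply: (le_lt_trans (cmodB _ _)); rewrite -/(v _) -/c in h1 h2; lra.
  move: cl; rewrite clE => -[th]; rewrite /= in_itv/= => /andP[h1 h2] E.
  exists (th + th0); first by rewrite /= in_itv/= !lerD2r h1.
  by rewrite -rcis E mulrC divfK// mobK.
- move=> [th']; rewrite /= in_itv/= => /andP[h1 h2] <-.
  have m1 : cmod (mob tau (q%:C * cis th')) < 1 by exact: cmod_mob_lt1.
  split; first exact: ltW.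
  have cl : cluster_phase sigma (cis (th' - th0)).
    by rewrite clE; exists (th' - th0) => //; rewrite /= in_itv/=; apply/andP; split; lra.
  have ch n : exists t, Num.max s n%:R <= t /\ cmod (sigma t - cis (th' - th0)) < n.+1%:R^-1.
    by have [|t ht1 ht2] := cl n.+1%:R^-1 (Num.max s n%:R); rewrite ?invr_gt0//; exists t.
  have [t_ Ht] := choice ch; exists t_.
  have tn n : n%:R <= t_ n by have [+ _] := Ht n; rewrite ge_max => /andP[].
  have ts n : s <= t_ n by have [+ _] := Ht n; rewrite ge_max => /andP[].
  have toy : t_ n @[n --> \oo] --> +oo.
    apply/cvgryPge => A; near=> n; apply: (le_trans _ (tn n)).
    by near: n; exact: nbhs_infty_ger.
  split => //; apply/cvg_cmodP => e e0.
  have [d d0 Hd] := ccont_mob tau1 (qcis1 th') e0.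
  have d2 : 0 < d / 2 by rewrite divr_gt0.
  have [T HT] := lim _ d2.
  near=> n; rewrite phiE//; apply: Hd.
  have hT : cmod (v (t_ n) - sigma (t_ n) * c) <= d / 2.
    by apply: HT; near: n; exact: cvg_pinfty_eps.
  have hs : cmod (sigma (t_ n) * c - q%:C * cis th') < d / 2.
    have -> : q%:C * cis th' = cis (th' - th0) * c.
      by rewrite [RHS]mulrC rcis; congr (_ * cis _); ring.
    rewrite -mulrBl normcM cc; apply: (@le_lt_trans _ _ (cmod (sigma (t_ n) - cis (th' - th0)))).
      by rewrite ler_piMr ?cmod_ge0// ltW.
    apply: (lt_trans (proj2 (Ht n))); near: n; exact: near_infty_natSinv_lt (PosNum d2).
  have -> : v (t_ n) - q%:C * cis th' =
    (v (t_ n) - sigma (t_ n) * c) + (sigma (t_ n) * c - q%:C * cis th') by ring.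
  by apply: (le_lt_trans (cmodD _ _)); lra.
Unshelve. all: by end_near.
Qed.

End OmegaLimits.

(** * The trichotomy *)

Section Trichotomy.
Context {R : realType}.
Local Notation C := R[i].
Implicit Types (s t e rho r q : R) (z w p : C).
Variables (phi : R -> R -> C -> C) (tau : C).
Hypotheses (phi_evol : evolution_family phi) (tau1 : cmod tau < 1).
Hypothesis phi_fix : forall s t, 0 <= s -> s <= t -> phi s t tau = tau.

Local Notation psi := (conj_family phi tau).
Let psi_diff := conj_family_diff phi_evol tau1.
Let psi_disk := conj_family_disk phi_evol tau1.
Let psi_comp := conj_family_comp phi_evol tau1.
Let psi0 := conj_family0 phi_fix.
Let psi_small := conj_family_small phi_evol tau1.
Let m0 : 0 < (1 - cmod tau) ^- 2.
Proof. by rewrite invr_gt0 exprn_gt0// subr_gt0. Qed.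

Lemma family_to_point : (forall e, 0 < e -> exists2 T, 0 <= T & cmod (lam psi 0 T) < e) ->
  cvg_to_point phi tau.
Proof.
move=> small s s0; apply: cvg_on_compacts_radius => rho e rho01 e0.
have [rho' rho'01 Hrho'] := mob_radius tau1 rho01.
have e1 : 0 < e / (1 - cmod tau) ^- 2 by rewrite divr_gt0.
have [T sT HT] := psi_to0 psi_diff psi_disk psi_comp psi0 psi_small small s0 rho'01 e1.
exists T => t z Tt zrho; have st := le_trans sT Tt.
have z1 : cmod z < 1 by case/andP: rho01 => _; exact: le_lt_trans.
have w1 := cmod_mob_lt1 tau1 z1.
rewrite (conj_familyE phi_evol tau1 s0 st z1) /cst -[in X in _ - X](mob0 tau).
have := mob_lip tau1 (_ : cmod 0 < 1) (psi_disk s0 st w1).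
rewrite (_ : cmod 0 = 0) ?subr0; last by apply/eqP; rewrite cmod_eq0.
move=> /(_ ltr01)/le_lt_trans; apply.
by rewrite mulrC -ltr_pdivlMr//; apply: HT => //; exact: Hrho'.
Qed.

Section NonDegenerate.
Variable ell : R.
Hypotheses (ell0 : 0 < ell) (lam_ge : forall t, 0 <= t -> ell <= cmod (lam psi 0 t)).

Let asymptotics := psi_asymptotics psi_diff psi_disk psi_comp psi0 psi_small ell0 lam_ge.
Let phase1 := cmod_phase psi_diff psi_disk psi_comp psi0 psi_small.

(** When the phase tends to p, psi s t tends to p h, and the limit is its conjugate by the Moebius
    map. *)
Lemma family_to_univalent p : cmod p = 1 ->
  (forall e, 0 < e -> exists T, forall t, T <= t -> cmod (phase psi t - p) <= e) ->
  cvg_to_univalent phi.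
Proof.
move=> p1 lim s s0; have [h [hd hi h00 hle hlim]] := asymptotics s0.
have hp1 z : cmod z < 1 -> cmod (p * h z) < 1.
  by move=> z1; rewrite normcM p1 mul1r; apply: (le_lt_trans _ z1); exact: hle.
have pn0 : p != 0 by rewrite -cmod_gt0 p1.
exists (fun z => mob tau (p * h (mob tau z))).
  split; first split.
  - move=> z z1; apply/derivable_cdiff; have w1 := cmod_mob_lt1 tau1 z1.
    have [l dl] := hd _ w1.
    have d1 := cdiff_comp (cdiff_mob tau1 z1) dl.
    have d2 := cdiff_comp (cdiffM (cdiff_cst p z) d1) (cdiff_mob tau1 (hp1 _ w1)).
    by eexists; exact: d2.
  - by move=> z z1; apply: cmod_mob_lt1 => //; apply: hp1; exact: cmod_mob_lt1.
  - move=> z w z1 w1 E; have mz := cmod_mob_lt1 tau1 z1; have mw := cmod_mob_lt1 tau1 w1.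
    have := congr1 (mob tau) E; rewrite !mobK ?hp1// => /(mulfI pn0)/(hi _ _ mz mw)/(congr1 (mob tau)).
    by rewrite !mobK.
apply: cvg_on_compacts_radius => rho e rho01 e0.
have [rho' rho'01 Hrho'] := mob_radius tau1 rho01.
pose e1 := e / (1 - cmod tau) ^- 2 / 3.
have e10 : 0 < e1 by rewrite !divr_gt0.
have [T sT HT] := hlim _ _ rho'01 e10; have [T' HT'] := lim _ e10.
exists (Num.max T T') => t z; rewrite ge_max => /andP[Tt Tt'] zrho; have st := le_trans sT Tt.
have z1 : cmod z < 1 by case/andP: rho01 => _; exact: le_lt_trans.
have w1 := cmod_mob_lt1 tau1 z1.
rewrite (conj_familyE phi_evol tau1 s0 st z1).
apply: (le_lt_trans (mob_lip tau1 (hp1 _ w1) (psi_disk s0 st w1))).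
rewrite mulrC -ltr_pdivlMr//; set w := mob tau z in w1 *.
have -> : psi s t w - p * h w = (psi s t w - phase psi t * h w) + (phase psi t - p) * h w by ring.
apply: (le_lt_trans (cmodD _ _)).
have a1 : cmod (psi s t w - phase psi t * h w) <= e1 by apply: HT => //; exact: Hrho'.
have a2 : cmod ((phase psi t - p) * h w) <= e1.
  rewrite normcM; apply: (le_trans _ (HT' t Tt')); rewrite ler_piMr ?cmod_ge0//.
  exact: (le_trans (hle _ w1) (ltW w1)).
have e1E : e / (1 - cmod tau) ^- 2 = e1 *+ 3 by rewrite /e1 -mulr_natr divfK.
by rewrite e1E !mulrS mulr0n; lra.
Qed.

Lemma family_to_arc (al be s : R) z : cluster_phase (phase psi) = [set cis th | th in `[al, be]] ->
  0 <= s -> cmod z < 1 -> z <> tau ->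
  exists q (th0 : R), [/\ 0 < q, q <= cmod (mob tau z) &
    omega_limit phi s z = hyp_arc tau q (al + th0) (be + th0)].
Proof.
move=> clE s0 z1 zt; have [h [hd hi h00 hle hlim]] := asymptotics s0.
have w1 := cmod_mob_lt1 tau1 z1; pose w := mob tau z.
have wn0 : w <> 0.
  by move=> E; apply: zt; rewrite -(mobK tau1 z1) -/w E mob0.
have hn0 : h w != 0.
  apply/eqP => E; apply: wn0; apply: hi => //; last by rewrite E h00.
  by rewrite (_ : cmod 0 = 0)//; apply/eqP; rewrite cmod_eq0.
have [th0 _ hE] := polar (h w).
have q0 : 0 < cmod (h w) by rewrite cmod_gt0.
have q1 : cmod (h w) < 1 by apply: (le_lt_trans _ w1); exact: hle.
exists (cmod (h w)), th0; split => //; first exact: hle.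
have q01 : 0 < cmod (h w) < 1 by rewrite q0.
apply: (omega_limit_arc (sigma := phase psi)) => //.
  by move=> t st; case: phi_evol => /(_ s t s0 st)[_ h'] _ _ _; exact: h'.
move=> e e0; have r01 : 0 <= cmod w < 1 by rewrite cmod_ge0.
have [T sT HT] := hlim _ _ r01 e0; exists T => t Tt.
rewrite -hE (conj_familyE phi_evol tau1 s0 (le_trans sT Tt) z1) mobK//; first exact: HT.
by apply: psi_disk => //; exact: le_trans Tt.
Qed.

End NonDegenerate.

Lemma family_trichotomy : [\/ cvg_to_point phi tau, cvg_to_univalent phi |
  exists al be : R, al < be <= al + pi *+ 2 /\
    forall s z, 0 <= s -> cmod z < 1 -> z <> tau -> exists q (th0 : R),
      [/\ 0 < q, q <= cmod (mob tau z) &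
        omega_limit phi s z = hyp_arc tau q (al + th0) (be + th0)]].
Proof.
have [small|] := pselect (forall e, 0 < e -> exists2 T, 0 <= T & cmod (lam psi 0 T) < e).
  by constructor 1; exact: family_to_point.
move=> /existsNP[ell /not_implyP[ell0 H]].
have lam_ge t : 0 <= t -> ell <= cmod (lam psi 0 t).
  by move=> t0; rewrite leNgt; apply/negP => h; apply: H; exists t.
have ph1 := cmod_phase psi_diff psi_disk psi_comp psi0 psi_small.
have phc := phase_continuous psi_diff psi_disk psi_comp psi0 psi_small ell0 lam_ge.
have [[p p1 lim]|[al [be [ab clE]]]] := phase_limit_set ph1 phc.
  by constructor 2; exact: (family_to_univalent ell0 lam_ge p1 lim).
constructor 3; exists al, be; split=> // s z.
exact: (family_to_arc ell0 lam_ge clE).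
Qed.

(** The angle be - al is common to all s and z, so either all arcs are full or all are proper. In
    the second case the factor 2 q / (1 - q^2) of the length is the sinh in the definition of the
    extent, which is thus be - al. *)
Lemma arcs_of_limits (al be : R) : al < be <= al + pi *+ 2 ->
  (forall s z, 0 <= s -> cmod z < 1 -> z <> tau -> exists q (th0 : R),
      [/\ 0 < q, q <= cmod (mob tau z) &
        omega_limit phi s z = hyp_arc tau q (al + th0) (be + th0)]) ->
  omega_circles phi tau \/ omega_proper_arcs phi tau.
Proof.
move=> /andP[ab]; rewrite le_eqVlt => /predU1P[full|proper] H.
  left=> s z s0 z1 zt; have [q [th0 [q0 qz oE]]] := H s z s0 z1 zt.
  exists (hyp_radius q); first exact: admissible_hyp_radius.
  have q01 : 0 < q < 1 by rewrite q0 (le_lt_trans qz)// cmod_mob_lt1.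
  rewrite frontier_hyp_disk// circleE// oE; apply/seteqP; split=> w.
    move=> [th _ <-]; have c1 : cmod (q%:C * cis th) = q.
      by rewrite normcM cmod_real cmod_cis mulr1 gtr0_norm.
    have c2 : cmod (q%:C * cis th) < 1 by rewrite c1; case/andP: q01.
    by rewrite /= mobK// cmod_mob_lt1.
  (* Turning back by al + th0 + pi matches the polar angles in [- pi, pi] with the given interval of
     angles of length 2 pi. *)
  move=> [w1 wq]; pose v := mob tau w * cis (- (al + th0 + pi)).
  have [th /andP[h1 h2] E] := polar v.
  have vq : cmod v = q by rewrite normcM cmod_cis mulr1.
  exists (th + (al + th0 + pi)).
    by rewrite /= in_itv/= full mulr2n; apply/andP; split; lra.
  rewrite cisD mulrA -vq -E /v -mulrA -cisD addNr cis0 mulr1 mobK//.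
right; exists (be - al)%:E => s z s0 z1 zt; have [q [th0 [q0 qz oE]]] := H s z s0 z1 zt.
have q01 : 0 < q < 1 by rewrite q0 (le_lt_trans qz)// cmod_mob_lt1.
have hab : al + th0 < be + th0 <= al + th0 + pi *+ 2 by rewrite ltrD2r ab/=; lra.
have [y1 [y2 [ad pr len]]] := hyp_arcP tau1 q01 hab.
have fE := frontier_hyp_disk tau1 q01.
exists (hyp_radius q); split; first exact: admissible_hyp_radius.
- rewrite oE fE; exists (circ_center tau q), (circ_radius tau q), y1, y2; split => //.
  by apply: pr; lra.
- rewrite oE; exists (circ_center tau q), (circ_radius tau q), y1, y2; rewrite fE; split => //.
  have q1 : q < 1 by case/andP: q01.
  have d0 : 0 < 1 - q ^+ 2 by rewrite subr_gt0 expr_lt1// ltW.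
  rewrite len sinh_hyp_radius ?(ltW q0)//.
  have k0 : 2 * q / (1 - q ^+ 2) != 0 by rewrite gt_eqF// divr_gt0// mulr_gt0.
  rewrite inver (negbTE k0) -EFinM; congr EFin.
  by rewrite mulrAC divff// mul1r; ring.
Qed.

End Trichotomy.

(** * Mutual exclusion of the cases *)

Section Exclusions.
Context {R : realType}.
Local Notation C := R[i].
Variables (phi : R -> R -> C -> C) (tau : C).
Hypothesis tau1 : cmod tau < 1.

Lemma exists_other : exists2 z : C, cmod z < 1 & z <> tau.
Proof.
have [E|/eqP ne] := eqVneq tau 0; last first.
  exists 0; last by move=> E; apply: ne.
  by rewrite (_ : cmod 0 = 0)//; apply/eqP; rewrite cmod_eq0.
exists (2^-1)%:C; first by rewrite cmod_real gtr0_norm// invf_lt1// ltr1n.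
by rewrite E => /(congr1 (fun z : C => complex.Re z)) /= /eqP; rewrite invr_eq0 pnatr_eq0.
Qed.

Lemma point_not_univalent : ~ (cvg_to_point phi tau /\ cvg_to_univalent phi).
Proof.
move=> [H1 H2]; have [z z1 zt] := exists_other.
have [h [_ hi] Hh] := H2 0 (lexx 0).
have lim w : cmod w < 1 -> h w = tau.
  move=> w1; apply/eqP; rewrite -subr_eq0 -cmod_eq0 eq_le cmod_ge0 andbT.
  apply/ler_addgt0Pr => e e0; rewrite add0r; have e2 : 0 < e / 2 by rewrite divr_gt0.
  have [T HT] := cvg_on_compacts_point (H1 0 (lexx 0)) w1 e2.
  have [T' HT'] := cvg_on_compacts_point Hh w1 e2.
  have := HT (Num.max T T'); rewrite le_max lexx /= => /(_ isT) a1.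
  have := HT' (Num.max T T'); rewrite le_max lexx orbT => /(_ isT) a2.
  set x := phi _ _ _ in a1 a2; have -> : h w - tau = (x - tau) - (x - h w) by ring.
  by apply: (le_trans (cmodB _ _)); rewrite /cst in a1; lra.
by apply: zt; apply: (hi z tau z1 tau1); rewrite !lim.
Qed.

(** A convergent trajectory has only one limit point, whereas an arc has two. *)
Lemma arcs_not_cvg (h : C -> C) : cvg_on_compacts (phi 0 t @[t --> +oo]) h -> ~ omega_arcs phi tau.
Proof.
move=> H arcs; have [z z1 zt] := exists_other.
have [r _ /closed_arc_two[x [y [ox oy]]]] := arcs 0 z (lexx 0) z1 zt; apply.
have U := omega_limit_unique (cvg_on_compacts_point H z1).
by rewrite (U x ox) (U y oy).
Qed.

Lemma circles_arcs : omega_circles phi tau -> omega_arcs phi tau.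
Proof.
move=> H s z s0 z1 zt; have [r ar oE] := H s z s0 z1 zt; exists r => //.
have [q q01 [E _]] := frontier_hyp_diskE tau1 (proj1 ar).
by rewrite oE E; apply: circle_closed_arc; exact: circ_radius_gt0.
Qed.

Lemma proper_arcs_arcs : omega_proper_arcs phi tau -> omega_arcs phi tau.
Proof.
move=> [e H] s z s0 z1 zt; have [r [ar pa _]] := H s z s0 z1 zt.
by exists r => //; exact: proper_arc_closed.
Qed.

(** The two subcases may come with different radii for the same trajectory. A common point of the
    two circles makes the radii agree, and a proper arc is not its whole circle. *)
Lemma circles_not_proper : ~ (omega_circles phi tau /\ omega_proper_arcs phi tau).
Proof.
move=> [H1 [e H2]]; have [z z1 zt] := exists_other.
have [r1 a1 oE] := H1 0 z (lexx 0) z1 zt.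
have [r2 [a2 pa _]] := H2 0 z (lexx 0) z1 zt.
have [x [_ [ox _ _]]] := closed_arc_two (proper_arc_closed pa).
have [q1 _ [_ E1]] := frontier_hyp_diskE tau1 (proj1 a1).
have [q2 _ [_ E2]] := frontier_hyp_diskE tau1 (proj1 a2).
have xin : frontier (hyp_disk tau r2) x.
  case: pa => [p [q [th1 [th2 [[q0 SE _ AE] _]]]]]; rewrite SE; rewrite AE in ox.
  case: ox => th _ <-.
  by rewrite /circle /= circle_pathE addrC addKr normcM cmod_real cmod_cis mulr1 gtr0_norm.
have qq : q1 = q2.
  by move: xin ox; rewrite oE E1 E2 => -[_ <-] [_ <-].
by apply: (@proper_arc_neq _ (frontier (hyp_disk tau r2))); move: pa; rewrite oE E1 qq -E2.
Qed.

End Exclusions.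

Theorem theorem3p3 (R : realType) (phi : R -> R -> R[i] -> R[i]) (tau : R[i])
    (phi_evol : evolution_family phi)
    (phi_nontrivial : nontrivial_family phi)
    (tau_disk : unit_disk tau)
    (phi_tau : common_denjoy_wolff_point phi tau) :
  ((cvg_to_point phi tau \/ cvg_to_univalent phi \/ omega_arcs phi tau) /\
   ~ (cvg_to_point phi tau /\ cvg_to_univalent phi) /\
   ~ (cvg_to_point phi tau /\ omega_arcs phi tau) /\
   ~ (cvg_to_univalent phi /\ omega_arcs phi tau)) /\
  ((omega_arcs phi tau <->
    omega_circles phi tau \/ omega_proper_arcs phi tau) /\
   ~ (omega_circles phi tau /\ omega_proper_arcs phi tau)).
Proof.
(* The identity fixes tau anyway; for any other map the boundary alternative is excluded by |tau| <
   1. *)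
have phi_fix s t : 0 <= s -> s <= t -> phi s t tau = tau.
  move=> s0 st; have [idf|nidf] := pselect (is_identity (phi s t)); first exact: idf.
  have [_ /(_ s t s0 st nidf)[[]//|[_ t1 _]]] := phi_tau.
  by move: tau_disk; rewrite /unit_disk /= t1 ltxx.
have tau1 : cmod tau < 1 := tau_disk.
have pu := @point_not_univalent _ phi tau tau1.
have pa : ~ (cvg_to_point phi tau /\ omega_arcs phi tau).
  by move=> [H]; exact: (arcs_not_cvg (H 0 (lexx 0))).
have ua : ~ (cvg_to_univalent phi /\ omega_arcs phi tau).
  by move=> [H]; have [h _ Hh] := H 0 (lexx 0); exact: (arcs_not_cvg Hh).
have ca := @circles_arcs _ phi tau tau1.
have pra := @proper_arcs_arcs _ phi tau.
have cpr := @circles_not_proper _ phi tau tau1.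
have tri : [\/ cvg_to_point phi tau, cvg_to_univalent phi | omega_circles phi tau \/ omega_proper_arcs phi tau].
  have [h|h|[al [be [ab H]]]] := family_trichotomy phi_evol tau1 phi_fix; first by constructor 1.
    by constructor 2.
  by constructor 3; exact: (arcs_of_limits tau1 ab H).
split.
  split; last by [].
  by case: tri => [h|h|[/ca|/pra]]; [left|right; left|right; right..].
split=> //; split; last by case; [exact: ca|exact: pra].
move=> arcs; case: tri => [h|h|//].
  by case: pa.
by case: ua.
Qed.
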